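(* Let $0<|q|<1$ and let $z\ne 0$ be a fixed constant. The following functions are $q$-WZ seeds (in the variables listed): (1') in the variables $a,b$: \[ z^{b+k}\left[\begin{array}{c}q^{b+k}\\ q^{a+k}\end{array};q\right]_\infty\left[\begin{array}{c}q^{a-b+1}\\ zq^{a-b+1}\end{array};q\right]_\infty; \] (2') in the variables $a,b,c,d$: \[ (-1)^{c+d}q^{k+\binom{c+1}{2}+\binom{d+1}{2}-cd}\left[\begin{array}{c}q^{c+k},\,q^{d+k}\\ q^{a+k},\,q^{b+k}\end{array};q\right]_\infty\left[\begin{array}{c}q^{a-c+1},\,q^{a-d+1},\,q^{b-c+1},\,q^{b-d+1}\\ q^{a+b-c-d+2}\end{array};q\right]_\infty; \] (3') in the variables $a,b,c$: \[ (-1)^kq^{2ck+\binom{2c}{2}+4bc}\left[\begin{array}{c}q^{2c+2a+k},\,q^{2b+2c+k}\\ q^{2a+k},\,q^{2b+k}\end{array};q\right]_\infty\left[\begin{array}{c}-q^{2c}\\ q^{2c}\end{array};q\right]_\infty\left[\begin{array}{c}q^{2a-2b-2c+1}\\ q^{2a-2b+2c+1}\end{array};q^2\right]_\infty; \] (4') in the variables $a,b,c,d,e$: \[ (-1)^{d+e}q^{k+\binom{d+1}{2}+\binom{e+1}{2}-de}\left[\begin{array}{c}q^{d+k},\,q^{e+k},\,q^{a+b+c-d-e+2+k}\\ q^{a+k},\,q^{b+k},\,q^{c+k}\end{array};q\right]_\infty \] \[ \times\left[\begin{array}{c}q^{a-d+1},\,q^{a-e+1},\,q^{b-d+1},\,q^{b-e+1},\,q^{c-d+1},\,q^{c-e+1}\\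 q^{a+b-d-e+2},\,q^{a+c-d-e+2},\,q^{b+c-d-e+2}\end{array};q\right]_\infty. \]
   Context: $(x;q)_\infty=\prod_{i\ge0}(1-xq^i)$ and $\left[\begin{array}{c}a_1,\dots,a_r\\ b_1,\dots,b_s\end{array};q\right]_\infty=\frac{\prod_{i=1}^r(a_i;q)_\infty}{\prod_{j=1}^s(b_j;q)_\infty}$. $\binom{x}{2}=x(x-1)/2$ for any complex $x$. A term $F(n_1,\dots,n_r)$ is $q$-hypergeometric in $n_1,\dots,n_r$ if each ratio $F(\dots,n_i+1,\dots)/F(\dots,n_i,\dots)$ is a rational function of $q^{n_1},\dots,q^{n_r}$. Write $\Delta_n f(n)=f(n+1)-f(n)$. A $q$-hypergeometric term $G(n,k)$ is a $q$-WZ mate of $F(n,k)$ if $\Delta_nF(n,k)=\Delta_kG(n,k)$. A $q$-hypergeometric term $F_0(k,a,b,\dots)$ is a $q$-WZ seed in the variables $a,b,\dots$ if for all integers $K,A,B,\dots$, all complex $k_0$ and all parameter values, $F(n,k)=F_0(Kn+k_0+k,An+a,Bn+b,\dots)$ has a $q$-WZ mate. Factors $(-1)^x$, $z^x$, $q^x$ with non-integer exponent are understood as $q$-hypergeometric factors with $(-1)^{x+1}=-(-1)^x$, $z^{x+1}=z\,z^x$, $q^{x}$ defined via a fixed branch (e.g. $q^x=e^{x\log q}$). *)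

(* Defs.v *)
From Stdlib Require Import Reals ZArith List ClassicalEpsilon.
From Coquelicot Require Import Coquelicot.
Open Scope C_scope.

Definition Cexp (w : C) : C :=
  (exp (Re w) * cos (Im w), exp (Re w) * sin (Im w))%R.

(** Powers with complex exponent via a fixed logarithm:
    if q = Cexp lam then q^x := Cexp (x * lam).  Choosing [lam] is choosing
    the branch of log q. *)
Definition cpowL (lam x : C) : C := Cexp (x * lam).

(** (-1)^x := e^{i pi x} (a fixed branch; (-1)^(x+1) = -(-1)^x). *)
Definition mone_pow (x : C) : C := Cexp (x * (0%R, PI)).

Fixpoint Cpown (x : C) (n : nat) : C :=
  match n with O => RtoC 1 | S n' => x * Cpown x n' end.

Definition binom2 (x : C) : C := x * (x - RtoC 1) / RtoC 2.

Fixpoint pprod (x p : C) (n : nat) : C :=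
  match n with O => RtoC 1 | S n' => pprod x p n' * (RtoC 1 - x * Cpown p n') end.

(** (x;p)_infty : the limit of the partial products (chosen by epsilon;
    the limit exists whenever |p| < 1). *)
Definition qpoch (x p : C) : C :=
  epsilon (inhabits (RtoC 0))
    (fun L => filterlim (pprod x p) eventually (locally L)).

(** Multivariate polynomials over C in r variables: a degree bound N and a
    coefficient function on exponent lists. *)
Record mpoly := MPoly { mp_bound : nat; mp_coef : list nat -> C }.

Fixpoint Csum (n : nat) (f : nat -> C) : C :=
  match n with O => RtoC 0 | S n' => Csum n' f + f n' end.

Fixpoint mp_eval_aux (N : nat) (c : list nat -> C) (xs : list C) : C :=
  match xs with
  | nil => c nil
  | x :: xs' => Csum N (fun i => Cpown x i * mp_eval_aux N (fun l => c (i :: l)) xs')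
  end.

Definition mp_eval (p : mpoly) (xs : list C) : C :=
  mp_eval_aux (mp_bound p) (mp_coef p) xs.

Definition mp_nonzero (r : nat) (p : mpoly) : Prop :=
  exists es : list nat, length es = r /\ List.Forall (fun e => (e < mp_bound p)%nat) es
                        /\ mp_coef p es <> RtoC 0.

Fixpoint shift_at (i : nat) (xs : list C) : list C :=
  match xs, i with
  | nil, _ => nil
  | x :: xs', O => (x + RtoC 1) :: xs'
  | x :: xs', S i' => x :: shift_at i' xs'
  end.

(** F is q-hypergeometric in its r (complex) variables: each shift ratio
    F(..,x_i+1,..)/F(..) is a rational function P/Q of the q^{x_j}
    (stated in cross-multiplied form, generically, i.e. off the zero set of
    some nonzero polynomial D in the q^{x_j}). *)
Definition qhyper (lam : C) (r : nat) (F : list C -> C) : Prop :=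
  forall i, (i < r)%nat ->
  exists P Q D : mpoly, mp_nonzero r Q /\ mp_nonzero r D /\
    forall xs, length xs = r ->
      mp_eval D (map (cpowL lam) xs) <> RtoC 0 ->
      mp_eval Q (map (cpowL lam) xs) * F (shift_at i xs)
      = mp_eval P (map (cpowL lam) xs) * F xs.

Definition qZ (lam : C) (n : Z) : C := cpowL lam (RtoC (IZR n)).

Definition qhyperZ2 (lam : C) (F : Z -> Z -> C) : Prop :=
  (exists P Q D : mpoly, mp_nonzero 2 Q /\ mp_nonzero 2 D /\
    forall n k, mp_eval D (qZ lam n :: qZ lam k :: nil) <> RtoC 0 ->
      mp_eval Q (qZ lam n :: qZ lam k :: nil) * F (n + 1)%Z k
      = mp_eval P (qZ lam n :: qZ lam k :: nil) * F n k) /\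
  (exists P Q D : mpoly, mp_nonzero 2 Q /\ mp_nonzero 2 D /\
    forall n k, mp_eval D (qZ lam n :: qZ lam k :: nil) <> RtoC 0 ->
      mp_eval Q (qZ lam n :: qZ lam k :: nil) * F n (k + 1)%Z
      = mp_eval P (qZ lam n :: qZ lam k :: nil) * F n k).

(** G is a q-WZ mate of F: G q-hypergeometric and
    Delta_n F(n,k) = Delta_k G(n,k) (as an identity of terms, i.e. off the
    zero set of a nonzero polynomial in q^n, q^k). *)
Definition qWZ_mate (lam : C) (F G : Z -> Z -> C) : Prop :=
  qhyperZ2 lam G /\
  exists D : mpoly, mp_nonzero 2 D /\
    forall n k, mp_eval D (qZ lam n :: qZ lam k :: nil) <> RtoC 0 ->
      F (n + 1)%Z k - F n k = G n (k + 1)%Z - G n k.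

Definition has_qWZ_mate (lam : C) (F : Z -> Z -> C) : Prop :=
  exists G, qWZ_mate lam F G.

Definition qWZ_seed (lam : C) (m : nat) (F0 : C -> list C -> C) : Prop :=
  qhyper lam (S m) (fun xs => F0 (hd (RtoC 0) xs) (tl xs)) /\
  forall (K : Z) (As : list Z) (k0 : C) (ps : list C),
    length As = m -> length ps = m ->
    has_qWZ_mate lam (fun n k =>
      F0 (RtoC (IZR K) * RtoC (IZR n) + k0 + RtoC (IZR k))
         (map (fun Ap => RtoC (IZR (fst Ap)) * RtoC (IZR n) + snd Ap)
              (combine As ps))).

(** The four seeds.  q = Cexp lam, z = Cexp mu. *)
Section Seeds.
Variables lam mu : C.
Let qp (x : C) := cpowL lam x.
Let P (x : C) := qpoch x (Cexp lam).
Let P2 (x : C) := qpoch x (Cexp (RtoC 2 * lam)).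
Let one := RtoC 1.
Let two := RtoC 2.

Definition seed1 (k : C) (ps : list C) : C :=
  let a := nth 0 ps (RtoC 0) in let b := nth 1 ps (RtoC 0) in
  cpowL mu (b + k) * (P (qp (b + k)) / P (qp (a + k)))
  * (P (qp (a - b + one)) / P (Cexp mu * qp (a - b + one))).

Definition seed2 (k : C) (ps : list C) : C :=
  let a := nth 0 ps (RtoC 0) in let b := nth 1 ps (RtoC 0) in
  let c := nth 2 ps (RtoC 0) in let d := nth 3 ps (RtoC 0) in
  mone_pow (c + d) * qp (k + binom2 (c + one) + binom2 (d + one) - c * d)
  * (P (qp (c + k)) * P (qp (d + k)) / (P (qp (a + k)) * P (qp (b + k))))
  * (P (qp (a - c + one)) * P (qp (a - d + one)) * P (qp (b - c + one))
     * P (qp (b - d + one)) / P (qp (a + b - c - d + two))).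

Definition seed3 (k : C) (ps : list C) : C :=
  let a := nth 0 ps (RtoC 0) in let b := nth 1 ps (RtoC 0) in
  let c := nth 2 ps (RtoC 0) in
  mone_pow k * qp (two * c * k + binom2 (two * c) + RtoC 4 * b * c)
  * (P (qp (two * c + two * a + k)) * P (qp (two * b + two * c + k))
     / (P (qp (two * a + k)) * P (qp (two * b + k))))
  * (P (- qp (two * c)) / P (qp (two * c)))
  * (P2 (qp (two * a - two * b - two * c + one))
     / P2 (qp (two * a - two * b + two * c + one))).

Definition seed4 (k : C) (ps : list C) : C :=
  let a := nth 0 ps (RtoC 0) in let b := nth 1 ps (RtoC 0) in
  let c := nth 2 ps (RtoC 0) in let d := nth 3 ps (RtoC 0) in
  let e := nth 4 ps (RtoC 0) in
  mone_pow (d + e) * qp (k + binom2 (d + one) + binom2 (e + one) - d * e)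
  * (P (qp (d + k)) * P (qp (e + k)) * P (qp (a + b + c - d - e + two + k))
     / (P (qp (a + k)) * P (qp (b + k)) * P (qp (c + k))))
  * (P (qp (a - d + one)) * P (qp (a - e + one)) * P (qp (b - d + one))
     * P (qp (b - e + one)) * P (qp (c - d + one)) * P (qp (c - e + one))
     / (P (qp (a + b - d - e + two)) * P (qp (a + c - d - e + two))
        * P (qp (b + c - d - e + two)))).
End Seeds.

(* Main.v *)
(** The four seeds are products of q-Pochhammer symbols (g q^L; q)_oo over linear
    forms L, so that a unit shift in one variable multiplies them by a rational
    function of the q-powers.  For each variable x there is an explicit rational R
    with F(x+1) - F(x) = Delta_k (R F), and R, like the ratio F(x+1)/F(x), has
    poles only where a factor of F vanishes or F has a pole.  Telescoping unit
    shifts along a lattice path from (0,...,0) to (K,A,B,...) gives the mate G as a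
    rational multiple of F.

    The parameters are arbitrary, so a form L that is constant along the lattice
    may sit at a zero or a pole.  Then F vanishes identically (also at a pole,
    because / 0 = 0).  Otherwise increasing L creates neither a zero nor a pole,
    and both end points of the path are joined to a common point along which all
    such forms increase.  Finally R F is q-hypergeometric even if R may be zero,
    since a polynomial in q^n and q^k is either zero or generically nonzero. *)

Require Import Defs.
From Stdlib Require Import Reals ZArith List ClassicalEpsilon.
From Stdlib Require Import FunctionalExtensionality Lra Lia.
From Coquelicot Require Import Coquelicot.
Open Scope C_scope.

(** * Exponentials and q-Pochhammer symbols *)

(** The statement asks for identities only off the zero set of a nonzero polynomial in the q-powers.
    One calculus of generically valid rational ratios therefore serves twice: over complex tuples
    for [qhyper], and over integer pairs for the mates. Divided by F, the relation F(x+1) - F(x) =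
    Delta_k (R F) is an identity of rational functions, and the infinite products enter through
    (x;q)_oo = (1-x) (xq;q)_oo.

    Three families suffice: (2') is the degenerate case of (4') in which a scaling factor of q^c is
    zero, symmetries leave only the shifts of [a] and [d] in that family, and (1') depends on k + b
    and a - b alone.

    The main obstacle is (3'): raising [c] raises 2a-2b+2c+1 but lowers 2a-2b-2c+1, so neither
    direction of [c] suits both forms. A surplus in a - b, which raises both, is built up first and
    pays for the change of [c]. The symbols at q^(2c) and -q^(2c) are constant along the lattice
    only when [c] does not move at all. *)

Lemma Cexp_plus (u v : C) : Cexp (u + v) = Cexp u * Cexp v.
Proof.
  destruct u as [a b], v as [c d]; unfold Cexp; simpl.
  rewrite exp_plus, cos_plus, sin_plus.
  apply injective_projections; simpl; ring.
Qed.

Lemma Cexp_0 : Cexp 0 = 1.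
Proof.
  unfold Cexp; simpl. rewrite exp_0, cos_0, sin_0.
  apply injective_projections; simpl; ring.
Qed.

Lemma Cmod_Cexp (w : C) : Cmod (Cexp w) = exp (Re w).
Proof.
  unfold Cmod, Cexp; simpl fst; simpl snd.
  replace ((exp (Re w) * cos (Im w)) ^ 2 + (exp (Re w) * sin (Im w)) ^ 2)%R
    with (Rsqr (exp (Re w))).
  - apply sqrt_Rsqr, Rlt_le, exp_pos.
  - assert (H := sin2_cos2 (Im w)). unfold Rsqr in *.
    transitivity (exp (Re w) * exp (Re w)
                  * (sin (Im w) * sin (Im w) + cos (Im w) * cos (Im w)))%R;
      [rewrite H|]; ring.
Qed.

Lemma Cexp_neq0 (w : C) : Cexp w <> 0.
Proof. apply Cmod_gt_0. rewrite Cmod_Cexp. apply exp_pos. Qed.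

Lemma Cinv_0 : / (0 : C) = 0.
Proof.
  apply injective_projections; simpl; unfold Rdiv; ring.
Qed.

(* Also true at zero, thanks to the convention [/ 0 = 0]. *)
Lemma Cinv_mul (a b : C) : / (a * b) = / a * / b.
Proof.
  destruct (excluded_middle_informative (a = 0)) as [->|Ha].
  { now rewrite Cmult_0_l, Cinv_0, Cmult_0_l. }
  destruct (excluded_middle_informative (b = 0)) as [->|Hb].
  { now rewrite Cmult_0_r, Cinv_0, Cmult_0_r. }
  now field.
Qed.

Lemma pprod_S_l (x p : C) (n : nat) :
  pprod x p (S n) = (1 - x) * pprod (x * p) p n.
Proof.
  induction n as [|n IH]; [simpl; ring|].
  change (pprod x p (S n) * (1 - x * Cpown p (S n))
          = (1 - x) * (pprod (x * p) p n * (1 - x * p * Cpown p n))).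
  rewrite IH. simpl. ring.
Qed.

Lemma Cmod_Cpown (p : C) (n : nat) : Cmod (Cpown p n) = (Cmod p ^ n)%R.
Proof.
  induction n as [|n IH]; simpl; [apply Cmod_1|].
  now rewrite Cmod_mult, IH.
Qed.

(** Since 1 + t <= exp t, the product is at most the exponential of a geometric sum. The bound is
    uniform in [n], which makes the increments of the partial products summable. *)
Lemma Cmod_pprod_le (x p : C) (n : nat) : (Cmod p < 1)%R ->
  (Cmod (pprod x p n) <= exp (Cmod x / (1 - Cmod p)))%R.
Proof.
  intros Hp. set (r := Cmod p) in *.
  assert (Hr : (0 <= r)%R) by apply Cmod_ge_0.
  assert (Hx : (0 <= Cmod x)%R) by apply Cmod_ge_0.
  apply Rle_trans with (exp (Cmod x * ((1 - r ^ n) / (1 - r)))).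
  - induction n as [|n IH].
    + simpl. rewrite Cmod_1.
      replace (Cmod x * ((1 - 1) / (1 - r)))%R with 0%R by (field; lra).
      rewrite exp_0; lra.
    + simpl pprod. rewrite Cmod_mult.
      replace (Cmod x * ((1 - r ^ S n) / (1 - r)))%R
        with (Cmod x * ((1 - r ^ n) / (1 - r)) + Cmod x * r ^ n)%R
        by (simpl; field; lra).
      rewrite exp_plus.
      apply Rmult_le_compat; auto using Cmod_ge_0.
      apply Rle_trans with (1 + Cmod x * r ^ n)%R; [|apply exp_ineq1_le].
      unfold Cminus.
      eapply Rle_trans; [apply Cmod_triangle|].
      rewrite Cmod_1, Cmod_opp, Cmod_mult, Cmod_Cpown. apply Rle_refl.
  - assert (0 <= r ^ n)%R by now apply pow_le.
    assert (H1 : ((1 - r ^ n) / (1 - r) <= 1 / (1 - r))%R).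
    { apply Rmult_le_compat_r; [apply Rlt_le, Rinv_0_lt_compat; lra|lra]. }
    assert (H2 : (Cmod x * ((1 - r ^ n) / (1 - r)) <= Cmod x / (1 - r))%R).
    { unfold Rdiv at 2. rewrite <- (Rmult_1_l (/ (1 - r))).
      now apply Rmult_le_compat_l. }
    destruct H2 as [H2| ->]; [now apply Rlt_le, exp_increasing|apply Rle_refl].
Qed.

Lemma pprod_cv (x p : C) : (Cmod p < 1)%R ->
  exists L : C, filterlim (pprod x p) eventually (locally L).
Proof.
  intros Hp.
  (* The increments of the partial products: their series has the products as partial sums and is
     dominated by a geometric series. *)
  set (b := fun n => match n with
                     | O => 1 : C
                     | S m => pprod x p m * (- x * Cpown p m) end).
  assert (Hs : forall n, sum_n (G := C_NormedModule) b n = pprod x p n).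
  { induction n as [|n IH].
    - now rewrite sum_O.
    - rewrite sum_Sn, IH. simpl.
      change (pprod x p n + pprod x p n * (- x * Cpown p n)
              = pprod x p n * (1 - x * Cpown p n)). ring. }
  assert (Hb : ex_series (V := C_CompleteNormedModule) b).
  { apply (ex_series_incr_1 (V := C_NormedModule)).
    apply (ex_series_le (V := C_CompleteNormedModule)) with
      (fun n => scal (exp (Cmod x / (1 - Cmod p)) * Cmod x)%R (Cmod p ^ n)%R).
    - intros n. change (Cmod (b (S n)) <= exp (Cmod x / (1 - Cmod p)) * Cmod x * Cmod p ^ n)%R.
      simpl b. rewrite Cmod_mult, Cmod_mult, Cmod_opp, Cmod_Cpown, Rmult_assoc.
      apply Rmult_le_compat_r; [|now apply Cmod_pprod_le].
      apply Rmult_le_pos; [apply Cmod_ge_0|apply pow_le, Cmod_ge_0].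
    - apply (ex_series_scal (V := R_NormedModule)).
      apply ex_series_geom. rewrite Rabs_pos_eq; [assumption|apply Cmod_ge_0]. }
  destruct Hb as [L HL]. exists L.
  eapply filterlim_ext; [exact Hs|exact HL].
Qed.

Lemma qpoch_lim (x p : C) : (Cmod p < 1)%R ->
  filterlim (pprod x p) eventually (locally (qpoch x p)).
Proof.
  intros Hp. unfold qpoch. apply epsilon_spec. now apply pprod_cv.
Qed.

Lemma qpoch_unique (x p L : C) : (Cmod p < 1)%R ->
  filterlim (pprod x p) eventually (locally L) -> qpoch x p = L.
Proof.
  intros Hp HL.
  exact (filterlim_locally_unique (V := C_NormedModule) (pprod x p) _ _
           (qpoch_lim x p Hp) HL).
Qed.

Lemma qpoch_step (x p : C) : (Cmod p < 1)%R ->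
  qpoch x p = (1 - x) * qpoch (x * p) p.
Proof.
  intros Hp.
  apply (filterlim_locally_unique (V := C_NormedModule) (F := eventually)
           (fun n => pprod x p (S n))).
  - apply (filterlim_comp _ _ _ S (pprod x p) eventually eventually).
    + intros Q [N HN]. exists N. intros n Hn. apply HN. lia.
    + now apply qpoch_lim.
  - apply filterlim_ext with (fun n => (1 - x) * pprod (x * p) p n).
    { intros n. symmetry. apply pprod_S_l. }
    apply (filterlim_comp _ _ _ (pprod (x * p) p) (fun z : C => (1 - x) * z)
             eventually (locally (qpoch (x * p) p))).
    + now apply qpoch_lim.
    + exact (filterlim_scal_r (V := C_NormedModule) (1 - x) (qpoch (x * p) p)).
Qed.

(** Makes the symbols scaled by zero drop out when seed (2') is obtained from the family of (4'). *)
Lemma qpoch_0 (p : C) : (Cmod p < 1)%R -> qpoch 0 p = 1.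
Proof.
  intros Hp. apply qpoch_unique; [assumption|].
  apply filterlim_ext with (fun _ : nat => 1 : C).
  - induction x as [|n IH]; simpl; [reflexivity|]. rewrite <- IH. ring.
  - apply filterlim_const.
Qed.

(** * Polynomials in the q-powers of the variables *)

Fixpoint mono (es : list nat) (ys : list C) : C :=
  match es, ys with
  | e :: es', y :: ys' => Cpown y e * mono es' ys'
  | _, _ => 1
  end.

(** Lists of terms, with repetitions allowed, are closed under sums by concatenation and under
    products by pairing, with no degree bound to maintain. [coef_terms] and [terms_bound] convert
    them to [mpoly] at the end. *)
Fixpoint eval_terms (L : list (C * list nat)) (ys : list C) : C :=
  match L with
  | nil => 0
  | t :: L' => fst t * mono (snd t) ys + eval_terms L' ys
  end.

Fixpoint coef_terms (L : list (C * list nat)) (es : list nat) : C :=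
  match L with
  | nil => 0
  | t :: L' =>
      (if list_eq_dec Nat.eq_dec es (snd t) then fst t else 0) + coef_terms L' es
  end.

Lemma Csum_ext (n : nat) (f g : nat -> C) :
  (forall i, (i < n)%nat -> f i = g i) -> Csum n f = Csum n g.
Proof.
  induction n as [|n IH]; intros H; simpl; [reflexivity|].
  rewrite IH, (H n); auto.
Qed.

Lemma Csum_plus (n : nat) (f g : nat -> C) :
  Csum n (fun i => f i + g i) = Csum n f + Csum n g.
Proof. induction n as [|n IH]; simpl; [ring|rewrite IH; ring]. Qed.

Lemma Csum_0 (n : nat) (f : nat -> C) :
  (forall i, (i < n)%nat -> f i = 0) -> Csum n f = 0.
Proof.
  induction n as [|n IH]; intros H; simpl; [reflexivity|].
  rewrite IH, (H n); auto; ring.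
Qed.

Lemma Csum_single (n j : nat) (f : nat -> C) : (j < n)%nat ->
  (forall i, (i < n)%nat -> i <> j -> f i = 0) -> Csum n f = f j.
Proof.
  induction n as [|n IH]; intros Hj H; [lia|]. simpl.
  destruct (Nat.eq_dec j n) as [->|Hn].
  - rewrite Csum_0; [ring|]. intros i Hi. apply H; lia.
  - rewrite IH, (H n); try lia; [ring|]. intros i Hi Hij. apply H; lia.
Qed.

Lemma Csum_S_l (n : nat) (f : nat -> C) :
  Csum (S n) f = f O + Csum n (fun i => f (S i)).
Proof. induction n as [|n IH]; simpl in *; [ring|rewrite IH; ring]. Qed.

Lemma mp_eval_aux_ext (N : nat) (ys : list C) (c d : list nat -> C) :
  (forall es, c es = d es) -> mp_eval_aux N c ys = mp_eval_aux N d ys.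
Proof.
  revert c d; induction ys as [|y ys IH]; intros c d H; simpl; [apply H|].
  apply Csum_ext; intros i _. f_equal. apply IH. intros es; apply H.
Qed.

Lemma mp_eval_aux_0 (N : nat) (ys : list C) (c : list nat -> C) :
  (forall es, length es = length ys -> List.Forall (fun e => (e < N)%nat) es ->
     c es = 0) ->
  mp_eval_aux N c ys = 0.
Proof.
  revert c; induction ys as [|y ys IH]; intros c H; simpl; [now apply H|].
  apply Csum_0; intros i Hi. rewrite IH; [ring|].
  intros es Hl Hf. apply H; simpl; auto.
Qed.

Lemma mp_eval_aux_plus (N : nat) (ys : list C) (c d : list nat -> C) :
  mp_eval_aux N (fun es => c es + d es) ys
  = mp_eval_aux N c ys + mp_eval_aux N d ys.
Proof.
  revert c d; induction ys as [|y ys IH]; intros c d; simpl; [reflexivity|].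
  rewrite <- Csum_plus. apply Csum_ext; intros i _. rewrite IH. ring.
Qed.

Lemma mp_eval_aux_mono (N : nat) (es : list nat) (ys : list C) (a : C) :
  length es = length ys -> List.Forall (fun e => (e < N)%nat) es ->
  mp_eval_aux N (fun l => if list_eq_dec Nat.eq_dec l es then a else 0) ys
  = a * mono es ys.
Proof.
  revert ys; induction es as [|e es IH]; intros [|y ys] Hl Hf; try discriminate.
  - simpl. ring.
  - inversion Hf as [|e' es' He Hes]; subst. injection Hl as Hl.
    cbn [mp_eval_aux mono].
    rewrite (Csum_single _ e); [|assumption|].
    + rewrite (mp_eval_aux_ext N ys _
        (fun l => if list_eq_dec Nat.eq_dec l es then a else 0)).
      * rewrite IH; auto. ring.
      * intros l. destruct (list_eq_dec Nat.eq_dec (e :: l) (e :: es)),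
          (list_eq_dec Nat.eq_dec l es); congruence.
    + intros i _ Hi. rewrite mp_eval_aux_0; [ring|].
      intros l _ _. destruct (list_eq_dec Nat.eq_dec (i :: l) (e :: es));
        congruence.
Qed.

Lemma mp_eval_aux_terms (N : nat) (L : list (C * list nat)) (ys : list C) :
  List.Forall (fun t => length (snd t) = length ys) L ->
  List.Forall (fun t => List.Forall (fun e => (e < N)%nat) (snd t)) L ->
  mp_eval_aux N (coef_terms L) ys = eval_terms L ys.
Proof.
  induction L as [|t L IH]; intros Hl Hf; simpl.
  - now apply mp_eval_aux_0.
  - inversion Hl; inversion Hf; subst.
    rewrite mp_eval_aux_plus, mp_eval_aux_mono, IH; auto.
Qed.

Lemma terms_bound (L : list (C * list nat)) :
  exists N, List.Forall (fun t => List.Forall (fun e => (e < N)%nat) (snd t)) L.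
Proof.
  induction L as [|t L [N HN]]; [exists O; constructor|].
  exists (N + S (list_max (snd t)))%nat. constructor.
  - assert (H := proj1 (list_max_le (snd t) (list_max (snd t))) (le_n _)).
    eapply Forall_impl; [|exact H]. simpl; intros; lia.
  - eapply Forall_impl; [|exact HN]. simpl; intros u Hu.
    eapply Forall_impl; [|exact Hu]. simpl; intros; lia.
Qed.

(** If all coefficients below the bound vanish, so do all values. A single nonzero value thus
    certifies [mp_nonzero], and no coefficient of a product has to be computed. *)
Lemma mp_nonzero_of_eval (p : mpoly) (ys : list C) :
  mp_eval p ys <> 0 -> mp_nonzero (length ys) p.
Proof.
  intros H. apply NNPP; intros Hn. apply H.
  apply mp_eval_aux_0. intros es Hl Hf. apply NNPP; intros Hc.
  apply Hn. exists es; auto.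
Qed.

Lemma mono_plus (es fs : list nat) (ys : list C) :
  length es = length ys -> length fs = length ys ->
  mono (map (fun ef => (fst ef + snd ef)%nat) (combine es fs)) ys
  = mono es ys * mono fs ys.
Proof.
  revert fs ys; induction es as [|e es IH]; intros [|f fs] [|y ys] He Hf;
    try discriminate; simpl; [ring|].
  rewrite IH by (simpl in *; lia).
  replace (Cpown y (e + f)) with (Cpown y e * Cpown y f); [ring|].
  clear; induction e as [|e IH]; simpl; [ring|rewrite <- IH; ring].
Qed.

Lemma eval_terms_app (L M : list (C * list nat)) (ys : list C) :
  eval_terms (L ++ M) ys = eval_terms L ys + eval_terms M ys.
Proof. induction L as [|t L IH]; simpl; [ring|rewrite IH; ring]. Qed.

Definition mul_term (t u : C * list nat) : C * list nat :=
  (fst t * fst u,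
   map (fun ef => (fst ef + snd ef)%nat) (combine (snd t) (snd u))).

Definition mul_terms (L M : list (C * list nat)) : list (C * list nat) :=
  flat_map (fun t => map (mul_term t) M) L.

Lemma mul_terms_length (r : nat) (L M : list (C * list nat)) :
  List.Forall (fun t => length (snd t) = r) L ->
  List.Forall (fun t => length (snd t) = r) M ->
  List.Forall (fun t => length (snd t) = r) (mul_terms L M).
Proof.
  rewrite !Forall_forall. intros HL HM t Ht.
  apply in_flat_map in Ht as [u [Hu Ht]]. apply in_map_iff in Ht as [v [<- Hv]].
  simpl. rewrite length_map, length_combine, (HL u Hu), (HM v Hv). lia.
Qed.

Lemma eval_mul_terms (L M : list (C * list nat)) (ys : list C) :
  List.Forall (fun t => length (snd t) = length ys) L ->
  List.Forall (fun t => length (snd t) = length ys) M ->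
  eval_terms (mul_terms L M) ys = eval_terms L ys * eval_terms M ys.
Proof.
  intros HL HM; induction HL as [|t L Ht HL IH]; simpl; [ring|].
  unfold mul_terms in *; simpl. rewrite eval_terms_app, IH.
  replace (eval_terms (map (mul_term t) M) ys)
    with (fst t * mono (snd t) ys * eval_terms M ys); [ring|].
  clear IH. induction HM as [|u M Hu HM IH]; simpl; [ring|].
  rewrite <- IH, mono_plus by assumption. ring.
Qed.

(** * Generic identities and rational functions *)

(* The points at which the terms are evaluated, the vector of their q-powers,
   and a filter of large sets of points witnessing that a polynomial is not
   zero.  Complex variables use a principal filter, integer variables [n], [k]
   use a filter that is invariant under shifts. *)
Record frame := Frame {
  pt : Type;
  dom : pt -> Prop;
  dim : nat;
  vec : pt -> list C;
  large : (pt -> Prop) -> Prop;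
  vec_length : forall x, dom x -> length (vec x) = dim;
  large_and : forall A B : pt -> Prop,
    large A -> large B -> large (fun x => A x /\ B x);
  large_mono : forall A B : pt -> Prop,
    (forall x, dom x -> A x -> B x) -> large A -> large B;
  large_ex : forall A : pt -> Prop, large A -> exists x, dom x /\ A x;
  large_dom : large dom
}.

Section Generic.
Variable fr : frame.
Implicit Types f g h rho : pt fr -> C.
Implicit Types A B : pt fr -> Prop.

Definition polyf (f : pt fr -> C) : Prop :=
  exists L, List.Forall (fun t => length (snd t) = dim fr) L
    /\ forall x, dom fr x -> f x = eval_terms L (vec fr x).

Definition nz (f : pt fr -> C) : Prop := large fr (fun x => f x <> 0).

Definition generic (A : pt fr -> Prop) : Prop :=
  exists D, polyf D /\ nz D /\ forall x, dom fr x -> D x <> 0 -> A x.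

Definition ratl (rho : pt fr -> C) : Prop :=
  exists N D, polyf N /\ polyf D /\ nz D
    /\ forall x, dom fr x -> D x <> 0 -> D x * rho x = N x.

(** The ratio may be zero, which a mate requires; [ratio_of] below adds the nonvanishing that makes
    the relation reversible. *)
Definition rat (f g : pt fr -> C) : Prop :=
  exists rho, ratl rho /\ generic (fun x => f x = rho x * g x).

Lemma polyf_mpoly f : polyf f ->
  exists p, forall x, dom fr x -> mp_eval p (vec fr x) = f x.
Proof.
  intros [L [HL Hf]]. destruct (terms_bound L) as [N HN].
  exists (MPoly N (coef_terms L)). intros x Hx. rewrite Hf by assumption.
  apply mp_eval_aux_terms; simpl; [|assumption].
  now rewrite (vec_length fr x Hx).
Qed.

Lemma nz_mpoly f p : nz f ->
  (forall x, dom fr x -> mp_eval p (vec fr x) = f x) -> mp_nonzero (dim fr) p.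
Proof.
  intros Hf Hp. destruct (large_ex fr _ Hf) as [x [Hx Hfx]].
  rewrite <- (vec_length fr x Hx). apply mp_nonzero_of_eval.
  now rewrite Hp.
Qed.

Lemma polyf_const (a : C) : polyf (fun _ => a).
Proof.
  exists ((a, repeat O (dim fr)) :: nil). split.
  - constructor; [apply repeat_length|constructor].
  - intros x Hx. simpl.
    replace (mono (repeat O (dim fr)) (vec fr x)) with (1 : C); [ring|].
    rewrite <- (vec_length fr x Hx).
    induction (vec fr x) as [|y ys IH]; simpl; [reflexivity|].
    rewrite <- IH. ring.
Qed.

Lemma polyf_proj (i : nat) : (i < dim fr)%nat ->
  polyf (fun x => nth i (vec fr x) 0).
Proof.
  intros Hi.
  exists ((1 : C, map (fun j => if Nat.eq_dec j i then 1%nat else O)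
                  (seq 0 (dim fr))) :: nil). split.
  - constructor; [|constructor]. simpl. now rewrite length_map, length_seq.
  - intros x Hx. simpl.
    rewrite <- (vec_length fr x Hx) in Hi |- *.
    assert (H0 : forall s ys, (i < s)%nat ->
      mono (map (fun j => if Nat.eq_dec j i then 1%nat else O)
             (seq s (length ys))) ys = 1).
    { intros s ys; revert s; induction ys as [|y ys IH]; intros s Hs; simpl;
        [reflexivity|].
      destruct (Nat.eq_dec s i); [lia|]. rewrite IH by lia. simpl; ring. }
    assert (H : forall ys s, (s <= i)%nat -> (i - s < length ys)%nat ->
      mono (map (fun j => if Nat.eq_dec j i then 1%nat else O)
             (seq s (length ys))) ys = nth (i - s) ys 0).
    { induction ys as [|y ys IH]; intros s Hs Hl; simpl in *; [lia|].
      destruct (Nat.eq_dec s i) as [->|Hn].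
      - rewrite H0, Nat.sub_diag by lia. simpl; ring.
      - rewrite IH by lia. replace (i - s)%nat with (S (i - S s)) by lia.
        simpl; ring. }
    rewrite H by lia. rewrite Nat.sub_0_r. ring.
Qed.

Lemma polyf_plus f g : polyf f -> polyf g -> polyf (fun x => f x + g x).
Proof.
  intros [L [HL Hf]] [M [HM Hg]]. exists (L ++ M). split.
  - now apply Forall_app.
  - intros x Hx. now rewrite eval_terms_app, Hf, Hg.
Qed.

Lemma polyf_mult f g : polyf f -> polyf g -> polyf (fun x => f x * g x).
Proof.
  intros [L [HL Hf]] [M [HM Hg]]. exists (mul_terms L M). split.
  - now apply mul_terms_length.
  - intros x Hx. rewrite eval_mul_terms, Hf, Hg;
      rewrite ?(vec_length fr x Hx); auto.
Qed.

Lemma nz_mult f g : nz f -> nz g -> nz (fun x => f x * g x).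
Proof.
  intros Hf Hg. eapply large_mono; [|exact (large_and _ _ _ Hf Hg)].
  intros x _ [H1 H2]. now apply Cmult_neq_0.
Qed.

Lemma nz_pointwise f : (forall x, dom fr x -> f x <> 0) -> nz f.
Proof.
  intros H. eapply large_mono; [|exact (large_dom fr)]. intros x Hx _.
  now apply H.
Qed.

Lemma nz_ext f g : (forall x, dom fr x -> f x = g x) -> nz f -> nz g.
Proof.
  intros H. apply large_mono. intros x Hx. now rewrite H.
Qed.

Lemma nz_inv f : nz f -> nz (fun x => / f x).
Proof.
  apply large_mono. intros x _ Hf He. apply C1_nz.
  rewrite <- (Cinv_r _ Hf), He. ring.
Qed.

Lemma nz_div f g : nz f -> nz g -> nz (fun x => f x / g x).
Proof. intros Hf Hg. apply nz_mult; [|apply nz_inv]; assumption. Qed.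

Lemma nz_opp f : nz f -> nz (fun x => - f x).
Proof.
  apply large_mono. intros x _ Hf He. apply Hf.
  replace (f x) with (- - f x) by ring. rewrite He; ring.
Qed.

Lemma generic_all (A : pt fr -> Prop) :
  (forall x, dom fr x -> A x) -> generic A.
Proof.
  intros H. exists (fun _ => 1). repeat split; auto using polyf_const.
  apply nz_pointwise. intros; apply C1_nz.
Qed.

Lemma generic_and A B : generic A -> generic B ->
  generic (fun x => A x /\ B x).
Proof.
  intros [D [HD [Hn H]]] [D' [HD' [Hn' H']]].
  exists (fun x => D x * D' x). split; [|split]; auto using polyf_mult, nz_mult.
  intros x Hx Hd. split.
  - apply H; auto. intros H0; apply Hd; rewrite H0; ring.
  - apply H'; auto. intros H0; apply Hd; rewrite H0; ring.
Qed.

Lemma generic_mono (A B : pt fr -> Prop) :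
  (forall x, dom fr x -> A x -> B x) -> generic A -> generic B.
Proof. intros H [D [HD [Hn HA]]]. exists D; auto. Qed.

Lemma generic_imp A B : generic A -> generic (fun x => A x -> B x) -> generic B.
Proof.
  intros HA HB. eapply generic_mono; [|exact (generic_and _ _ HA HB)].
  simpl. intros x _ [H H']. auto.
Qed.

Lemma ratl_ext f g : (forall x, dom fr x -> f x = g x) -> ratl f -> ratl g.
Proof.
  intros H [N [D [HN [HD [Hn Hf]]]]]. exists N, D. repeat split; auto.
  intros x Hx Hd. rewrite <- H; auto.
Qed.

Lemma ratl_poly f : polyf f -> ratl f.
Proof.
  intros H. exists f, (fun _ => 1). repeat split; auto using polyf_const.
  - apply nz_pointwise. intros; apply C1_nz.
  - intros x _ _; ring.
Qed.

Lemma ratl_const (a : C) : ratl (fun _ => a).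
Proof. apply ratl_poly, polyf_const. Qed.

Lemma ratl_plus f g : ratl f -> ratl g -> ratl (fun x => f x + g x).
Proof.
  intros [N [D [HN [HD [Hn H]]]]] [N' [D' [HN' [HD' [Hn' H']]]]].
  exists (fun x => N x * D' x + N' x * D x), (fun x => D x * D' x).
  repeat split; auto using polyf_plus, polyf_mult, nz_mult.
  intros x Hx Hd. rewrite <- H, <- H'; auto.
  - ring.
  - intros H0; apply Hd; rewrite H0; ring.
  - intros H0; apply Hd; rewrite H0; ring.
Qed.

Lemma ratl_mult f g : ratl f -> ratl g -> ratl (fun x => f x * g x).
Proof.
  intros [N [D [HN [HD [Hn H]]]]] [N' [D' [HN' [HD' [Hn' H']]]]].
  exists (fun x => N x * N' x), (fun x => D x * D' x).
  repeat split; auto using polyf_mult, nz_mult.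
  intros x Hx Hd. rewrite <- H, <- H'; auto.
  - ring.
  - intros H0; apply Hd; rewrite H0; ring.
  - intros H0; apply Hd; rewrite H0; ring.
Qed.

Lemma ratl_opp f : ratl f -> ratl (fun x => - f x).
Proof.
  intros H. apply ratl_ext with (fun x => (- (1)) * f x); [intros; ring|].
  now apply ratl_mult; [apply ratl_const|].
Qed.

Lemma ratl_minus f g : ratl f -> ratl g -> ratl (fun x => f x - g x).
Proof. intros Hf Hg. apply ratl_plus; [|apply ratl_opp]; assumption. Qed.

Lemma ratl_inv f : ratl f -> nz f -> ratl (fun x => / f x).
Proof.
  intros [N [D [HN [HD [Hn H]]]]] Hf.
  (* The extra factor [D] keeps the points where [D] vanishes out of play, since [D x * f x = N x]
     is known only elsewhere. *)
  exists (fun x => D x * D x), (fun x => N x * D x).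
  repeat split; auto using polyf_mult.
  - eapply large_mono; [|exact (large_and _ _ _ Hn Hf)].
    intros x Hx [Hd H0]. rewrite <- H by assumption.
    auto using Cmult_neq_0.
  - intros x Hx Hd.
    assert (Hd1 : D x <> 0) by (intros H0; apply Hd; rewrite H0; ring).
    assert (Hf1 : f x <> 0).
    { intros H0; apply Hd. rewrite <- H, H0 by assumption. ring. }
    rewrite <- H by assumption. field. assumption.
Qed.

Lemma ratl_div f g : ratl f -> ratl g -> nz g -> ratl (fun x => f x / g x).
Proof. intros Hf Hg Hn. apply ratl_mult; [|apply ratl_inv]; assumption. Qed.

(** Passes from largeness in the filter to the complement of the zero set of one polynomial, here
    [D * N]. *)
Lemma generic_neq0 f : ratl f -> nz f -> generic (fun x => f x <> 0).
Proof.
  intros [N [D [HN [HD [Hn H]]]]] Hf.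
  exists (fun x => D x * N x). repeat split; auto using polyf_mult.
  - eapply large_mono; [|exact (large_and _ _ _ Hn Hf)].
    intros x Hx [Hd H0]. rewrite <- H by assumption.
    auto using Cmult_neq_0.
  - intros x Hx Hd H0. apply Hd.
    assert (Hd1 : D x <> 0) by (intros H1; apply Hd; rewrite H1; ring).
    rewrite <- H, H0 by assumption. ring.
Qed.

Definition ratio_of (f g rho : pt fr -> C) : Prop :=
  ratl rho /\ nz rho /\ generic (fun x => f x = rho x * g x).

Lemma ratio_of_rat f g rho : ratio_of f g rho -> rat f g.
Proof. intros [Hr [_ H]]. now exists rho. Qed.

Lemma rat_trans f g h : rat f g -> rat g h -> rat f h.
Proof.
  intros [r [Hr Hf]] [s [Hs Hg]]. exists (fun x => r x * s x).
  split; [now apply ratl_mult|].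
  eapply generic_mono; [|exact (generic_and _ _ Hf Hg)].
  simpl. intros x _ [-> ->]. ring.
Qed.

Lemma rat_ext f f' g g' : (forall x, dom fr x -> f x = f' x) ->
  (forall x, dom fr x -> g x = g' x) -> rat f' g' -> rat f g.
Proof.
  intros Hf Hg [r [Hr H]]. exists r. split; [assumption|].
  eapply generic_mono; [|exact H]. intros x Hx E. now rewrite Hf, Hg.
Qed.

Lemma rat_refl f : rat f f.
Proof.
  exists (fun _ => 1). split; [apply ratl_const|].
  apply generic_all. intros; ring.
Qed.

Lemma rat_plus f g h : rat f h -> rat g h -> rat (fun x => f x + g x) h.
Proof.
  intros [r [Hr Hf]] [s [Hs Hg]]. exists (fun x => r x + s x).
  split; [now apply ratl_plus|].
  eapply generic_mono; [|exact (generic_and _ _ Hf Hg)].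
  simpl. intros x _ [-> ->]. ring.
Qed.

Lemma rat_opp f h : rat f h -> rat (fun x => - f x) h.
Proof.
  intros [r [Hr Hf]]. exists (fun x => - r x).
  split; [now apply ratl_opp|].
  eapply generic_mono; [|exact Hf].
  simpl. intros x _ ->. ring.
Qed.

Lemma rat_inv f g rho : ratl rho -> nz rho ->
  generic (fun x => f x = rho x * g x) -> rat g f.
Proof.
  intros Hr Hn Hf. exists (fun x => / rho x). split; [now apply ratl_inv|].
  eapply generic_mono; [|exact (generic_and _ _ Hf (generic_neq0 _ Hr Hn))].
  simpl. intros x _ [-> H]. now field.
Qed.

Lemma rat_mpoly f g : rat f g ->
  exists P Q D : mpoly, mp_nonzero (dim fr) Q /\ mp_nonzero (dim fr) D
    /\ forall x, dom fr x -> mp_eval D (vec fr x) <> 0 ->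
         mp_eval Q (vec fr x) * f x = mp_eval P (vec fr x) * g x.
Proof.
  intros [r [[N [Q [HN [HQ [HnQ Hr]]]]] [D [HD [HnD Hf]]]]].
  destruct (polyf_mpoly _ HN) as [p Hp].
  destruct (polyf_mpoly _ HQ) as [q Hq].
  destruct (polyf_mpoly _ (polyf_mult _ _ HD HQ)) as [d Hd].
  exists p, q, d. split; [|split].
  - now apply nz_mpoly with Q.
  - apply nz_mpoly with (fun x => D x * Q x); [now apply nz_mult|assumption].
  - intros x Hx. rewrite Hp, Hq, Hd by assumption. intros H0.
    assert (D x <> 0) by (intros H1; apply H0; rewrite H1; ring).
    assert (Q x <> 0) by (intros H1; apply H0; rewrite H1; ring).
    rewrite (Hf x), <- (Hr x) by assumption. ring.
Qed.

Lemma generic_mpoly (A : pt fr -> Prop) : generic A ->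
  exists D : mpoly, mp_nonzero (dim fr) D
    /\ forall x, dom fr x -> mp_eval D (vec fr x) <> 0 -> A x.
Proof.
  intros [D [HD [Hn H]]]. destruct (polyf_mpoly _ HD) as [d Hd].
  exists d. split; [now apply nz_mpoly with D|].
  intros x Hx. rewrite Hd by assumption. auto.
Qed.

End Generic.

Arguments polyf {fr}. Arguments nz {fr}. Arguments generic {fr}.
Arguments ratl {fr}. Arguments rat {fr}. Arguments ratio_of {fr}.

(** * Terms of two integer variables *)

Section IntegerTerms.
Variable lam : C.
Hypothesis Hq : (Re lam < 0)%R.
Implicit Types T : Z * Z -> C.

(** The threshold for [n] may depend on [k]: q^n - q^k vanishes on the diagonal, so a common
    threshold for both variables would not detect nonzero polynomials. *)
Definition largeZ2 (A : Z * Z -> Prop) : Prop :=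
  exists M, forall k, (M <= k)%Z -> exists N, forall n, (N <= n)%Z -> A (n, k).

Definition frameZ2 : frame.
Proof.
  refine (Frame (Z * Z) (fun _ => True) 2
            (fun p => qZ lam (fst p) :: qZ lam (snd p) :: nil) largeZ2
            (fun _ _ => eq_refl) _ _ _ _).
  - intros A B [M HM] [M' HM']. exists (Z.max M M'). intros k Hk.
    destruct (HM k) as [N HN]; [lia|]. destruct (HM' k) as [N' HN']; [lia|].
    exists (Z.max N N'). intros n Hn. split; [apply HN|apply HN']; lia.
  - intros A B H [M HM]. exists M. intros k Hk. destruct (HM k Hk) as [N HN].
    exists N. auto.
  - intros A [M HM]. destruct (HM M) as [N HN]; [lia|].
    exists (N, M). split; [exact I|]. apply HN; lia.
  - exists 0%Z. intros; exists 0%Z; auto.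
Defined.

Definition sn (p : Z * Z) : Z * Z := ((fst p + 1)%Z, snd p).
Definition sk (p : Z * Z) : Z * Z := (fst p, (snd p + 1)%Z).

Lemma qZ_S (n : Z) : qZ lam (n + 1) = Cexp lam * qZ lam n.
Proof.
  unfold qZ, cpowL. rewrite <- Cexp_plus. f_equal.
  rewrite plus_IZR, RtoC_plus. ring.
Qed.

Lemma Cmod_qZ (n : Z) : Cmod (qZ lam n) = exp (IZR n * Re lam).
Proof.
  unfold qZ, cpowL. rewrite Cmod_Cexp. f_equal. simpl. unfold Re. ring.
Qed.

Lemma Cmod_qZ_small (eps : R) : (0 < eps)%R ->
  exists M, forall n, (M <= n)%Z -> (Cmod (qZ lam n) < eps)%R.
Proof.
  intros He. exists (up (ln eps / Re lam)). intros n Hn.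
  rewrite Cmod_qZ. rewrite <- (exp_ln eps He). apply exp_increasing.
  assert (H := proj1 (archimed (ln eps / Re lam))).
  apply IZR_le in Hn.
  assert (H1 : (ln eps / Re lam < IZR n)%R) by lra.
  apply (Rmult_lt_gt_compat_neg_l (Re lam)) in H1; [|assumption].
  replace (Re lam * (ln eps / Re lam))%R with (ln eps) in H1 by (field; lra).
  lra.
Qed.

Lemma Csum_bounded (N : nat) (a : nat -> C) :
  exists B, (0 < B)%R /\ forall y, (Cmod y <= 1)%R ->
    (Cmod (Csum N (fun i => Cpown y i * a i)%C) < B)%R.
Proof.
  induction N as [|N [B [HB H]]].
  - exists 1%R. split; [lra|]. intros y _. simpl. rewrite Cmod_0. lra.
  - exists (B + Cmod (a N))%R. assert (HN := Cmod_ge_0 (a N)).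
    split; [lra|]. intros y Hy. simpl.
    eapply Rle_lt_trans; [apply Cmod_triangle|].
    specialize (H y Hy). rewrite Cmod_mult, Cmod_Cpown.
    assert (Cmod y ^ N <= 1)%R.
    { rewrite <- (pow1 N). apply pow_incr. split; [apply Cmod_ge_0|assumption]. }
    assert (Cmod y ^ N * Cmod (a N) <= 1 * Cmod (a N))%R
      by now apply Rmult_le_compat_r.
    lra.
Qed.

(* The lowest coefficient dominates since q^n tends to 0. *)
Lemma univariate_nz (N : nat) (a : nat -> C) :
  (exists i, (i < N)%nat /\ a i <> 0) ->
  exists M, forall n, (M <= n)%Z ->
    Csum N (fun i => Cpown (qZ lam n) i * a i) <> 0.
Proof.
  revert a; induction N as [|N IH]; intros a [i [Hi Ha]]; [lia|].
  assert (HS : forall y, Csum (S N) (fun i => Cpown y i * a i)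
            = a O + y * Csum N (fun i => Cpown y i * a (S i))).
  { intros y. rewrite Csum_S_l. simpl.
    replace (Csum N (fun i0 => y * Cpown y i0 * a (S i0)))
      with (y * Csum N (fun i0 => Cpown y i0 * a (S i0))); [ring|].
    clear. induction N as [|N IH]; simpl; [ring|rewrite <- IH; ring]. }
  destruct (excluded_middle_informative (a O = 0)) as [H0|H0].
  - destruct (IH (fun i => a (S i))) as [M HM].
    { destruct i as [|i]; [contradiction|]. exists i. split; [lia|assumption]. }
    exists M. intros n Hn. rewrite HS, H0, Cplus_0_l.
    apply Cmult_neq_0; [apply Cexp_neq0|auto].
  - destruct (Csum_bounded N (fun i => a (S i))) as [B [HB HBd]].
    destruct (Cmod_qZ_small (Rmin 1 (Cmod (a O) / B))) as [M HM].
    { apply Rmin_pos; [lra|]. apply Rdiv_lt_0_compat; [|assumption].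
      now apply Cmod_gt_0. }
    exists M. intros n Hn Hz. rewrite HS in Hz. specialize (HM n Hn).
    set (y := qZ lam n) in *.
    assert (H1 := Rmin_l 1 (Cmod (a O) / B)).
    assert (H2 := Rmin_r 1 (Cmod (a O) / B)).
    assert (Hy : (Cmod y <= 1)%R) by lra. specialize (HBd y Hy).
    set (s := Csum N _) in *.
    assert (Ho : Cmod (a O) = (Cmod y * Cmod s)%R).
    { rewrite <- Cmod_mult, <- (Cmod_opp (y * s)). f_equal.
      replace (a O) with (a O + y * s - y * s) by ring. rewrite Hz. ring. }
    assert (Cmod y * B < Cmod (a O))%R.
    { replace (Cmod (a O)) with (Cmod (a O) / B * B)%R by (field; lra).
      apply Rmult_lt_compat_r; lra. }
    assert (Cmod y * Cmod s <= Cmod y * B)%R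
      by (apply Rmult_le_compat_l; [apply Cmod_ge_0|lra]).
    lra.
Qed.

(** Read [f] as a polynomial in q^n whose coefficients are polynomials in q^k. A coefficient that is
    not the zero polynomial is nonzero for large [k], and then [f] is nonzero for large [n]. *)
Lemma polyf_zero_or_nz (f : Z * Z -> C) : polyf (fr := frameZ2) f ->
  (forall p, f p = 0) \/ nz (fr := frameZ2) f.
Proof.
  intros Hf. destruct (polyf_mpoly frameZ2 f Hf) as [p Hp].
  set (N := mp_bound p). set (c := mp_coef p).
  assert (HE : forall n k, f (n, k)
    = Csum N (fun i => Cpown (qZ lam n) i
        * Csum N (fun j => Cpown (qZ lam k) j * c (i :: j :: nil)))).
  { intros n k. rewrite <- Hp by exact I. reflexivity. }
  destruct (excluded_middle_informative
    (exists i j, (i < N)%nat /\ (j < N)%nat /\ c (i :: j :: nil) <> 0))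
    as [[i [j [Hi [Hj Hc]]]]|Hn].
  - right. destruct (univariate_nz N (fun j => c (i :: j :: nil))) as [M HM].
    { exists j; auto. }
    exists M. intros k Hk.
    destruct (univariate_nz N (fun i =>
      Csum N (fun j => Cpown (qZ lam k) j * c (i :: j :: nil)))) as [M' HM'].
    { exists i; auto. }
    exists M'. intros n Hn. rewrite HE. auto.
  - left. intros [n k]. rewrite HE. apply Csum_0. intros i Hi.
    rewrite Csum_0; [ring|]. intros j Hj.
    destruct (excluded_middle_informative (c (i :: j :: nil) = 0)) as [->|H0];
      [ring|]. exfalso; apply Hn; exists i, j; auto.
Qed.

Lemma nz_shift (s : Z * Z -> Z * Z) (f : Z * Z -> C) :
  s = sn \/ s = sk -> nz (fr := frameZ2) f ->
  nz (fr := frameZ2) (fun p => f (s p)).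
Proof.
  intros [-> | ->] [M HM].
  - exists M. intros k Hk. destruct (HM k Hk) as [N HN]. exists N.
    intros n Hn. apply (HN (n + 1)%Z). lia.
  - exists M. intros k Hk. destruct (HM (k + 1)%Z) as [N HN]; [lia|].
    exists N. intros n Hn. now apply HN.
Qed.

Lemma polyf_shift (s : Z * Z -> Z * Z) (f : Z * Z -> C) :
  s = sn \/ s = sk -> polyf (fr := frameZ2) f ->
  polyf (fr := frameZ2) (fun p => f (s p)).
Proof.
  intros Hs [L [HL Hf]].
  assert (H : polyf (fr := frameZ2) (fun p => eval_terms L (vec frameZ2 (s p)))).
  { clear Hf. induction HL as [|t L Ht HL IH]; simpl.
    - apply polyf_const.
    - apply (polyf_plus frameZ2); [|exact IH].
      destruct t as [a [|e1 [|e2 [|]]]]; try discriminate Ht. simpl.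
      assert (Hm : forall x y e, Cpown (x * y) e = Cpown x e * Cpown y e).
      { intros x y e. induction e as [|e IHe]; simpl; [ring|].
        rewrite IHe; ring. }
      destruct Hs as [-> | ->].
      + exists ((a * Cpown (Cexp lam) e1, e1 :: e2 :: nil) :: nil). split.
        * constructor; [reflexivity|constructor].
        * intros [n k] _. simpl. rewrite qZ_S, Hm; ring.
      + exists ((a * Cpown (Cexp lam) e2, e1 :: e2 :: nil) :: nil). split.
        * constructor; [reflexivity|constructor].
        * intros [n k] _. simpl. rewrite qZ_S, Hm; ring. }
  destruct H as [L' [HL' H]]. exists L'. split; [assumption|].
  intros p _. rewrite Hf by exact I. now apply H.
Qed.

Lemma ratl_shift (s : Z * Z -> Z * Z) (f : Z * Z -> C) :
  s = sn \/ s = sk -> ratl (fr := frameZ2) f ->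
  ratl (fr := frameZ2) (fun p => f (s p)).
Proof.
  intros Hs [N [D [HN [HD [Hn H]]]]].
  exists (fun p => N (s p)), (fun p => D (s p)).
  split; [now apply polyf_shift|]. split; [now apply polyf_shift|].
  split; [now apply nz_shift|]. intros p _. now apply H.
Qed.

Lemma generic_shift (s : Z * Z -> Z * Z) (A : Z * Z -> Prop) :
  s = sn \/ s = sk -> generic (fr := frameZ2) A ->
  generic (fr := frameZ2) (fun p => A (s p)).
Proof.
  intros Hs [D [HD [Hn H]]]. exists (fun p => D (s p)).
  split; [now apply polyf_shift|]. split; [now apply nz_shift|].
  intros p _. now apply H.
Qed.

(* An equivalence relation, so that unit shifts in either direction can be
   chained. *)
Definition wz_equiv (T T' : Z * Z -> C) : Prop :=
  rat (fr := frameZ2) T' T /\ rat (fr := frameZ2) T T' /\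
  exists G, rat (fr := frameZ2) G T /\
    generic (fr := frameZ2) (fun p => T' p - T p = G (sk p) - G p).

Lemma wz_refl T : wz_equiv T T.
Proof.
  split; [apply rat_refl|split; [apply rat_refl|]].
  exists (fun _ => 0). split.
  - exists (fun _ => 0). split; [apply ratl_const|].
    apply (generic_all frameZ2). intros; ring.
  - apply (generic_all frameZ2). intros; ring.
Qed.

Lemma wz_sym T T' : wz_equiv T T' -> wz_equiv T' T.
Proof.
  intros [H1 [H2 [G [HG H]]]]. split; [assumption|split; [assumption|]].
  exists (fun p => - G p). split.
  - apply (rat_opp frameZ2). exact (rat_trans frameZ2 _ _ _ HG H2).
  - eapply (generic_mono frameZ2); [|exact H]. simpl. intros p _ Hp.
    replace (T p - T' p) with (- (T' p - T p)) by ring. rewrite Hp. ring.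
Qed.

Lemma wz_trans T T' T'' : wz_equiv T T' -> wz_equiv T' T'' -> wz_equiv T T''.
Proof.
  intros [H1 [H2 [G [HG H]]]] [H1' [H2' [G' [HG' H']]]].
  split; [exact (rat_trans frameZ2 _ _ _ H1' H1)|].
  split; [exact (rat_trans frameZ2 _ _ _ H2 H2')|].
  exists (fun p => G p + G' p). split.
  - apply (rat_plus frameZ2); [assumption|].
    exact (rat_trans frameZ2 _ _ _ HG' H1).
  - eapply (generic_mono frameZ2);
      [|exact (generic_and frameZ2 _ _ H H')]. simpl. intros p _ [Hp Hp'].
    replace (T'' p - T p) with ((T' p - T p) + (T'' p - T' p)) by ring.
    rewrite Hp, Hp'. ring.
Qed.

(** With [rho] the ratio T'/T and [kappa] the ratio of [T] in [k], division of T' - T = Delta_k (R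
    T) by [T] leaves the rational identity in the last hypothesis. *)
Lemma wz_certificate (T T' rho kappa R : Z * Z -> C) :
  ratio_of (fr := frameZ2) T' T rho ->
  ratio_of (fr := frameZ2) (fun p => T (sk p)) T kappa ->
  ratl (fr := frameZ2) R ->
  generic (fr := frameZ2) (fun p => rho p - 1 = R (sk p) * kappa p - R p) ->
  wz_equiv T T'.
Proof.
  intros [Hr [Hn H1]] [_ [_ H2]] HR H3.
  split; [now exists rho|]. split; [exact (rat_inv frameZ2 _ _ _ Hr Hn H1)|].
  exists (fun p => R p * T p). split.
  - exists R. split; [assumption|]. now apply (generic_all frameZ2).
  - eapply (generic_mono frameZ2);
      [|exact (generic_and frameZ2 _ _ H1 (generic_and frameZ2 _ _ H2 H3))].
    simpl. intros p _ [-> [-> Hc]].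
    replace (rho p * T p - T p) with ((rho p - 1) * T p) by ring.
    rewrite Hc. ring.
Qed.

(** The term [T] itself serves as mate, because its shift in [k] minus [T] is Delta_k T. *)
Lemma wz_shift_k (T kappa : Z * Z -> C) :
  ratio_of (fr := frameZ2) (fun p => T (sk p)) T kappa ->
  wz_equiv T (fun p => T (sk p)).
Proof.
  intros [Hr [Hn H]].
  split; [now exists kappa|]. split; [exact (rat_inv frameZ2 _ _ _ Hr Hn H)|].
  exists T. split; [apply rat_refl|]. now apply (generic_all frameZ2).
Qed.

(** The ratio of [G] is that of [F] times [rho (s p) / rho p]. Division by [rho] fails only if its
    numerator is the zero polynomial; then [G] and its shift vanish generically, and the ratio zero
    serves. *)
Lemma rat_shift_hyper (G F : Z * Z -> C) (s : Z * Z -> Z * Z) :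
  s = sn \/ s = sk -> rat (fr := frameZ2) (fun p => F (s p)) F ->
  rat (fr := frameZ2) G F -> rat (fr := frameZ2) (fun p => G (s p)) G.
Proof.
  intros Hs HF [rho [Hr HG]].
  assert (HGs : rat (fr := frameZ2) (fun p => G (s p)) F).
  { apply (rat_trans frameZ2 _ (fun p => F (s p))); [|assumption].
    exists (fun p => rho (s p)). split; [now apply ratl_shift|].
    exact (generic_shift s _ Hs HG). }
  destruct Hr as [N [D [HN [HD [Hn Hr]]]]].
  destruct (polyf_zero_or_nz N HN) as [H0|HN0].
  - exists (fun _ => 0). split; [apply ratl_const|].
    assert (HGz : generic (fr := frameZ2) (fun p => G p = 0)).
    { apply (generic_mono frameZ2) with
        (fun p => G p = rho p * F p /\ D p <> 0).
      - intros p _ [-> Hd]. specialize (Hr p I Hd). rewrite H0 in Hr.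
        replace (rho p) with (/ D p * (D p * rho p)) by now field.
        rewrite Hr. ring.
      - apply (generic_and frameZ2); [assumption|].
        now apply (generic_neq0 frameZ2); [apply ratl_poly|]. }
    eapply (generic_mono frameZ2); [|exact (generic_shift s _ Hs HGz)].
    simpl. intros p _ ->. ring.
  - apply (rat_trans frameZ2 _ F); [assumption|].
    apply (rat_inv frameZ2 G F rho); [now exists N, D| |assumption].
    eapply (large_mono frameZ2); [|exact (large_and frameZ2 _ _ HN0 Hn)].
    simpl. intros p _ [H1 H2] H3. apply H1.
    rewrite <- (Hr p I H2), H3. ring.
Qed.

Lemma mate_of_wz_equiv (F : Z -> Z -> C) :
  rat (fr := frameZ2) (fun p => F (fst (sk p)) (snd (sk p)))
    (fun p => F (fst p) (snd p)) ->
  wz_equiv (fun p => F (fst p) (snd p))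
    (fun p => F (fst (sn p)) (snd (sn p))) ->
  has_qWZ_mate lam F.
Proof.
  intros Hk [Hn [_ [G [HG H]]]].
  exists (fun n k => G (n, k)). split; [split|].
  - destruct (rat_mpoly frameZ2 _ _
      (rat_shift_hyper G _ sn (or_introl eq_refl) Hn HG))
      as [P [Q [D [HQ [HD He]]]]].
    exists P, Q, D. split; [assumption|split; [assumption|]].
    intros n k. exact (He (n, k) I).
  - destruct (rat_mpoly frameZ2 _ _
      (rat_shift_hyper G _ sk (or_intror eq_refl) Hk HG))
      as [P [Q [D [HQ [HD He]]]]].
    exists P, Q, D. split; [assumption|split; [assumption|]].
    intros n k. exact (He (n, k) I).
  - destruct (generic_mpoly frameZ2 _ H) as [D [HD He]].
    exists D. split; [assumption|]. intros n k. exact (He (n, k) I).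
Qed.

Lemma has_mate_ext (F F' : Z -> Z -> C) :
  (forall n k, F n k = F' n k) -> has_qWZ_mate lam F' -> has_qWZ_mate lam F.
Proof.
  intros H. replace F with F'; [auto|].
  apply functional_extensionality; intros n.
  apply functional_extensionality; intros k. symmetry; apply H.
Qed.

Lemma mate_of_zero (F : Z -> Z -> C) :
  (forall n k, F n k = 0) -> has_qWZ_mate lam F.
Proof.
  intros H0. apply mate_of_wz_equiv.
  - exists (fun _ => 0). split; [apply ratl_const|].
    apply (generic_all frameZ2). intros p _. rewrite H0. ring.
  - assert (Hr : forall f g : Z * Z -> C, (forall p, f p = 0) ->
      (forall p, g p = 0) -> rat (fr := frameZ2) f g).
    { intros f g Hf Hg. exists (fun _ => 0). split; [apply ratl_const|].
      apply (generic_all frameZ2). intros p _. rewrite Hf. ring. }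
    split; [now apply Hr; intros|]. split; [now apply Hr; intros|].
    exists (fun _ => 0). split; [now apply Hr; intros|].
    apply (generic_all frameZ2). intros p _. rewrite !H0. ring.
Qed.

End IntegerTerms.

(** * Rational functions of q-powers *)

Section Powers.
Variable lam : C.
Hypothesis Hq : (Re lam < 0)%R.
Notation qp := (cpowL lam).

Lemma cpowL_plus (mu x y : C) : cpowL mu (x + y) = cpowL mu x * cpowL mu y.
Proof. unfold cpowL. rewrite <- Cexp_plus. f_equal. ring. Qed.

Lemma cpowL_0 (mu : C) : cpowL mu 0 = 1.
Proof. unfold cpowL. rewrite Cmult_0_l. apply Cexp_0. Qed.

Lemma cpowL_neq0 (mu x : C) : cpowL mu x <> 0.
Proof. apply Cexp_neq0. Qed.

Lemma cpowL_opp (mu x : C) : cpowL mu (- x) = / cpowL mu x.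
Proof.
  assert (H : cpowL mu x * cpowL mu (- x) = 1).
  { rewrite <- cpowL_plus, Cplus_opp_r. apply cpowL_0. }
  replace (cpowL mu (- x)) with (/ cpowL mu x * (cpowL mu x * cpowL mu (- x))).
  - rewrite H. ring.
  - field. apply cpowL_neq0.
Qed.

Lemma cpowL_minus (mu x y : C) : cpowL mu (x - y) = cpowL mu x / cpowL mu y.
Proof. unfold Cminus. rewrite cpowL_plus, cpowL_opp. reflexivity. Qed.

Lemma cpowL_1 (mu : C) : cpowL mu 1 = Cexp mu.
Proof. unfold cpowL. f_equal. ring. Qed.

Lemma cpowL_2 (mu : C) : cpowL mu 2 = Cexp mu * Cexp mu.
Proof. rewrite <- Cexp_plus. unfold cpowL. f_equal. ring. Qed.

Lemma mone_pow_S (x : C) : mone_pow (x + 1) = - mone_pow x.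
Proof.
  unfold mone_pow. replace ((x + 1) * (0%R, PI)) with (x * (0%R, PI) + (0%R, PI))
    by ring.
  rewrite Cexp_plus. replace (Cexp (0%R, PI)) with (- (1) : C); [ring|].
  unfold Cexp; simpl. rewrite exp_0, cos_PI, sin_PI.
  apply injective_projections; simpl; ring.
Qed.

Lemma Cmod_cpowL (x : C) : Cmod (qp x) = exp (Re (x * lam)).
Proof. apply Cmod_Cexp. Qed.

Section Frame.
Variable fr : frame.
Implicit Types f g h : pt fr -> C.

Lemma nz_qp h : nz (fr := fr) (fun x => qp (h x)).
Proof. apply nz_pointwise. intros; apply cpowL_neq0. Qed.

Lemma ratl_qp_plus f g : ratl (fr := fr) (fun x => qp (f x)) ->
  ratl (fr := fr) (fun x => qp (g x)) ->
  ratl (fr := fr) (fun x => qp (f x + g x)).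
Proof.
  intros Hf Hg. apply ratl_ext with (fun x => qp (f x) * qp (g x)).
  - intros; symmetry; apply cpowL_plus.
  - now apply ratl_mult.
Qed.

Lemma ratl_qp_opp f : ratl (fr := fr) (fun x => qp (f x)) ->
  ratl (fr := fr) (fun x => qp (- f x)).
Proof.
  intros Hf. apply ratl_ext with (fun x => / qp (f x)).
  - intros; symmetry; apply cpowL_opp.
  - apply ratl_inv; [assumption|apply nz_qp].
Qed.

Lemma ratl_qp_minus f g : ratl (fr := fr) (fun x => qp (f x)) ->
  ratl (fr := fr) (fun x => qp (g x)) ->
  ratl (fr := fr) (fun x => qp (f x - g x)).
Proof. intros Hf Hg. apply ratl_qp_plus; [|apply ratl_qp_opp]; assumption. Qed.

Lemma ratl_qp_double f : ratl (fr := fr) (fun x => qp (f x)) ->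
  ratl (fr := fr) (fun x => qp (2 * f x)).
Proof.
  intros Hf. apply ratl_ext with (fun x => qp (f x + f x)).
  - intros; f_equal; ring.
  - now apply ratl_qp_plus.
Qed.

End Frame.

(** * The frame of complex variables *)

(** Here [nz f] just means [f x0 <> 0]. One test point at which no relevant factor vanishes
    certifies that all polynomials involved are nonzero. *)
Definition frameC (x0 : list C) : frame.
Proof.
  refine (Frame (list C) (fun xs => length xs = length x0) (length x0)
            (map qp) (fun A => A x0) _ _ _ _ _).
  - intros xs <-. apply length_map.
  - auto.
  - intros A B H. now apply H.
  - intros A H. now exists x0.
  - reflexivity.
Defined.

Lemma ratl_frameC_nth (x0 : list C) (i : nat) : (i < length x0)%nat ->
  ratl (fr := frameC x0) (fun xs => qp (nth i xs 0)).
Proof.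
  intros Hi. apply ratl_ext with (fun xs => nth i (map qp xs) 0).
  - intros xs Hx. simpl in Hx. rewrite <- Hx in Hi.
    rewrite (nth_indep (map qp xs) 0 (qp 0)) by now rewrite length_map.
    apply map_nth.
  - apply ratl_poly. exact (polyf_proj (frameC x0) i Hi).
Qed.

Lemma qhyper_of_rat (x0 : list C) (F : list C -> C) :
  (forall i, (i < length x0)%nat ->
     rat (fr := frameC x0) (fun xs => F (shift_at i xs)) F) ->
  qhyper lam (length x0) F.
Proof.
  intros H i Hi. destruct (rat_mpoly _ _ _ (H i Hi)) as [P [Q [D H']]].
  exists P, Q, D. exact H'.
Qed.

Lemma factor_neq0 (g x : C) :
  (Cmod g * exp (Re (x * lam)) <> 1)%R -> 1 - g * qp x <> 0.
Proof.
  intros H H0. apply H. rewrite <- Cmod_cpowL, <- Cmod_mult.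
  replace (g * qp x) with (1 - (1 - g * qp x)) by ring. rewrite H0.
  replace (1 - 0) with (1 : C) by ring. apply Cmod_1.
Qed.

(** For real x > 0 the modulus of q^x is below 1. Nonvanishing at a real test point thereby reduces
    to positivity of linear forms. *)
Lemma factor_neq0_real (g x : C) : Im g = 0%R -> (-1 <= Re g <= 1)%R ->
  Im x = 0%R -> (0 < Re x)%R -> 1 - g * qp x <> 0.
Proof.
  intros Hg [Hg0 Hg1] Hx Hx0. apply factor_neq0.
  replace g with (RtoC (Re g)) by (apply injective_projections; auto).
  rewrite Cmod_R. assert (Ha := Rabs_le _ _ (conj Hg0 Hg1)).
  assert (exp (Re (x * lam)) < 1)%R.
  { rewrite <- exp_0. apply exp_increasing. destruct x, lam. simpl in *. nra. }
  assert (He := exp_pos (Re (x * lam))).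
  apply (Rmult_le_compat_r _ _ _ (Rlt_le _ _ He)) in Ha. change (IPR 1) with 1%R in Ha. intros E; lra.
Qed.

(** * Affine functions of the integer variables *)

Notation frZ := (frameZ2 lam).

Definition affine (u v : Z) (h : Z * Z -> C) : Prop :=
  exists l : C, forall p, h p = RtoC (IZR u) * RtoC (IZR (fst p))
                              + RtoC (IZR v) * RtoC (IZR (snd p)) + l.

(** Each q-Pochhammer argument of the seeds either omits [k] or contains it with coefficient one.
    Only those of the first kind can be constant along the lattice. *)
Definition in_n (h : Z * Z -> C) : Prop := exists u, affine u 0 h.
Definition in_nk (h : Z * Z -> C) : Prop := exists u, affine u 1 h.

Lemma affine_plus u v u' v' f g : affine u v f -> affine u' v' g ->
  affine (u + u') (v + v') (fun p => f p + g p).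
Proof.
  intros [l H] [l' H']. exists (l + l'). intros p.
  rewrite H, H', !plus_IZR, !RtoC_plus. ring.
Qed.

Lemma affine_opp u v f : affine u v f -> affine (- u) (- v) (fun p => - f p).
Proof.
  intros [l H]. exists (- l). intros p.
  rewrite H, !opp_IZR, !RtoC_opp. ring.
Qed.

Lemma affine_const (c : C) : affine 0 0 (fun _ => c).
Proof. exists c. intros p. ring. Qed.

Lemma in_n_const (c : C) : in_n (fun _ => c).
Proof. exists 0%Z. apply affine_const. Qed.

Lemma in_n_plus f g : in_n f -> in_n g -> in_n (fun p => f p + g p).
Proof.
  intros [u H] [v H']. exists (u + v)%Z. exact (affine_plus _ _ _ _ _ _ H H').
Qed.

Lemma in_n_minus f g : in_n f -> in_n g -> in_n (fun p => f p - g p).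
Proof.
  intros Hf [v H']. apply in_n_plus; [assumption|].
  exists (- v)%Z. exact (affine_opp _ _ _ H').
Qed.

Lemma in_n_double f : in_n f -> in_n (fun p => 2 * f p).
Proof.
  intros H. assert (H' := in_n_plus _ _ H H).
  replace (fun p => 2 * f p) with (fun p => f p + f p); [assumption|].
  apply functional_extensionality. intros p. ring.
Qed.

Lemma in_nk_plus_l f g : in_n f -> in_nk g -> in_nk (fun p => f p + g p).
Proof.
  intros [u H] [v H']. exists (u + v)%Z. exact (affine_plus _ _ _ _ _ _ H H').
Qed.

Lemma in_nk_plus_r f g : in_nk f -> in_n g -> in_nk (fun p => f p + g p).
Proof.
  intros [u H] [v H']. exists (u + v)%Z. exact (affine_plus _ _ _ _ _ _ H H').
Qed.

Lemma in_n_sk h p : in_n h -> h (sk p) = h p.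
Proof. intros [u [l H]]. rewrite !H. simpl. ring. Qed.

Lemma in_nk_sk h p : in_nk h -> h (sk p) = h p + 1.
Proof.
  intros [u [l H]]. rewrite !H. simpl. rewrite plus_IZR, RtoC_plus. ring.
Qed.

Lemma ratl_qp_IZR (u : Z) (f : Z * Z -> C) :
  ratl (fr := frZ) (fun p => qp (f p)) ->
  ratl (fr := frZ) (fun p => qp (RtoC (IZR u) * f p)).
Proof.
  intros Hf.
  assert (HN : forall n : nat,
    ratl (fr := frZ) (fun p => qp (RtoC (INR n) * f p))).
  { induction n as [|n IH].
    - apply ratl_ext with (fun _ => 1); [|apply ratl_const].
      intros p _. simpl INR. rewrite Cmult_0_l. symmetry; apply cpowL_0.
    - apply ratl_ext with (fun p => qp (RtoC (INR n) * f p + f p)).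
      + intros p _. f_equal. rewrite S_INR, RtoC_plus. ring.
      + exact (ratl_qp_plus frZ _ _ IH Hf). }
  destruct (Z_le_gt_dec 0 u) as [Hu|Hu].
  - rewrite <- (Z2Nat.id u Hu), <- INR_IZR_INZ. apply HN.
  - replace u with (- Z.of_nat (Z.to_nat (- u)))%Z by lia.
    apply ratl_ext with (fun p => qp (- (RtoC (INR (Z.to_nat (- u))) * f p))).
    + intros p _. f_equal. rewrite opp_IZR, RtoC_opp, <- INR_IZR_INZ. ring.
    + exact (ratl_qp_opp frZ _ (HN _)).
Qed.

Lemma ratl_affine u v h : affine u v h -> ratl (fr := frZ) (fun p => qp (h p)).
Proof.
  intros [l H].
  apply ratl_ext with (fun p => qp (RtoC (IZR u) * RtoC (IZR (fst p))
                              + RtoC (IZR v) * RtoC (IZR (snd p)) + l)).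
  { intros p _. now rewrite H. }
  apply (ratl_qp_plus frZ (fun p => RtoC (IZR u) * RtoC (IZR (fst p))
                              + RtoC (IZR v) * RtoC (IZR (snd p))) (fun _ => l));
    [|apply ratl_const].
  apply (ratl_qp_plus frZ (fun p => RtoC (IZR u) * RtoC (IZR (fst p)))
                          (fun p => RtoC (IZR v) * RtoC (IZR (snd p))));
    apply ratl_qp_IZR; apply ratl_poly.
  - exact (polyf_proj frZ 0 (Nat.lt_0_succ 1)).
  - exact (polyf_proj frZ 1 (Nat.lt_succ_diag_r 1)).
Qed.

Lemma ratl_in_n h : in_n h -> ratl (fr := frZ) (fun p => qp (h p)).
Proof. intros [u H]. exact (ratl_affine _ _ _ H). Qed.

Lemma ratl_in_nk h : in_nk h -> ratl (fr := frZ) (fun p => qp (h p)).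
Proof. intros [u H]. exact (ratl_affine _ _ _ H). Qed.

(** The modulus of q^m is strictly monotone in [m] because [Re lam < 0], so a factor vanishes for at
    most one integer [m]. *)
Lemma cpowL_IZR_inj (g l : C) (m m' : Z) :
  1 - g * qp (RtoC (IZR m) + l) = 0 -> 1 - g * qp (RtoC (IZR m') + l) = 0 ->
  m = m'.
Proof.
  intros H H'. destruct (Z.eq_dec m m') as [|Hm]; [assumption|exfalso].
  assert (E : forall x, 1 - g * qp x = 0 -> (Cmod g * exp (Re (x * lam)) = 1)%R).
  { intros x Hx. apply NNPP. intros Hn. now apply (factor_neq0 g x Hn). }
  apply E in H. apply E in H'.
  assert (Hg : (Cmod g <> 0)%R) by (intros Hg; rewrite Hg in H; lra).
  assert (He : exp (Re ((RtoC (IZR m) + l) * lam))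
             = exp (Re ((RtoC (IZR m') + l) * lam))).
  { apply (Rmult_eq_reg_l (Cmod g)); [lra|assumption]. }
  apply exp_inv in He. simpl in He.
  assert (H0 : ((IZR m - IZR m') * fst lam = 0)%R) by lra.
  apply Rmult_integral in H0 as [H0|H0].
  - apply Hm, eq_IZR. lra.
  - unfold Re in Hq. lra.
Qed.

(** The factor depends on [u * n + v * k] only and vanishes for at most one value of it. If [u] is
    zero, large [k] avoids that value; otherwise, for each [k], large [n] does. *)
Lemma nz_affine (g : C) u v h : affine u v h -> (u <> 0 \/ v <> 0)%Z ->
  nz (fr := frZ) (fun p => 1 - g * qp (h p)).
Proof.
  intros [l H] Huv.
  assert (HE : forall n k, h (n, k) = RtoC (IZR (u * n + v * k)) + l).
  { intros n k. rewrite H. simpl. rewrite plus_IZR, !mult_IZR, RtoC_plus, !RtoC_mult.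
    ring. }
  assert (Hex : exists m, forall m', m' <> m ->
    1 - g * qp (RtoC (IZR m') + l) <> 0).
  { destruct (excluded_middle_informative
      (exists m, 1 - g * qp (RtoC (IZR m) + l) = 0)) as [[m Hm]|Hn].
    - exists m. intros m' Hm' H0. apply Hm'. now apply (cpowL_IZR_inj g l).
    - exists 0%Z. intros m' _ H0. apply Hn. now exists m'. }
  destruct Hex as [m Hm].
  destruct (Z.eq_dec u 0) as [->|Hu].
  - exists (Z.abs m + 1)%Z. intros k Hk. exists 0%Z. intros n _.
    rewrite HE. apply Hm. nia.
  - exists 0%Z. intros k _. exists (Z.abs (m - v * k) + 1)%Z. intros n Hn.
    rewrite HE. apply Hm. nia.
Qed.

Lemma nz_in_nk (g : C) h : in_nk h -> nz (fr := frZ) (fun p => 1 - g * qp (h p)).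
Proof. intros [u H]. apply (nz_affine g u 1); [assumption|]. right; lia. Qed.

(** * Regular forms *)

(* The infinite product [(g q^h; q^s)_oo] has no factor that vanishes
   identically.  A factor can only do so when [h] is constant. *)
Definition regular (s g : C) (h : Z * Z -> C) : Prop :=
  forall j : nat, nz (fr := frZ) (fun p => 1 - g * qp (h p + s * RtoC (INR j))).

Lemma regular_nz s g h : regular s g h ->
  nz (fr := frZ) (fun p => 1 - g * qp (h p)).
Proof.
  intros H. eapply (nz_ext frZ); [|exact (H O)]. simpl. intros p _.
  do 3 f_equal. ring.
Qed.

(** Raising the form by [n] steps of size [s] only removes the first [n] factors of the product. *)
Lemma regular_up s g h h' (n : nat) :
  (forall p, h' p = h p + s * RtoC (INR n)) -> regular s g h -> regular s g h'.
Proof.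
  intros Hh H j. eapply (nz_ext frZ); [|exact (H (n + j)%nat)].
  simpl. intros p _. rewrite Hh, plus_INR, RtoC_plus. do 3 f_equal. ring.
Qed.

Lemma regular_sn s g h : regular s g h -> regular s g (fun p => h (sn p)).
Proof.
  intros H j. exact (nz_shift lam sn _ (or_introl eq_refl) (H j)).
Qed.

Lemma Cmod_Cexp_lt1 (s : R) : (0 < s)%R -> (Cmod (Cexp (RtoC s * lam)) < 1)%R.
Proof.
  intros Hs. rewrite Cmod_Cexp, <- exp_0. apply exp_increasing. simpl.
  unfold Re in Hq. nra.
Qed.

Lemma qpoch_cpowL_step (s : R) (g l : C) : (0 < s)%R ->
  qpoch (g * qp l) (Cexp (RtoC s * lam))
  = (1 - g * qp l) * qpoch (g * qp (l + RtoC s)) (Cexp (RtoC s * lam)).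
Proof.
  intros Hs. rewrite qpoch_step by now apply Cmod_Cexp_lt1.
  rewrite cpowL_plus, Cmult_assoc. reflexivity.
Qed.

(** A nonconstant form is regular by [nz_affine]. For a constant form, peeling off factors one by
    one shows that a nonzero product has no vanishing factor. *)
Lemma regular_or_vanishing (s : R) g h : (0 < s)%R -> in_n h ->
  regular (RtoC s) g h
  \/ forall p, qpoch (g * qp (h p)) (Cexp (RtoC s * lam)) = 0.
Proof.
  intros Hs [u Hu].
  destruct (Z.eq_dec u 0) as [Hu0|Hu0].
  - subst u. destruct Hu as [l Hl].
    assert (Hc : forall p, h p = l) by (intros p; rewrite Hl; ring).
    destruct (excluded_middle_informative
      (qpoch (g * qp l) (Cexp (RtoC s * lam)) = 0)) as [H0|H0].
    + right. intros p. now rewrite Hc.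
    + left. intros j. apply (nz_pointwise frZ). intros p _. rewrite Hc.
      assert (HP : qpoch (g * qp (l + RtoC s * RtoC (INR j)))
                     (Cexp (RtoC s * lam)) <> 0).
      { induction j as [|j IH].
        - simpl INR. now rewrite Cmult_0_r, Cplus_0_r.
        - intros HS. apply IH. rewrite qpoch_cpowL_step by assumption.
          rewrite <- Cplus_assoc.
          replace (RtoC s * RtoC (INR j) + RtoC s)
            with (RtoC s * RtoC (INR (S j)))
            by (rewrite S_INR, RtoC_plus; ring).
          rewrite HS. ring. }
      intros H1. apply HP. rewrite qpoch_cpowL_step by assumption.
      rewrite H1. ring.
  - left. intros j. apply (nz_affine g u 0); [|now left].
    destruct Hu as [l Hl]. exists (l + RtoC s * RtoC (INR j)).
    intros p. rewrite Hl. ring.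
Qed.

Lemma wz_iter (T : nat -> Z * Z -> C) (n : nat) :
  (forall i, (i < n)%nat -> wz_equiv lam (T i) (T (S i))) ->
  wz_equiv lam (T O) (T n).
Proof.
  induction n as [|n IH]; intros H; [apply wz_refl|].
  exact (wz_trans lam _ _ _ (IH (fun i Hi => H i (Nat.lt_lt_succ_r _ _ Hi)))
           (H n (Nat.lt_succ_diag_r n))).
Qed.

(** The step is required only for [i < n]: in seed (3') the parameter [c] may be raised over a
    bounded range only. *)
Lemma wz_raise (T : (Z * Z -> C) -> Z * Z -> C) (a : Z * Z -> C) (n : nat) :
  (forall i, (i < n)%nat ->
     wz_equiv lam (T (fun p => a p + RtoC (INR i)))
                  (T (fun p => a p + RtoC (INR i) + 1))) ->
  wz_equiv lam (T a) (T (fun p => a p + RtoC (INR n))).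
Proof.
  intros H. replace (T a) with (T (fun p => a p + RtoC (INR 0))).
  - apply (wz_iter (fun n => T (fun p => a p + RtoC (INR n)))). intros i Hi.
    replace (fun p => a p + RtoC (INR (S i)))
      with (fun p => a p + RtoC (INR i) + 1); [now apply H|].
    apply functional_extensionality; intros p. rewrite S_INR, RtoC_plus. ring.
  - f_equal. apply functional_extensionality; intros p; simpl; ring.
Qed.

Lemma wz_lower (T : (Z * Z -> C) -> Z * Z -> C) (a : Z * Z -> C) :
  (forall i, wz_equiv lam (T (fun p => a p - RtoC (INR (S i))))
                          (T (fun p => a p - RtoC (INR (S i)) + 1))) ->
  forall n, wz_equiv lam (T a) (T (fun p => a p - RtoC (INR n))).
Proof.
  intros H n. replace (T a) with (T (fun p => a p - RtoC (INR 0))).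
  - apply (wz_iter (fun n => T (fun p => a p - RtoC (INR n)))). intros i _.
    apply wz_sym. replace (fun p => a p - RtoC (INR i))
      with (fun p => a p - RtoC (INR (S i)) + 1); [apply H|].
    apply functional_extensionality; intros p. rewrite S_INR, RtoC_plus. ring.
  - f_equal. apply functional_extensionality; intros p; simpl; ring.
Qed.

Lemma RtoC_INR_to_nat (m : Z) : (0 <= m)%Z ->
  RtoC (INR (Z.to_nat m)) = RtoC (IZR m).
Proof. intros Hm. now rewrite INR_IZR_INZ, Z2Nat.id. Qed.

(** For negative [K] the end points trade places, so unit steps upwards suffice and [ok] need only
    be stable under raising. *)
Lemma wz_translate (T : (Z * Z -> C) -> Z * Z -> C) (ok : (Z * Z -> C) -> Prop) :
  (forall a (i : nat), ok a -> ok (fun p => a p + RtoC (INR i))) ->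
  (forall a, ok a -> wz_equiv lam (T a) (T (fun p => a p + 1))) ->
  forall (K : Z) a a', ok a -> ok a' -> (forall p, a' p = a p + RtoC (IZR K)) ->
  wz_equiv lam (T a) (T a').
Proof.
  intros Hok H K a a' Ha Ha' Hp.
  assert (HN : forall a, ok a -> forall n,
    wz_equiv lam (T a) (T (fun p => a p + RtoC (INR n)))).
  { intros b Hb n. apply wz_raise. intros i _. apply (H (fun p => b p + RtoC (INR i))).
    now apply Hok. }
  destruct (Z_le_gt_dec 0 K) as [HK|HK].
  - replace a' with (fun p => a p + RtoC (INR (Z.to_nat K))); [now apply HN|].
    apply functional_extensionality; intros p. now rewrite Hp, RtoC_INR_to_nat.
  - apply wz_sym. replace a with (fun p => a' p + RtoC (INR (Z.to_nat (- K))));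
      [now apply HN|].
    apply functional_extensionality; intros p.
    rewrite Hp, RtoC_INR_to_nat, opp_IZR, RtoC_opp by lia. ring.
Qed.

Lemma wz_translate_k (T : (Z * Z -> C) -> Z * Z -> C) :
  (forall k, in_nk k -> wz_equiv lam (T k) (T (fun p => k p + 1))) ->
  forall (K : Z) k k', in_nk k -> in_nk k' ->
  (forall p, k' p = k p + RtoC (IZR K)) -> wz_equiv lam (T k) (T k').
Proof.
  apply wz_translate. intros k i Hk. apply in_nk_plus_r; [assumption|].
  apply in_n_const.
Qed.

(** * Parameters depending linearly on [n] *)

Definition lin (A : Z) (a : C) (p : Z * Z) : C :=
  RtoC (IZR A) * RtoC (IZR (fst p)) + a.

Definition link (K : Z) (k0 : C) (p : Z * Z) : C :=
  RtoC (IZR K) * RtoC (IZR (fst p)) + k0 + RtoC (IZR (snd p)).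

Lemma lin_sn A a p : lin A a (sn p) = lin A a p + RtoC (IZR A).
Proof. unfold lin. simpl. rewrite plus_IZR, RtoC_plus. ring. Qed.

Lemma link_sn K k0 p : link K k0 (sn p) = link K k0 p + RtoC (IZR K).
Proof. unfold link. simpl. rewrite plus_IZR, RtoC_plus. ring. Qed.

Lemma in_n_lin A a : in_n (lin A a).
Proof. exists A, a. intros p. unfold lin. ring. Qed.

Lemma in_nk_link K k0 : in_nk (link K k0).
Proof. exists K, k0. intros p. unfold link. ring. Qed.

Lemma in_n_lin_sn A a : in_n (fun p => lin A a (sn p)).
Proof.
  exists A, (RtoC (IZR A) + a). intros p. rewrite lin_sn. unfold lin. ring.
Qed.

Lemma in_nk_link_sn K k0 : in_nk (fun p => link K k0 (sn p)).
Proof.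
  exists K, (RtoC (IZR K) + k0). intros p. rewrite link_sn. unfold link. ring.
Qed.

(** The end point at [n + 1] raised by [M - A] meets the one at [n] raised by [M]. The bound on [A]
    makes both lifts natural numbers. *)
Lemma lin_sn_raise (M A : Z) a : (Z.abs A <= M)%Z ->
  (fun p => lin A a (sn p) + RtoC (INR (Z.to_nat (M - A))))
  = (fun p => lin A a p + RtoC (INR (Z.to_nat M))).
Proof.
  intros HA. apply functional_extensionality; intros p.
  rewrite lin_sn, !RtoC_INR_to_nat, minus_IZR, RtoC_minus by lia. ring.
Qed.

Lemma lin_sn_lower (M A : Z) a : (Z.abs A <= M)%Z ->
  (fun p => lin A a (sn p) - RtoC (INR (Z.to_nat (M + A))))
  = (fun p => lin A a p - RtoC (INR (Z.to_nat M))).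
Proof.
  intros HA. apply functional_extensionality; intros p.
  rewrite lin_sn, !RtoC_INR_to_nat, plus_IZR, RtoC_plus by lia. ring.
Qed.

End Powers.

(** * Tactics for rationality, generic factors and affine forms *)

Ltac ratl_tac :=
  repeat (cbv beta; first
  [ assumption
  | lazymatch goal with
    | |- @ratl ?F (fun x => cpowL _ (@?f x + @?g x)) => apply (ratl_qp_plus _ F f g)
    | |- @ratl ?F (fun x => cpowL _ (@?f x - @?g x)) => apply (ratl_qp_minus _ F f g)
    | |- @ratl ?F (fun x => cpowL _ (RtoC 2 * @?f x)) => apply (ratl_qp_double _ F f)
    | |- @ratl ?F (fun x => @?f x + @?g x) => apply (ratl_plus F f g)
    | |- @ratl ?F (fun x => @?f x - @?g x) => apply (ratl_minus F f g)
    | |- @ratl ?F (fun x => @?f x * @?g x) => apply (ratl_mult F f g)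
    | |- @ratl ?F (fun x => @?f x / @?g x) => apply (ratl_div F f g)
    | |- @ratl ?F (fun x => - @?f x) => apply (ratl_opp F f)
    | |- @nz ?F (fun x => cpowL _ (@?f x)) => apply (nz_qp _ F f)
    | |- @nz ?F (fun x => @?f x * @?g x) => apply (nz_mult F f g)
    | |- @nz ?F (fun x => @?f x / @?g x) => apply (nz_div F f g)
    | |- @nz ?F (fun x => - @?f x) => apply (nz_opp F f)
    | |- @nz ?F (fun _ => Cexp ?w) => apply (nz_pointwise F); intros; apply Cexp_neq0
    | |- @ratl ?F (fun _ => ?c) => apply (ratl_const F c)
    end ]).

(** Each [nz] hypothesis of the context becomes a pointwise premise [f x <> 0]; what is left is an
    ordinary identity at a point. *)
Ltac generic_factors :=
  repeat match goal with
  | H : @nz ?F ?f |- @generic ?F _ =>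
      refine (generic_imp F _ _ (generic_neq0 F f _ H) _); [ratl_tac|]; clear H
  end;
  lazymatch goal with |- @generic ?F _ => apply (generic_all F) end; cbv beta.

Ltac form_tac :=
  repeat (cbv beta; first
  [ assumption
  | lazymatch goal with
    | |- in_n (fun x => @?f x + @?g x) => apply (in_n_plus f g)
    | |- in_n (fun x => @?f x - @?g x) => apply (in_n_minus f g)
    | |- in_n (fun x => RtoC 2 * @?f x) => apply (in_n_double f)
    | |- in_nk (fun x => @?f x + @?g x) =>
        first [ apply (in_nk_plus_l f g); [solve [form_tac]|]
              | apply (in_nk_plus_r f g); [|solve [form_tac]] ]
    | |- in_n (fun _ => ?c) => apply (in_n_const c)
    end ]).

(** * Seeds (2') and (4') *)

(** [field] asks for nonvanishing of factors with denominators cleared, such as d - g1 a q in place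
    of 1 - g1 (a/d) q; [m] is the monomial between the two. *)
Lemma neq0_scale (m x y : C) : m <> 0 -> x <> 0 -> y = m * x -> y <> 0.
Proof. intros Hm Hx ->. now apply Cmult_neq_0. Qed.

Ltac side_cond m :=
  first
  [ assumption
  | cbv beta;
    match goal with
    | H : ?Y <> _ |- ?X <> _ =>
        apply (neq0_scale m Y X);
        [ repeat apply Cmult_neq_0; first [assumption | apply C1_nz]
        | exact H
        | field; repeat split; assumption ]
    end ].

#[local] Hint Rewrite cpowL_plus cpowL_minus cpowL_1 cpowL_2 : cpow.

Section S4.
Variable lam : C.
Hypothesis Hq : (Re lam < 0)%R.
Notation qp := (cpowL lam).
Notation Q := (Cexp lam).

Definition Pq (g l : C) : C := qpoch (g * qp l) Q.

Lemma Pq_step g l l' : l' = l + 1 -> Pq g l = (1 - g * qp l) * Pq g l'.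
Proof.
  intros ->. unfold Pq. assert (H := qpoch_cpowL_step lam Hq 1 g l Rlt_0_1).
  now rewrite Cmult_1_l in H.
Qed.

Lemma Pq_up g l l' : l' = l + 1 -> 1 - g * qp l <> 0 ->
  Pq g l' = Pq g l / (1 - g * qp l).
Proof. intros H Hn. rewrite (Pq_step g l l' H). now field. Qed.

(** Valid even if the factor is zero, by [Cinv_mul]. Lowering an argument is thus unconditional,
    also in a denominator, whereas raising it divides by a factor. *)
Lemma Pq_inv_step g l l' : l' = l + 1 -> / Pq g l = / (1 - g * qp l) * / Pq g l'.
Proof. intros H. rewrite (Pq_step g l l' H). apply Cinv_mul. Qed.

Lemma Pq_inv_up g l l' : l' = l + 1 -> 1 - g * qp l <> 0 ->
  / Pq g l' = (1 - g * qp l) * / Pq g l.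
Proof.
  intros H Hn. rewrite (Pq_inv_step g l l' H), Cmult_assoc, Cinv_r by assumption.
  ring.
Qed.

Lemma regular_or_Pq_zero g h : in_n h ->
  regular lam 1 g h \/ forall p, Pq g (h p) = 0.
Proof.
  intros Hh.
  destruct (regular_or_vanishing lam Hq 1 g h Rlt_0_1 Hh) as [H|H];
    [now left|right].
  intros p. unfold Pq. rewrite <- (H p). do 2 f_equal. ring.
Qed.

(* [g1], [g2], [g3] scale q^a, q^b, q^c.  Seed (4') is the case 1, 1, 1, and
   seed (2') is the case 1, 1, 0, where [c] drops out. *)
Definition S4 (g1 g2 g3 k a b c d e : C) : C :=
  mone_pow (d + e) * qp (k + binom2 (d + 1) + binom2 (e + 1) - d * e)
  * (Pq 1 (d + k) * Pq 1 (e + k) * Pq (g1 * g2 * g3) (a + b + c - d - e + 2 + k)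
     * (/ Pq g1 (a + k) * / Pq g2 (b + k) * / Pq g3 (c + k)))
  * (Pq g1 (a - d + 1) * Pq g1 (a - e + 1) * Pq g2 (b - d + 1)
     * Pq g2 (b - e + 1) * Pq g3 (c - d + 1) * Pq g3 (c - e + 1)
     * (/ Pq (g1 * g2) (a + b - d - e + 2) * / Pq (g1 * g3) (a + c - d - e + 2)
        * / Pq (g2 * g3) (b + c - d - e + 2))).

(** With the two symmetries that follow, all five parameters are covered by the shifts of [a] and
    [d]. *)
Lemma S4_swap_ab g1 g2 g3 k a b c d e :
  S4 g1 g2 g3 k a b c d e = S4 g2 g1 g3 k b a c d e.
Proof.
  unfold S4. rewrite (Cplus_comm b a), (Cmult_comm g2 g1). ring.
Qed.

Lemma S4_swap_ac g1 g2 g3 k a b c d e :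
  S4 g1 g2 g3 k a b c d e = S4 g3 g2 g1 k c b a d e.
Proof.
  unfold S4. replace (g3 * g2 * g1) with (g1 * g2 * g3) by ring.
  replace (c + b + a) with (a + b + c) by ring.
  rewrite (Cplus_comm c b), (Cplus_comm b a), (Cplus_comm c a),
    (Cmult_comm g3 g2), (Cmult_comm g2 g1), (Cmult_comm g3 g1). ring.
Qed.

Lemma S4_swap_de g1 g2 g3 k a b c d e :
  S4 g1 g2 g3 k a b c d e = S4 g1 g2 g3 k a b c e d.
Proof.
  unfold S4. rewrite (Cplus_comm e d).
  replace (k + binom2 (e + 1) + binom2 (d + 1) - e * d)
    with (k + binom2 (d + 1) + binom2 (e + 1) - d * e) by ring.
  replace (a + b + c - e - d + 2 + k) with (a + b + c - d - e + 2 + k) by ring.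
  replace (a + b - e - d + 2) with (a + b - d - e + 2) by ring.
  replace (a + c - e - d + 2) with (a + c - d - e + 2) by ring.
  replace (b + c - e - d + 2) with (b + c - d - e + 2) by ring.
  ring.
Qed.

(** * Shift ratios and certificates of the common family of (2') and (4') *)

Definition S4_ratio_k (g1 g2 g3 k a b c d e : C) : C :=
  Q * (1 - g1 * qp (a + k)) * (1 - g2 * qp (b + k)) * (1 - g3 * qp (c + k))
  / ((1 - 1 * qp (d + k)) * (1 - 1 * qp (e + k))
     * (1 - (g1 * g2 * g3) * qp (a + b + c - d - e + 2 + k))).

Definition S4_ratio_a (g1 g2 g3 k a b c d e : C) : C :=
  (1 - g1 * qp (a + k)) * (1 - (g1 * g2) * qp (a + b - d - e + 2))
  * (1 - (g1 * g3) * qp (a + c - d - e + 2))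
  / ((1 - (g1 * g2 * g3) * qp (a + b + c - d - e + 2 + k))
     * (1 - g1 * qp (a - d + 1)) * (1 - g1 * qp (a - e + 1))).

Definition S4_ratio_d (g1 g2 g3 k a b c d e : C) : C :=
  - (Q * (qp d / qp e))
  * ((1 - (g1 * g2 * g3) * qp (a + b + c - d - e + 1 + k))
     * (1 - g1 * qp (a - d)) * (1 - g2 * qp (b - d)) * (1 - g3 * qp (c - d)))
  / ((1 - 1 * qp (d + k)) * (1 - (g1 * g2) * qp (a + b - d - e + 1))
     * (1 - (g1 * g3) * qp (a + c - d - e + 1))
     * (1 - (g2 * g3) * qp (b + c - d - e + 1))).

(* The certificates are the rational R with F(a+1) - F(a) = Delta_k (R F),
   found by undetermined coefficients after clearing denominators in q^k. *)
Definition S4_cert_a (g1 g2 g3 k a b c d e : C) : C :=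
  Q * Q * g1 * qp a / (qp d * qp e)
  * (1 - qp d * qp k / Q) * (1 - qp e * qp k / Q)
  / (qp k * ((1 - g1 * qp (a - d + 1)) * (1 - g1 * qp (a - e + 1)))).

Definition S4_cert_d (g1 g2 g3 k a b c d e : C) : C :=
  let p := g1 * g2 * g3 * qp a * qp b * qp c in
  - (Q / qp e * (1 - Q * p / (qp d * qp d * qp e)))
  * (1 - qp e * qp k / Q) * (1 - Q * p * qp k / (qp d * qp e))
  / (qp k * ((1 - (g1 * g2) * qp (a + b - d - e + 1))
     * (1 - (g1 * g3) * qp (a + c - d - e + 1))
     * (1 - (g2 * g3) * qp (b + c - d - e + 1)))).

Lemma binom2_S (x : C) : binom2 (x + 1) = binom2 x + x.
Proof. unfold binom2. field. Qed.

Lemma S4_shift_k g1 g2 g3 k a b c d e :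
  1 - 1 * qp (d + k) <> 0 -> 1 - 1 * qp (e + k) <> 0 ->
  1 - (g1 * g2 * g3) * qp (a + b + c - d - e + 2 + k) <> 0 ->
  1 - g1 * qp (a + k) <> 0 -> 1 - g2 * qp (b + k) <> 0 ->
  1 - g3 * qp (c + k) <> 0 ->
  S4 g1 g2 g3 (k + 1) a b c d e
  = S4_ratio_k g1 g2 g3 k a b c d e * S4 g1 g2 g3 k a b c d e.
Proof.
  intros H1 H2 H3 H4 H5 H6. unfold S4, S4_ratio_k.
  rewrite (Pq_up 1 (d + k) (d + (k + 1))), (Pq_up 1 (e + k) (e + (k + 1))),
    (Pq_up (g1 * g2 * g3) (a + b + c - d - e + 2 + k)
       (a + b + c - d - e + 2 + (k + 1))),
    (Pq_inv_up g1 (a + k) (a + (k + 1))), (Pq_inv_up g2 (b + k) (b + (k + 1))),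
    (Pq_inv_up g3 (c + k) (c + (k + 1))) by (assumption || ring).
  replace (k + 1 + binom2 (d + 1) + binom2 (e + 1) - d * e)
    with (1 + (k + binom2 (d + 1) + binom2 (e + 1) - d * e)) by ring.
  rewrite (cpowL_plus lam 1), cpowL_1.
  unfold Cdiv. rewrite !Cinv_mul. ring.
Qed.

Lemma S4_shift_a g1 g2 g3 k a b c d e :
  1 - g1 * qp (a + k) <> 0 ->
  1 - (g1 * g2 * g3) * qp (a + b + c - d - e + 2 + k) <> 0 ->
  1 - (g1 * g2) * qp (a + b - d - e + 2) <> 0 ->
  1 - (g1 * g3) * qp (a + c - d - e + 2) <> 0 ->
  1 - g1 * qp (a - d + 1) <> 0 -> 1 - g1 * qp (a - e + 1) <> 0 ->
  S4 g1 g2 g3 k (a + 1) b c d e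
  = S4_ratio_a g1 g2 g3 k a b c d e * S4 g1 g2 g3 k a b c d e.
Proof.
  intros H1 H2 H3 H4 H5 H6. unfold S4, S4_ratio_a.
  rewrite (Pq_inv_up g1 (a + k) (a + 1 + k)),
    (Pq_up (g1 * g2 * g3) (a + b + c - d - e + 2 + k)
       (a + 1 + b + c - d - e + 2 + k)),
    (Pq_inv_up (g1 * g2) (a + b - d - e + 2) (a + 1 + b - d - e + 2)),
    (Pq_inv_up (g1 * g3) (a + c - d - e + 2) (a + 1 + c - d - e + 2)),
    (Pq_up g1 (a - d + 1) (a + 1 - d + 1)),
    (Pq_up g1 (a - e + 1) (a + 1 - e + 1)) by (assumption || ring).
  unfold Cdiv. rewrite !Cinv_mul. ring.
Qed.

(** Besides the symbols, (-1)^(d+e) changes sign, and binom(d+1,2) - de grows by d + 1 - e, whence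
    the prefactor -q^(1+d-e). *)
Lemma S4_shift_d g1 g2 g3 k a b c d e :
  1 - 1 * qp (d + k) <> 0 ->
  S4 g1 g2 g3 k a b c (d + 1) e
  = S4_ratio_d g1 g2 g3 k a b c d e * S4 g1 g2 g3 k a b c d e.
Proof.
  intros H1. unfold S4, S4_ratio_d.
  rewrite (Pq_up 1 (d + k) (d + 1 + k)) by (assumption || ring).
  rewrite (Pq_step (g1 * g2 * g3) (a + b + c - (d + 1) - e + 2 + k)
       (a + b + c - d - e + 2 + k)),
    (Pq_step g1 (a - (d + 1) + 1) (a - d + 1)),
    (Pq_step g2 (b - (d + 1) + 1) (b - d + 1)),
    (Pq_step g3 (c - (d + 1) + 1) (c - d + 1)),
    (Pq_inv_step (g1 * g2) (a + b - (d + 1) - e + 2) (a + b - d - e + 2)),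
    (Pq_inv_step (g1 * g3) (a + c - (d + 1) - e + 2) (a + c - d - e + 2)),
    (Pq_inv_step (g2 * g3) (b + c - (d + 1) - e + 2) (b + c - d - e + 2)) by ring.
  replace (d + 1 + e) with (d + e + 1) by ring. rewrite mone_pow_S.
  rewrite (binom2_S (d + 1)).
  replace (k + (binom2 (d + 1) + (d + 1)) + binom2 (e + 1) - (d + 1) * e)
    with (k + binom2 (d + 1) + binom2 (e + 1) - d * e + (1 + (d - e))) by ring.
  rewrite (cpowL_plus lam (k + binom2 (d + 1) + binom2 (e + 1) - d * e)),
    (cpowL_plus lam 1), cpowL_1, (cpowL_minus lam d e).
  replace (a + b + c - (d + 1) - e + 2 + k) with (a + b + c - d - e + 1 + k) by ring.
  replace (a + b - (d + 1) - e + 2) with (a + b - d - e + 1) by ring.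
  replace (a + c - (d + 1) - e + 2) with (a + c - d - e + 1) by ring.
  replace (b + c - (d + 1) - e + 2) with (b + c - d - e + 1) by ring.
  replace (a - (d + 1) + 1) with (a - d) by ring.
  replace (b - (d + 1) + 1) with (b - d) by ring.
  replace (c - (d + 1) + 1) with (c - d) by ring.
  unfold Cdiv. rewrite !Cinv_mul. ring.
Qed.

(** The certificate contains 1 - q^(d+k-1) and 1 - q^(e+k-1). At k + 1 they cancel two denominators
    of [S4_ratio_k], and the third one also occurs in [S4_ratio_a]. *)
Lemma S4_cert_a_correct g1 g2 g3 k a b c d e :
  1 - 1 * qp (d + k) <> 0 -> 1 - 1 * qp (e + k) <> 0 ->
  1 - (g1 * g2 * g3) * qp (a + b + c - d - e + 2 + k) <> 0 ->
  1 - g1 * qp (a - d + 1) <> 0 -> 1 - g1 * qp (a - e + 1) <> 0 ->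
  S4_ratio_a g1 g2 g3 k a b c d e - 1
  = S4_cert_a g1 g2 g3 (k + 1) a b c d e * S4_ratio_k g1 g2 g3 k a b c d e
    - S4_cert_a g1 g2 g3 k a b c d e.
Proof.
  intros H1 H2 H3 H4 H5. unfold S4_ratio_a, S4_cert_a, S4_ratio_k.
  autorewrite with cpow in *.
  assert (Hd := cpowL_neq0 lam d). assert (He := cpowL_neq0 lam e).
  assert (Hk := cpowL_neq0 lam k). assert (HQ := Cexp_neq0 lam).
  (* From here on the q-powers are independent indeterminates, and a rational function identity
     remains. *)
  generalize dependent (qp a). generalize dependent (qp b).
  generalize dependent (qp c). generalize dependent (qp d).
  generalize dependent (qp e). generalize dependent (qp k).
  generalize dependent Q. clear a b c d e k.
  intros q Hq0 x Hx e H2 He d H1 Hd c b a H3 H4 H5.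
  field. repeat split; side_cond (1 : C) || side_cond d || side_cond e || side_cond (d * e).
Qed.

(** Here the factors of the certificate cancel at k + 1 the denominators with q^(e+k) and
    q^(a+b+c-d-e+2+k); the remaining one, 1 - q^(d+k), is shared with [S4_ratio_d]. *)
Lemma S4_cert_d_correct g1 g2 g3 k a b c d e :
  1 - 1 * qp (d + k) <> 0 -> 1 - 1 * qp (e + k) <> 0 ->
  1 - (g1 * g2 * g3) * qp (a + b + c - d - e + 2 + k) <> 0 ->
  1 - (g1 * g2) * qp (a + b - d - e + 1) <> 0 ->
  1 - (g1 * g3) * qp (a + c - d - e + 1) <> 0 ->
  1 - (g2 * g3) * qp (b + c - d - e + 1) <> 0 ->
  S4_ratio_d g1 g2 g3 k a b c d e - 1
  = S4_cert_d g1 g2 g3 (k + 1) a b c d e * S4_ratio_k g1 g2 g3 k a b c d e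
    - S4_cert_d g1 g2 g3 k a b c d e.
Proof.
  intros H1 H2 H3 H4 H5 H6. unfold S4_ratio_d, S4_cert_d, S4_ratio_k.
  autorewrite with cpow in *.
  assert (Hd := cpowL_neq0 lam d). assert (He := cpowL_neq0 lam e).
  assert (Hk := cpowL_neq0 lam k). assert (HQ := Cexp_neq0 lam).
  generalize dependent (qp a). generalize dependent (qp b).
  generalize dependent (qp c). generalize dependent (qp d).
  generalize dependent (qp e). generalize dependent (qp k).
  generalize dependent Q. clear a b c d e k.
  intros q Hq0 x Hx e H2 He d H1 Hd c b H6 a H3 H4 H5.
  field. repeat split; side_cond (1 : C) || side_cond (d * e).
Qed.

Section S4_frame.
Variable fr : frame.
Variables g1 g2 g3 : C.
Variables k a b c d e : pt fr -> C.
Hypothesis rk : ratl (fun x => qp (k x)).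
Hypothesis ra : ratl (fun x => qp (a x)).
Hypothesis rb : ratl (fun x => qp (b x)).
Hypothesis rc : ratl (fun x => qp (c x)).
Hypothesis rd : ratl (fun x => qp (d x)).
Hypothesis re : ratl (fun x => qp (e x)).

(** Stated over any frame: complex tuples give the q-hypergeometric property of the seed, integer
    pairs the ratios along the lattice. *)
Lemma S4_ratio_of_k :
  nz (fun x => 1 - 1 * qp (d x + k x)) -> nz (fun x => 1 - 1 * qp (e x + k x)) ->
  nz (fun x => 1 - (g1 * g2 * g3) * qp (a x + b x + c x - d x - e x + 2 + k x)) ->
  nz (fun x => 1 - g1 * qp (a x + k x)) -> nz (fun x => 1 - g2 * qp (b x + k x)) ->
  nz (fun x => 1 - g3 * qp (c x + k x)) ->
  ratio_of (fun x => S4 g1 g2 g3 (k x + 1) (a x) (b x) (c x) (d x) (e x))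
    (fun x => S4 g1 g2 g3 (k x) (a x) (b x) (c x) (d x) (e x))
    (fun x => S4_ratio_k g1 g2 g3 (k x) (a x) (b x) (c x) (d x) (e x)).
Proof.
  intros H1 H2 H3 H4 H5 H6. unfold S4_ratio_k at 1.
  split; [ratl_tac|split; [unfold S4_ratio_k; ratl_tac|]].
  generic_factors. intros. now apply S4_shift_k.
Qed.

Lemma S4_ratio_of_a :
  nz (fun x => 1 - g1 * qp (a x + k x)) ->
  nz (fun x => 1 - (g1 * g2 * g3) * qp (a x + b x + c x - d x - e x + 2 + k x)) ->
  nz (fun x => 1 - (g1 * g2) * qp (a x + b x - d x - e x + 2)) ->
  nz (fun x => 1 - (g1 * g3) * qp (a x + c x - d x - e x + 2)) ->
  nz (fun x => 1 - g1 * qp (a x - d x + 1)) ->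
  nz (fun x => 1 - g1 * qp (a x - e x + 1)) ->
  ratio_of (fun x => S4 g1 g2 g3 (k x) (a x + 1) (b x) (c x) (d x) (e x))
    (fun x => S4 g1 g2 g3 (k x) (a x) (b x) (c x) (d x) (e x))
    (fun x => S4_ratio_a g1 g2 g3 (k x) (a x) (b x) (c x) (d x) (e x)).
Proof.
  intros H1 H2 H3 H4 H5 H6. unfold S4_ratio_a at 1.
  split; [ratl_tac|split; [unfold S4_ratio_a; ratl_tac|]].
  generic_factors. intros. now apply S4_shift_a.
Qed.

Lemma S4_ratio_of_d :
  nz (fun x => 1 - 1 * qp (d x + k x)) ->
  nz (fun x => 1 - (g1 * g2 * g3) * qp (a x + b x + c x - d x - e x + 1 + k x)) ->
  nz (fun x => 1 - g1 * qp (a x - d x)) ->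
  nz (fun x => 1 - g2 * qp (b x - d x)) ->
  nz (fun x => 1 - g3 * qp (c x - d x)) ->
  nz (fun x => 1 - (g1 * g2) * qp (a x + b x - d x - e x + 1)) ->
  nz (fun x => 1 - (g1 * g3) * qp (a x + c x - d x - e x + 1)) ->
  nz (fun x => 1 - (g2 * g3) * qp (b x + c x - d x - e x + 1)) ->
  ratio_of (fun x => S4 g1 g2 g3 (k x) (a x) (b x) (c x) (d x + 1) (e x))
    (fun x => S4 g1 g2 g3 (k x) (a x) (b x) (c x) (d x) (e x))
    (fun x => S4_ratio_d g1 g2 g3 (k x) (a x) (b x) (c x) (d x) (e x)).
Proof.
  intros H1 H2 H3 H4 H5 H6 H7 H8. unfold S4_ratio_d at 1.
  split; [ratl_tac|split; [unfold S4_ratio_d; ratl_tac|]].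
  generic_factors. intros. now apply S4_shift_d.
Qed.

End S4_frame.

(** * Lattice paths and mates for the common family *)

Notation frZ := (frameZ2 lam).
Notation reg := (regular lam 1).

Section S4_integer.
Variables g1 g2 g3 : C.

(** Regularity of the nine symbols whose argument omits [k], the only ones that can vanish along the
    whole lattice. *)
Definition S4_admissible (a b c d e : Z * Z -> C) : Prop :=
  (reg g1 (fun p => a p - d p + 1) /\ reg g1 (fun p => a p - e p + 1)) /\
  (reg g2 (fun p => b p - d p + 1) /\ reg g2 (fun p => b p - e p + 1)) /\
  (reg g3 (fun p => c p - d p + 1) /\ reg g3 (fun p => c p - e p + 1)) /\
  reg (g1 * g2) (fun p => a p + b p - d p - e p + 2) /\
  reg (g1 * g3) (fun p => a p + c p - d p - e p + 2) /\
  reg (g2 * g3) (fun p => b p + c p - d p - e p + 2).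

Definition S4t (k a b c d e : Z * Z -> C) (p : Z * Z) : C :=
  S4 g1 g2 g3 (k p) (a p) (b p) (c p) (d p) (e p).

Variables k a b c d e : Z * Z -> C.
Hypothesis fk : in_nk k.
Hypothesis fa : in_n a.
Hypothesis fb : in_n b.
Hypothesis fc : in_n c.
Hypothesis fd : in_n d.
Hypothesis fe : in_n e.

(** No admissibility is involved: every factor of this ratio contains [k] and so is generically
    nonzero. *)
Lemma S4t_ratio_of_k :
  ratio_of (fr := frZ) (fun p => S4t k a b c d e (sk p)) (S4t k a b c d e)
    (fun p => S4_ratio_k g1 g2 g3 (k p) (a p) (b p) (c p) (d p) (e p)).
Proof.
  assert (H : ratio_of (fr := frZ)
    (fun p => S4 g1 g2 g3 (k p + 1) (a p) (b p) (c p) (d p) (e p))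
    (fun p => S4 g1 g2 g3 (k p) (a p) (b p) (c p) (d p) (e p))
    (fun p => S4_ratio_k g1 g2 g3 (k p) (a p) (b p) (c p) (d p) (e p))).
  { apply (S4_ratio_of_k frZ); first [now apply ratl_in_n | now apply ratl_in_nk
      | apply nz_in_nk; [assumption|form_tac]]. }
  destruct H as [H1 [H2 H3]]. split; [assumption|split; [assumption|]].
  eapply (generic_mono frZ); [|exact H3]. intros p _ H. unfold S4t.
  now rewrite in_nk_sk, !in_n_sk.
Qed.

Lemma S4t_step_k : wz_equiv lam (S4t k a b c d e) (S4t (fun p => k p + 1) a b c d e).
Proof.
  assert (H := wz_shift_k lam _ _ S4t_ratio_of_k).
  replace (S4t (fun p => k p + 1) a b c d e)
    with (fun p => S4t k a b c d e (sk p)); [assumption|].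
  apply functional_extensionality. intros p. unfold S4t.
  now rewrite in_nk_sk, !in_n_sk.
Qed.

Lemma S4t_step_a : S4_admissible a b c d e ->
  wz_equiv lam (S4t k a b c d e) (S4t k (fun p => a p + 1) b c d e).
Proof.
  intros [[A1 A2] [_ [_ [A3 [A4 _]]]]].
  apply regular_nz in A1, A2, A3, A4.
  apply (wz_certificate lam) with
    (fun p => S4_ratio_a g1 g2 g3 (k p) (a p) (b p) (c p) (d p) (e p))
    (fun p => S4_ratio_k g1 g2 g3 (k p) (a p) (b p) (c p) (d p) (e p))
    (fun p => S4_cert_a g1 g2 g3 (k p) (a p) (b p) (c p) (d p) (e p)).
  - apply (S4_ratio_of_a frZ); first [assumption | now apply ratl_in_n
      | now apply ratl_in_nk | apply nz_in_nk; [assumption|form_tac]].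
  - exact S4t_ratio_of_k.
  - assert (ratl (fr := frZ) (fun p => qp (k p))) by now apply ratl_in_nk.
    assert (ratl (fr := frZ) (fun p => qp (a p))) by now apply ratl_in_n.
    assert (ratl (fr := frZ) (fun p => qp (d p))) by now apply ratl_in_n.
    assert (ratl (fr := frZ) (fun p => qp (e p))) by now apply ratl_in_n.
    unfold S4_cert_a. ratl_tac.
  - assert (H1 : nz (fr := frZ) (fun p => 1 - 1 * qp (d p + k p)))
      by (apply nz_in_nk; [assumption|form_tac]).
    assert (H2 : nz (fr := frZ) (fun p => 1 - 1 * qp (e p + k p)))
      by (apply nz_in_nk; [assumption|form_tac]).
    assert (H3 : nz (fr := frZ) (fun p => 1 - (g1 * g2 * g3)
      * qp (a p + b p + c p - d p - e p + 2 + k p)))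
      by (apply nz_in_nk; [assumption|form_tac]).
    assert (ratl (fr := frZ) (fun p => qp (k p))) by now apply ratl_in_nk.
    assert (ratl (fr := frZ) (fun p => qp (a p))) by now apply ratl_in_n.
    assert (ratl (fr := frZ) (fun p => qp (b p))) by now apply ratl_in_n.
    assert (ratl (fr := frZ) (fun p => qp (c p))) by now apply ratl_in_n.
    assert (ratl (fr := frZ) (fun p => qp (d p))) by now apply ratl_in_n.
    assert (ratl (fr := frZ) (fun p => qp (e p))) by now apply ratl_in_n.
    clear A3 A4. generic_factors. intros p _ B1 B2 B3 B4 B5.
    rewrite in_nk_sk, !in_n_sk by assumption.
    now apply S4_cert_a_correct.
Qed.

(** Raising [d] lowers the forms, so admissibility is demanded at [d + 1], the lower end of the
    step. *)
Lemma S4t_step_d : S4_admissible a b c (fun p => d p + 1) e ->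
  wz_equiv lam (S4t k a b c d e) (S4t k a b c (fun p => d p + 1) e).
Proof.
  intros [[A1 _] [[A2 _] [[A3 _] [A4 [A5 A6]]]]].
  apply regular_nz in A1, A2, A3, A4, A5, A6.
  assert (B1 : nz (fr := frZ) (fun p => 1 - g1 * qp (a p - d p)))
    by (eapply (nz_ext frZ); [|exact A1]; intros; simpl; do 3 f_equal; ring).
  assert (B2 : nz (fr := frZ) (fun p => 1 - g2 * qp (b p - d p)))
    by (eapply (nz_ext frZ); [|exact A2]; intros; simpl; do 3 f_equal; ring).
  assert (B3 : nz (fr := frZ) (fun p => 1 - g3 * qp (c p - d p)))
    by (eapply (nz_ext frZ); [|exact A3]; intros; simpl; do 3 f_equal; ring).
  assert (B4 : nz (fr := frZ)
      (fun p => 1 - (g1 * g2) * qp (a p + b p - d p - e p + 1)))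
    by (eapply (nz_ext frZ); [|exact A4]; intros; simpl; do 3 f_equal; ring).
  assert (B5 : nz (fr := frZ)
      (fun p => 1 - (g1 * g3) * qp (a p + c p - d p - e p + 1)))
    by (eapply (nz_ext frZ); [|exact A5]; intros; simpl; do 3 f_equal; ring).
  assert (B6 : nz (fr := frZ)
      (fun p => 1 - (g2 * g3) * qp (b p + c p - d p - e p + 1)))
    by (eapply (nz_ext frZ); [|exact A6]; intros; simpl; do 3 f_equal; ring).
  clear A1 A2 A3 A4 A5 A6.
  assert (K1 : nz (fr := frZ) (fun p => 1 - 1 * qp (d p + k p)))
    by (apply nz_in_nk; [assumption|form_tac]).
  assert (ratl (fr := frZ) (fun p => qp (k p))) by now apply ratl_in_nk.
  assert (ratl (fr := frZ) (fun p => qp (a p))) by now apply ratl_in_n.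
  assert (ratl (fr := frZ) (fun p => qp (b p))) by now apply ratl_in_n.
  assert (ratl (fr := frZ) (fun p => qp (c p))) by now apply ratl_in_n.
  assert (ratl (fr := frZ) (fun p => qp (d p))) by now apply ratl_in_n.
  assert (ratl (fr := frZ) (fun p => qp (e p))) by now apply ratl_in_n.
  apply (wz_certificate lam) with
    (fun p => S4_ratio_d g1 g2 g3 (k p) (a p) (b p) (c p) (d p) (e p))
    (fun p => S4_ratio_k g1 g2 g3 (k p) (a p) (b p) (c p) (d p) (e p))
    (fun p => S4_cert_d g1 g2 g3 (k p) (a p) (b p) (c p) (d p) (e p)).
  - apply (S4_ratio_of_d frZ); first [assumption
      | apply nz_in_nk; [assumption|form_tac]].
  - exact S4t_ratio_of_k.
  - unfold S4_cert_d. ratl_tac.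
  - assert (K2 : nz (fr := frZ) (fun p => 1 - 1 * qp (e p + k p)))
      by (apply nz_in_nk; [assumption|form_tac]).
    assert (K3 : nz (fr := frZ) (fun p => 1 - (g1 * g2 * g3)
      * qp (a p + b p + c p - d p - e p + 2 + k p)))
      by (apply nz_in_nk; [assumption|form_tac]).
    clear B1 B2 B3. generic_factors. intros.
    rewrite in_nk_sk, !in_n_sk by assumption.
    now apply S4_cert_d_correct.
Qed.
End S4_integer.

Lemma S4_admissible_up g1 g2 g3 a b c d e a' b' c' d' e' (i j l m n : nat) :
  (forall p, a' p = a p + RtoC (INR i)) -> (forall p, b' p = b p + RtoC (INR j)) ->
  (forall p, c' p = c p + RtoC (INR l)) -> (forall p, d' p = d p - RtoC (INR m)) ->
  (forall p, e' p = e p - RtoC (INR n)) ->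
  S4_admissible g1 g2 g3 a b c d e -> S4_admissible g1 g2 g3 a' b' c' d' e'.
Proof.
  intros Ha Hb Hc Hd He [[A1 A2] [[A3 A4] [[A5 A6] [A7 [A8 A9]]]]].
  split; [split|split; [split|split; [split|split; [|split]]]];
  [ eapply (regular_up lam 1 _ _ _ (i + m)); [|exact A1]
  | eapply (regular_up lam 1 _ _ _ (i + n)); [|exact A2]
  | eapply (regular_up lam 1 _ _ _ (j + m)); [|exact A3]
  | eapply (regular_up lam 1 _ _ _ (j + n)); [|exact A4]
  | eapply (regular_up lam 1 _ _ _ (l + m)); [|exact A5]
  | eapply (regular_up lam 1 _ _ _ (l + n)); [|exact A6]
  | eapply (regular_up lam 1 _ _ _ (i + j + m + n)); [|exact A7]
  | eapply (regular_up lam 1 _ _ _ (i + l + m + n)); [|exact A8]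
  | eapply (regular_up lam 1 _ _ _ (j + l + m + n)); [|exact A9] ];
  intros p; rewrite ?Ha, ?Hb, ?Hc, ?Hd, ?He, ?plus_INR, ?RtoC_plus; ring.
Qed.

Lemma S4_admissible_swap_ab g1 g2 g3 a b c d e :
  S4_admissible g1 g2 g3 a b c d e -> S4_admissible g2 g1 g3 b a c d e.
Proof.
  unfold S4_admissible. rewrite (Cmult_comm g2 g1).
  replace (fun p => b p + a p - d p - e p + 2)
    with (fun p => a p + b p - d p - e p + 2); [tauto|].
  apply functional_extensionality; intros p; ring.
Qed.

Lemma S4_admissible_swap_ac g1 g2 g3 a b c d e :
  S4_admissible g1 g2 g3 a b c d e -> S4_admissible g3 g2 g1 c b a d e.
Proof.
  unfold S4_admissible.
  rewrite (Cmult_comm g3 g2), (Cmult_comm g3 g1), (Cmult_comm g2 g1).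
  replace (fun p => c p + b p - d p - e p + 2)
    with (fun p => b p + c p - d p - e p + 2)
    by (apply functional_extensionality; intros p; ring).
  replace (fun p => c p + a p - d p - e p + 2)
    with (fun p => a p + c p - d p - e p + 2)
    by (apply functional_extensionality; intros p; ring).
  replace (fun p => b p + a p - d p - e p + 2)
    with (fun p => a p + b p - d p - e p + 2)
    by (apply functional_extensionality; intros p; ring).
  tauto.
Qed.

Lemma S4_admissible_swap_de g1 g2 g3 a b c d e :
  S4_admissible g1 g2 g3 a b c d e -> S4_admissible g1 g2 g3 a b c e d.
Proof.
  unfold S4_admissible.
  assert (H : forall f g : Z * Z -> C, (fun p => f p + g p - e p - d p + 2)
            = (fun p => f p + g p - d p - e p + 2))
    by (intros f g; apply functional_extensionality; intros p; ring).
  rewrite (H a b), (H a c), (H b c). tauto.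
Qed.

Lemma S4t_raise_a g1 g2 g3 k a b c d e (n : nat) :
  in_nk k -> in_n a -> in_n b -> in_n c -> in_n d -> in_n e ->
  S4_admissible g1 g2 g3 a b c d e ->
  wz_equiv lam (S4t g1 g2 g3 k a b c d e)
    (S4t g1 g2 g3 k (fun p => a p + RtoC (INR n)) b c d e).
Proof.
  intros fk fa fb fc fd fe H.
  apply (wz_raise lam (fun a => S4t g1 g2 g3 k a b c d e)). intros i _.
  apply (S4t_step_a g1 g2 g3 k (fun p => a p + RtoC (INR i))); auto; [form_tac|].
  eapply (S4_admissible_up g1 g2 g3 a b c d e _ _ _ _ _ i 0 0 0 0);
    [..|exact H]; intros p; simpl; ring.
Qed.

Lemma S4t_raise_b g1 g2 g3 k a b c d e (n : nat) :
  in_nk k -> in_n a -> in_n b -> in_n c -> in_n d -> in_n e ->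
  S4_admissible g1 g2 g3 a b c d e ->
  wz_equiv lam (S4t g1 g2 g3 k a b c d e)
    (S4t g1 g2 g3 k a (fun p => b p + RtoC (INR n)) c d e).
Proof.
  intros fk fa fb fc fd fe H.
  assert (E : forall b', S4t g1 g2 g3 k a b' c d e = S4t g2 g1 g3 k b' a c d e)
    by (intros b'; apply functional_extensionality; intros p; apply S4_swap_ab).
  rewrite !E. apply S4t_raise_a; auto using S4_admissible_swap_ab.
Qed.

Lemma S4t_raise_c g1 g2 g3 k a b c d e (n : nat) :
  in_nk k -> in_n a -> in_n b -> in_n c -> in_n d -> in_n e ->
  S4_admissible g1 g2 g3 a b c d e ->
  wz_equiv lam (S4t g1 g2 g3 k a b c d e)
    (S4t g1 g2 g3 k a b (fun p => c p + RtoC (INR n)) d e).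
Proof.
  intros fk fa fb fc fd fe H.
  assert (E : forall c', S4t g1 g2 g3 k a b c' d e = S4t g3 g2 g1 k c' b a d e)
    by (intros c'; apply functional_extensionality; intros p; apply S4_swap_ac).
  rewrite !E. apply S4t_raise_a; auto using S4_admissible_swap_ac.
Qed.

Lemma S4t_lower_d g1 g2 g3 k a b c d e (n : nat) :
  in_nk k -> in_n a -> in_n b -> in_n c -> in_n d -> in_n e ->
  S4_admissible g1 g2 g3 a b c d e ->
  wz_equiv lam (S4t g1 g2 g3 k a b c d e)
    (S4t g1 g2 g3 k a b c (fun p => d p - RtoC (INR n)) e).
Proof.
  intros fk fa fb fc fd fe H.
  apply (wz_lower lam (fun d => S4t g1 g2 g3 k a b c d e)). intros i.
  apply (S4t_step_d g1 g2 g3 k a b c (fun p => d p - RtoC (INR (S i)))); auto;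
    [form_tac|].
  eapply (S4_admissible_up g1 g2 g3 a b c d e _ _ _ _ _ 0 0 0 i 0);
    [..|exact H]; intros p; rewrite ?S_INR, ?RtoC_plus; simpl; ring.
Qed.

Lemma S4t_lower_e g1 g2 g3 k a b c d e (n : nat) :
  in_nk k -> in_n a -> in_n b -> in_n c -> in_n d -> in_n e ->
  S4_admissible g1 g2 g3 a b c d e ->
  wz_equiv lam (S4t g1 g2 g3 k a b c d e)
    (S4t g1 g2 g3 k a b c d (fun p => e p - RtoC (INR n))).
Proof.
  intros fk fa fb fc fd fe H.
  assert (E : forall e', S4t g1 g2 g3 k a b c d e' = S4t g1 g2 g3 k a b c e' d)
    by (intros e'; apply functional_extensionality; intros p; apply S4_swap_de).
  rewrite !E. apply S4t_lower_d; auto using S4_admissible_swap_de.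
Qed.

(** Raising [a], [b], [c] and lowering [d], [e] never lowers any of the nine forms, so admissibility
    persists along the path. *)
Lemma S4t_to_top g1 g2 g3 k a b c d e (i j l m n : nat) :
  in_nk k -> in_n a -> in_n b -> in_n c -> in_n d -> in_n e ->
  S4_admissible g1 g2 g3 a b c d e ->
  wz_equiv lam (S4t g1 g2 g3 k a b c d e)
    (S4t g1 g2 g3 k (fun p => a p + RtoC (INR i)) (fun p => b p + RtoC (INR j))
       (fun p => c p + RtoC (INR l)) (fun p => d p - RtoC (INR m))
       (fun p => e p - RtoC (INR n))).
Proof.
  intros fk fa fb fc fd fe H.
  eapply wz_trans; [now apply (S4t_raise_a _ _ _ _ _ _ _ _ _ i)|].
  eapply wz_trans; [apply (S4t_raise_b _ _ _ _ _ _ _ _ _ j); auto; try form_tac|].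
  { eapply (S4_admissible_up g1 g2 g3 a b c d e _ _ _ _ _ i 0 0 0 0);
      [..|exact H]; intros p; simpl; ring. }
  eapply wz_trans; [apply (S4t_raise_c _ _ _ _ _ _ _ _ _ l); auto; try form_tac|].
  { eapply (S4_admissible_up g1 g2 g3 a b c d e _ _ _ _ _ i j 0 0 0);
      [..|exact H]; intros p; simpl; ring. }
  eapply wz_trans; [apply (S4t_lower_d _ _ _ _ _ _ _ _ _ m); auto; try form_tac|].
  { eapply (S4_admissible_up g1 g2 g3 a b c d e _ _ _ _ _ i j l 0 0);
      [..|exact H]; intros p; simpl; ring. }
  apply (S4t_lower_e _ _ _ _ _ _ _ _ _ n); auto; try form_tac.
  eapply (S4_admissible_up g1 g2 g3 a b c d e _ _ _ _ _ i j l m 0);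
      [..|exact H]; intros p; simpl; ring.
Qed.

(* Some numerator or denominator vanishes identically, the latter making the
   term zero because of [/ 0 = 0]. *)
Lemma S4t_admissible_or_zero g1 g2 g3 k a b c d e :
  in_n a -> in_n b -> in_n c -> in_n d -> in_n e ->
  S4_admissible g1 g2 g3 a b c d e
  \/ forall p, S4t g1 g2 g3 k a b c d e p = 0.
Proof.
  intros fa fb fc fd fe.
  assert (D := regular_or_Pq_zero).
  unfold S4_admissible, S4t, S4.
  destruct (D g1 (fun p => a p - d p + 1)) as [A1|H];
    [form_tac| |right; intros p; rewrite H; ring].
  destruct (D g1 (fun p => a p - e p + 1)) as [A2|H];
    [form_tac| |right; intros p; rewrite H; ring].
  destruct (D g2 (fun p => b p - d p + 1)) as [A3|H];
    [form_tac| |right; intros p; rewrite H; ring].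
  destruct (D g2 (fun p => b p - e p + 1)) as [A4|H];
    [form_tac| |right; intros p; rewrite H; ring].
  destruct (D g3 (fun p => c p - d p + 1)) as [A5|H];
    [form_tac| |right; intros p; rewrite H; ring].
  destruct (D g3 (fun p => c p - e p + 1)) as [A6|H];
    [form_tac| |right; intros p; rewrite H; ring].
  destruct (D (g1 * g2) (fun p => a p + b p - d p - e p + 2)) as [A7|H];
    [form_tac| |right; intros p; rewrite H, Cinv_0; ring].
  destruct (D (g1 * g3) (fun p => a p + c p - d p - e p + 2)) as [A8|H];
    [form_tac| |right; intros p; rewrite H, Cinv_0; ring].
  destruct (D (g2 * g3) (fun p => b p + c p - d p - e p + 2)) as [A9|H];
    [form_tac| |right; intros p; rewrite H, Cinv_0; ring].
  left. tauto.
Qed.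

Lemma S4_has_mate g1 g2 g3 (K A B C0 D E : Z) (k0 a b c d e : C) :
  has_qWZ_mate lam (fun n k => S4 g1 g2 g3 (link K k0 (n, k)) (lin A a (n, k))
    (lin B b (n, k)) (lin C0 c (n, k)) (lin D d (n, k)) (lin E e (n, k))).
Proof.
  assert (fk := in_nk_link K k0). assert (fk' := in_nk_link_sn K k0).
  assert (fl := in_n_lin). assert (fl' := in_n_lin_sn).
  destruct (S4t_admissible_or_zero g1 g2 g3 (link K k0) (lin A a) (lin B b)
    (lin C0 c) (lin D d) (lin E e)) as [Ha|H0]; auto.
  2: { apply (mate_of_zero lam Hq). intros n k. exact (H0 (n, k)). }
  apply (mate_of_wz_equiv lam Hq).
  { eapply ratio_of_rat, (S4t_ratio_of_k g1 g2 g3 (link K k0) (lin A a) (lin B b)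
      (lin C0 c) (lin D d) (lin E e)); auto. }
  change (wz_equiv lam
    (S4t g1 g2 g3 (link K k0) (lin A a) (lin B b) (lin C0 c) (lin D d) (lin E e))
    (S4t g1 g2 g3 (fun p => link K k0 (sn p)) (fun p => lin A a (sn p))
       (fun p => lin B b (sn p)) (fun p => lin C0 c (sn p))
       (fun p => lin D d (sn p)) (fun p => lin E e (sn p)))).
  assert (Ha' : S4_admissible g1 g2 g3 (fun p => lin A a (sn p))
       (fun p => lin B b (sn p)) (fun p => lin C0 c (sn p))
       (fun p => lin D d (sn p)) (fun p => lin E e (sn p))).
  { destruct Ha as [[A1 A2] [[A3 A4] [[A5 A6] [A7 [A8 A9]]]]].
    apply regular_sn in A1, A2, A3, A4, A5, A6, A7, A8, A9.
    unfold S4_admissible. tauto. }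
  (* [M] bounds every slope, so the lifts [M - A], ..., [M + E] from the end point at [n + 1] are
     all nonnegative. *)
  set (M := (Z.abs A + Z.abs B + Z.abs C0 + Z.abs D + Z.abs E)%Z).
  eapply wz_trans.
  { apply (S4t_to_top g1 g2 g3 (link K k0) _ _ _ _ _ (Z.to_nat M) (Z.to_nat M)
      (Z.to_nat M) (Z.to_nat M) (Z.to_nat M)); auto. }
  apply wz_sym. eapply wz_trans.
  { apply (S4t_to_top g1 g2 g3 (fun p => link K k0 (sn p)) _ _ _ _ _
      (Z.to_nat (M - A)) (Z.to_nat (M - B)) (Z.to_nat (M - C0))
      (Z.to_nat (M + D)) (Z.to_nat (M + E))); auto. }
  cbv beta. rewrite !lin_sn_raise, !lin_sn_lower by lia.
  (* At the common top the two terms differ only in [k], by [K]. *)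
  apply wz_sym, (wz_translate_k lam (fun k => S4t g1 g2 g3 k _ _ _ _ _)) with K;
    auto using link_sn.
  intros k fk0. apply S4t_step_k; auto; form_tac; auto.
Qed.

End S4.

(** * Seeds (2') and (4') as members of the family *)

Ltac at_point :=
  first
  [ apply ratl_frameC_nth; simpl; lia
  | apply ratl_const
  | unfold nz; simpl; apply factor_neq0_real; [assumption|simpl; lra..] ].

(** Handles one variable of [qhyper]: [lemL] supplies the ratio, its factors are checked at the test
    point, and [lemS] identifies the seed on an explicit list. *)
Ltac by_shift_with point_tac lemS lemL :=
  eapply rat_ext; [| |eapply ratio_of_rat, lemL; first [at_point | point_tac]];
  intros xs Hx; simpl in Hx;
  repeat (destruct xs as [|? xs]; [try discriminate Hx|]; try discriminate Hx);
  simpl; rewrite lemS; try reflexivity.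

Ltac by_shift lemS lemL := by_shift_with fail lemS lemL.

Section Seeds24.
Variable lam : C.
Hypothesis Hq : (Re lam < 0)%R.

Lemma Cexp_lt1 : (Cmod (Cexp lam) < 1)%R.
Proof.
  assert (H := Cmod_Cexp_lt1 lam Hq 1 Rlt_0_1). now rewrite Cmult_1_l in H.
Qed.

Lemma seed4_S4 k a b c d e :
  seed4 lam k (a :: b :: c :: d :: e :: nil) = S4 lam 1 1 1 k a b c d e.
Proof.
  unfold seed4, S4, Pq. simpl nth. unfold Cdiv.
  rewrite !Cinv_mul, !Cmult_1_l. ring.
Qed.

(** The symbols scaled by [g3 = 0] equal (0;q)_oo = 1, so [x] is arbitrary: 100 at the test point, 0
    on the lattice. The [c], [d] of seed (2') play the parts of [d], [e]. *)
Lemma seed2_S4 x k a b c d :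
  seed2 lam k (a :: b :: c :: d :: nil) = S4 lam 1 1 0 k a b x c d.
Proof.
  unfold seed2, S4, Pq. simpl nth. unfold Cdiv.
  rewrite !Cinv_mul, !Cmult_1_l, !Cmult_0_l, (qpoch_0 _ Cexp_lt1).
  replace (/ (1 : C)) with (1 : C) by field. ring.
Qed.

Notation v i := (fun xs : list C => @nth C i xs (RtoC 0)).

Lemma seed4_qhyper : qhyper lam 6 (fun xs => seed4 lam (hd (RtoC 0) xs) (tl xs)).
Proof.
  (* In the order k, a, b, c, d, e: with a, b, c well above d, e, every form in the ratios is
     positive. *)
  set (x0 := (1 : C) :: (100 : C) :: (100 : C) :: (100 : C) :: (10 : C) :: (10 : C)
             :: nil).
  apply (qhyper_of_rat lam x0).
  intros [|[|[|[|[|[|i]]]]]] Hi; [..|simpl in Hi; lia].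
  - by_shift seed4_S4 (S4_ratio_of_k lam Hq (frameC lam x0) 1 1 1
      (v 0%nat) (v 1%nat) (v 2%nat) (v 3%nat) (v 4%nat) (v 5%nat)).
  - by_shift seed4_S4 (S4_ratio_of_a lam Hq (frameC lam x0) 1 1 1
      (v 0%nat) (v 1%nat) (v 2%nat) (v 3%nat) (v 4%nat) (v 5%nat)).
  - by_shift seed4_S4 (S4_ratio_of_a lam Hq (frameC lam x0) 1 1 1
      (v 0%nat) (v 2%nat) (v 1%nat) (v 3%nat) (v 4%nat) (v 5%nat));
    apply S4_swap_ab.
  - by_shift seed4_S4 (S4_ratio_of_a lam Hq (frameC lam x0) 1 1 1
      (v 0%nat) (v 3%nat) (v 2%nat) (v 1%nat) (v 4%nat) (v 5%nat));
    apply S4_swap_ac.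
  - by_shift seed4_S4 (S4_ratio_of_d lam Hq (frameC lam x0) 1 1 1
      (v 0%nat) (v 1%nat) (v 2%nat) (v 3%nat) (v 4%nat) (v 5%nat)).
  - by_shift seed4_S4 (S4_ratio_of_d lam Hq (frameC lam x0) 1 1 1
      (v 0%nat) (v 1%nat) (v 2%nat) (v 3%nat) (v 5%nat) (v 4%nat));
    apply S4_swap_de.
Qed.

Lemma seed2_qhyper : qhyper lam 5 (fun xs => seed2 lam (hd (RtoC 0) xs) (tl xs)).
Proof.
  set (x0 := (1 : C) :: (100 : C) :: (100 : C) :: (10 : C) :: (10 : C) :: nil).
  apply (qhyper_of_rat lam x0).
  intros [|[|[|[|[|i]]]]] Hi; [..|simpl in Hi; lia].
  - by_shift (seed2_S4 100) (S4_ratio_of_k lam Hq (frameC lam x0) 1 1 0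
      (v 0%nat) (v 1%nat) (v 2%nat) (fun _ => 100) (v 3%nat) (v 4%nat)).
  - by_shift (seed2_S4 100) (S4_ratio_of_a lam Hq (frameC lam x0) 1 1 0
      (v 0%nat) (v 1%nat) (v 2%nat) (fun _ => 100) (v 3%nat) (v 4%nat)).
  - by_shift (seed2_S4 100) (S4_ratio_of_a lam Hq (frameC lam x0) 1 1 0
      (v 0%nat) (v 2%nat) (v 1%nat) (fun _ => 100) (v 3%nat) (v 4%nat));
    apply S4_swap_ab.
  - by_shift (seed2_S4 100) (S4_ratio_of_d lam Hq (frameC lam x0) 1 1 0
      (v 0%nat) (v 1%nat) (v 2%nat) (fun _ => 100) (v 3%nat) (v 4%nat)).
  - by_shift (seed2_S4 100) (S4_ratio_of_d lam Hq (frameC lam x0) 1 1 0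
      (v 0%nat) (v 1%nat) (v 2%nat) (fun _ => 100) (v 4%nat) (v 3%nat));
    apply S4_swap_de.
Qed.

Lemma seed4_seed : qWZ_seed lam 5 (seed4 lam).
Proof.
  split; [exact seed4_qhyper|].
  intros K As k0 ps HA Hp.
  destruct As as [|A [|B [|C0 [|D [|E [|]]]]]]; try discriminate HA.
  destruct ps as [|a [|b [|c [|d [|e [|]]]]]]; try discriminate Hp.
  eapply (has_mate_ext lam); [|apply (S4_has_mate lam Hq 1 1 1 K A B C0 D E k0 a b c d e)].
  intros n k. apply seed4_S4.
Qed.

Lemma seed2_seed : qWZ_seed lam 4 (seed2 lam).
Proof.
  split; [exact seed2_qhyper|].
  intros K As k0 ps HA Hp.
  destruct As as [|A [|B [|C0 [|D [|]]]]]; try discriminate HA.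
  destruct ps as [|a [|b [|c [|d [|]]]]]; try discriminate Hp.
  eapply (has_mate_ext lam); [|apply (S4_has_mate lam Hq 1 1 0 K A B 0 C0 D k0 a b 0 c d)].
  intros n k. apply seed2_S4.
Qed.
End Seeds24.

(** * Seed (1') *)

Section Seed1.
Variables lam mu : C.
Hypothesis Hq : (Re lam < 0)%R.
Notation qp := (cpowL lam).
Notation Q := (Cexp lam).
Notation z := (Cexp mu).
Notation frZ := (frameZ2 lam).
Notation P := (Pq lam).
Notation v i := (fun xs : list C => @nth C i xs (RtoC 0)).

Definition S1 (k a b : C) : C :=
  cpowL mu (b + k) * (P 1 (b + k) * / P 1 (a + k))
  * (P 1 (a - b + 1) * / P z (a - b + 1)).

(** The term depends on k + b and a - b only. For the mates [b] may thus be set to zero, its slope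
    and offset being absorbed by those of [k] and [a]. *)
Lemma S1_translate k a b : S1 k a b = S1 (k + b) (a - b) 0.
Proof.
  unfold S1.
  replace (0 + (k + b)) with (b + k) by ring.
  replace (a - b + (k + b)) with (a + k) by ring.
  replace (a - b - 0 + 1) with (a - b + 1) by ring.
  reflexivity.
Qed.

Lemma seed1_S1 k a b : seed1 lam mu k (a :: b :: nil) = S1 k a b.
Proof.
  unfold seed1, S1, Pq. simpl nth. unfold Cdiv.
  rewrite !Cmult_1_l. ring.
Qed.

Definition S1_ratio_k (k a b : C) : C :=
  z * (1 - 1 * qp (a + k)) / (1 - 1 * qp (b + k)).

Definition S1_ratio_a (k a b : C) : C :=
  (1 - 1 * qp (a + k)) * (1 - z * qp (a - b + 1)) / (1 - 1 * qp (a - b + 1)).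

Definition S1_ratio_b (k a b : C) : C :=
  z * (1 - 1 * qp (a - b)) / ((1 - 1 * qp (b + k)) * (1 - z * qp (a - b))).

(** At k + 1 the factor 1 - q^(b+k-1) cancels the denominator of [S1_ratio_k]. The identity is then
    linear in q^k, and its two coefficients agree. *)
Definition S1_cert_a (k a b : C) : C :=
  - (Q * qp a / qp b) / (1 - 1 * qp (a - b + 1)) * (1 - qp b * qp k / Q).

Lemma S1_shift_k k a b :
  1 - 1 * qp (a + k) <> 0 -> 1 - 1 * qp (b + k) <> 0 ->
  S1 (k + 1) a b = S1_ratio_k k a b * S1 k a b.
Proof.
  intros H1 H2. unfold S1, S1_ratio_k.
  rewrite (Pq_up lam Hq 1 (b + k) (b + (k + 1))),
    (Pq_inv_up lam Hq 1 (a + k) (a + (k + 1))) by (assumption || ring).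
  replace (b + (k + 1)) with (b + k + 1) by ring.
  rewrite (cpowL_plus mu (b + k)), cpowL_1. unfold Cdiv. ring.
Qed.

Lemma S1_shift_a k a b :
  1 - 1 * qp (a + k) <> 0 -> 1 - 1 * qp (a - b + 1) <> 0 ->
  1 - z * qp (a - b + 1) <> 0 ->
  S1 k (a + 1) b = S1_ratio_a k a b * S1 k a b.
Proof.
  intros H1 H2 H3. unfold S1, S1_ratio_a.
  rewrite (Pq_inv_up lam Hq 1 (a + k) (a + 1 + k)),
    (Pq_up lam Hq 1 (a - b + 1) (a + 1 - b + 1)),
    (Pq_inv_up lam Hq z (a - b + 1) (a + 1 - b + 1)) by (assumption || ring).
  unfold Cdiv. ring.
Qed.

Lemma S1_shift_b k a b :
  1 - 1 * qp (b + k) <> 0 ->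
  S1 k a (b + 1) = S1_ratio_b k a b * S1 k a b.
Proof.
  intros H1. unfold S1, S1_ratio_b.
  rewrite (Pq_up lam Hq 1 (b + k) (b + 1 + k)) by (assumption || ring).
  replace (a - (b + 1) + 1) with (a - b) by ring.
  rewrite (Pq_step lam Hq 1 (a - b) (a - b + 1)),
    (Pq_inv_step lam Hq z (a - b) (a - b + 1)) by ring.
  replace (b + 1 + k) with (b + k + 1) by ring.
  rewrite (cpowL_plus mu (b + k)), cpowL_1. unfold Cdiv. rewrite !Cinv_mul. ring.
Qed.

Lemma S1_cert_a_correct k a b :
  1 - 1 * qp (b + k) <> 0 -> 1 - 1 * qp (a - b + 1) <> 0 ->
  S1_ratio_a k a b - 1
  = S1_cert_a (k + 1) a b * S1_ratio_k k a b - S1_cert_a k a b.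
Proof.
  intros H1 H2. unfold S1_ratio_a, S1_cert_a, S1_ratio_k.
  autorewrite with cpow in *.
  assert (Hb := cpowL_neq0 lam b). assert (Hk := cpowL_neq0 lam k).
  assert (HQ := Cexp_neq0 lam).
  generalize dependent (qp a). generalize dependent (qp b).
  generalize dependent (qp k). generalize dependent Q. generalize z.
  clear a b k. intros w q Hq0 x Hx b H1 Hb a H2.
  field. repeat split; side_cond (1 : C) || side_cond b.
Qed.

Lemma S1_ratio_of_k (fr : frame) (k a b : pt fr -> C) :
  ratl (fun x => qp (k x)) -> ratl (fun x => qp (a x)) ->
  ratl (fun x => qp (b x)) ->
  nz (fun x => 1 - 1 * qp (a x + k x)) -> nz (fun x => 1 - 1 * qp (b x + k x)) ->
  ratio_of (fun x => S1 (k x + 1) (a x) (b x)) (fun x => S1 (k x) (a x) (b x))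
    (fun x => S1_ratio_k (k x) (a x) (b x)).
Proof.
  intros rk ra rb H1 H2. unfold S1_ratio_k at 1.
  split; [ratl_tac|split; [unfold S1_ratio_k; ratl_tac|]].
  generic_factors. intros. now apply S1_shift_k.
Qed.

Lemma S1_ratio_of_a (fr : frame) (k a b : pt fr -> C) :
  ratl (fun x => qp (k x)) -> ratl (fun x => qp (a x)) ->
  ratl (fun x => qp (b x)) ->
  nz (fun x => 1 - 1 * qp (a x + k x)) ->
  nz (fun x => 1 - 1 * qp (a x - b x + 1)) ->
  nz (fun x => 1 - z * qp (a x - b x + 1)) ->
  ratio_of (fun x => S1 (k x) (a x + 1) (b x)) (fun x => S1 (k x) (a x) (b x))
    (fun x => S1_ratio_a (k x) (a x) (b x)).
Proof.
  intros rk ra rb H1 H2 H3. unfold S1_ratio_a at 1.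
  split; [ratl_tac|split; [unfold S1_ratio_a; ratl_tac|]].
  generic_factors. intros. now apply S1_shift_a.
Qed.

Lemma S1_ratio_of_b (fr : frame) (k a b : pt fr -> C) :
  ratl (fun x => qp (k x)) -> ratl (fun x => qp (a x)) ->
  ratl (fun x => qp (b x)) ->
  nz (fun x => 1 - 1 * qp (b x + k x)) ->
  nz (fun x => 1 - 1 * qp (a x - b x)) -> nz (fun x => 1 - z * qp (a x - b x)) ->
  ratio_of (fun x => S1 (k x) (a x) (b x + 1)) (fun x => S1 (k x) (a x) (b x))
    (fun x => S1_ratio_b (k x) (a x) (b x)).
Proof.
  intros rk ra rb H1 H2 H3. unfold S1_ratio_b at 1.
  split; [ratl_tac|split; [unfold S1_ratio_b; ratl_tac|]].
  generic_factors. intros. now apply S1_shift_b.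
Qed.

Lemma seed1_qhyper : qhyper lam 3 (fun xs => seed1 lam mu (hd (RtoC 0) xs) (tl xs)).
Proof.
  (* For real x >= t the modulus of z q^x is below 1. The test point has to depend on the size of
     z. *)
  set (t := (1 + Rabs (Re mu / Re lam))%R).
  assert (Ht : (0 < t)%R) by (assert (H := Rabs_pos (Re mu / Re lam)); unfold t; lra).
  assert (Hz : forall x : C, Im x = 0%R -> (t <= Re x)%R -> 1 - z * qp x <> 0).
  { intros x Hx Hx0. apply factor_neq0. rewrite Cmod_Cexp, <- exp_plus, <- exp_0.
    intros He. apply exp_inv in He.
    assert (Hr : (Re mu / Re lam * Re lam = Re mu)%R) by (field; lra).
    assert (Ha := Rle_abs (- (Re mu / Re lam))). rewrite Rabs_Ropp in Ha.
    unfold t in Hx0. destruct x as [x y], lam, mu. simpl in *. subst y. nra. }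
  set (x0 := (1 : C) :: RtoC (1 + t) :: (1 : C) :: nil).
  apply (qhyper_of_rat lam x0).
  intros [|[|[|i]]] Hi; [..|simpl in Hi; lia].
  - by_shift_with ltac:(unfold nz; simpl; apply Hz; simpl; lra) seed1_S1 (S1_ratio_of_k (frameC lam x0) (v 0%nat) (v 1%nat) (v 2%nat)).
  - by_shift_with ltac:(unfold nz; simpl; apply Hz; simpl; lra) seed1_S1 (S1_ratio_of_a (frameC lam x0) (v 0%nat) (v 1%nat) (v 2%nat)).
  - by_shift_with ltac:(unfold nz; simpl; apply Hz; simpl; lra) seed1_S1 (S1_ratio_of_b (frameC lam x0) (v 0%nat) (v 1%nat) (v 2%nat)).
Qed.

(** * Mates for seed (1') *)

Definition S1t (k a : Z * Z -> C) (p : Z * Z) : C := S1 (k p) (a p) 0.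

Definition S1_admissible (a : Z * Z -> C) : Prop :=
  regular lam 1 1 (fun p => a p - 0 + 1) /\ regular lam 1 z (fun p => a p - 0 + 1).

Lemma S1t_ratio_of_k k a : in_nk k -> in_n a ->
  ratio_of (fr := frZ) (fun p => S1t k a (sk p)) (S1t k a)
    (fun p => S1_ratio_k (k p) (a p) 0).
Proof.
  intros fk fa.
  assert (H : ratio_of (fr := frZ) (fun p => S1 (k p + 1) (a p) 0)
    (fun p => S1 (k p) (a p) 0) (fun p => S1_ratio_k (k p) (a p) 0)).
  { apply (S1_ratio_of_k frZ k a (fun _ => 0)); first [now apply ratl_in_n
      | now apply ratl_in_nk | apply (ratl_const frZ)
      | apply nz_in_nk; [assumption|form_tac]]. }
  destruct H as [H1 [H2 H3]]. split; [assumption|split; [assumption|]].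
  eapply (generic_mono frZ); [|exact H3]. intros p _ H. unfold S1t.
  now rewrite in_nk_sk, !in_n_sk.
Qed.

Lemma S1t_step_k k a : in_nk k -> in_n a ->
  wz_equiv lam (S1t k a) (S1t (fun p => k p + 1) a).
Proof.
  intros fk fa. assert (H := wz_shift_k lam _ _ (S1t_ratio_of_k k a fk fa)).
  replace (S1t (fun p => k p + 1) a) with (fun p => S1t k a (sk p)); [assumption|].
  apply functional_extensionality. intros p. unfold S1t.
  now rewrite in_nk_sk, !in_n_sk.
Qed.

Lemma S1t_step_a k a : in_nk k -> in_n a -> S1_admissible a ->
  wz_equiv lam (S1t k a) (S1t k (fun p => a p + 1)).
Proof.
  intros fk fa [A1 A2]. apply regular_nz in A1, A2.
  assert (rk : ratl (fr := frZ) (fun p => qp (k p))) by now apply ratl_in_nk.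
  assert (ra : ratl (fr := frZ) (fun p => qp (a p))) by now apply ratl_in_n.
  apply (wz_certificate lam) with (fun p => S1_ratio_a (k p) (a p) 0)
    (fun p => S1_ratio_k (k p) (a p) 0) (fun p => S1_cert_a (k p) (a p) 0).
  - apply (S1_ratio_of_a frZ k a (fun _ => 0)); first [assumption
      | apply (ratl_const frZ) | apply nz_in_nk; [assumption|form_tac]].
  - now apply S1t_ratio_of_k.
  - unfold S1_cert_a. ratl_tac.
  - assert (K1 : nz (fr := frZ) (fun p => 1 - 1 * qp (0 + k p)))
      by (apply nz_in_nk; [assumption|form_tac]).
    clear A2. generic_factors. intros.
    rewrite in_nk_sk, !in_n_sk by assumption.
    now apply S1_cert_a_correct.
Qed.

Lemma S1t_raise_a k a (n : nat) : in_nk k -> in_n a -> S1_admissible a ->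
  wz_equiv lam (S1t k a) (S1t k (fun p => a p + RtoC (INR n))).
Proof.
  intros fk fa [A1 A2]. apply (wz_raise lam (S1t k)). intros i _.
  apply (S1t_step_a k (fun p => a p + RtoC (INR i))); auto; [form_tac|].
  split; [eapply (regular_up lam 1 _ _ _ i); [|exact A1]
         |eapply (regular_up lam 1 _ _ _ i); [|exact A2]]; intros p; cbv beta; ring.
Qed.

Lemma S1t_admissible_or_zero k a : in_n a ->
  S1_admissible a \/ forall p, S1t k a p = 0.
Proof.
  intros fa.
  assert (D : forall g, regular lam 1 g (fun p => a p - 0 + 1)
    \/ forall p, P g (a p - 0 + 1) = 0).
  { intros g. apply (regular_or_Pq_zero lam Hq). form_tac. }
  destruct (D 1) as [A1|H].
  2: { right. intros p. unfold S1t, S1. rewrite H. ring. }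
  destruct (D z) as [A2|H].
  2: { right. intros p. unfold S1t, S1. rewrite H, Cinv_0. ring. }
  left. now split.
Qed.

Lemma S1_has_mate (K A : Z) (k0 a : C) :
  has_qWZ_mate lam (fun n k => S1 (link K k0 (n, k)) (lin A a (n, k)) 0).
Proof.
  assert (fk := in_nk_link K k0). assert (fk' := in_nk_link_sn K k0).
  assert (fl := in_n_lin). assert (fl' := in_n_lin_sn).
  destruct (S1t_admissible_or_zero (link K k0) (lin A a)) as [Ha|H0]; auto.
  2: { apply (mate_of_zero lam Hq). intros n k. exact (H0 (n, k)). }
  apply (mate_of_wz_equiv lam Hq).
  { eapply ratio_of_rat, (S1t_ratio_of_k (link K k0) (lin A a)); auto. }
  change (wz_equiv lam (S1t (link K k0) (lin A a))
    (S1t (fun p => link K k0 (sn p)) (fun p => lin A a (sn p)))).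
  assert (Ha' : S1_admissible (fun p => lin A a (sn p))).
  { destruct Ha as [A1 A2]. apply regular_sn in A1, A2. now split. }
  eapply wz_trans.
  { apply (S1t_raise_a (link K k0) _ (Z.to_nat (Z.abs A))); auto. }
  apply wz_sym. eapply wz_trans.
  { apply (S1t_raise_a (fun p => link K k0 (sn p)) _ (Z.to_nat (Z.abs A - A)));
      auto. }
  cbv beta. rewrite lin_sn_raise by lia.
  apply wz_sym, (wz_translate_k lam (fun k => S1t k _)) with K;
    auto using link_sn.
  intros k fk0. apply S1t_step_k; auto; form_tac; auto.
Qed.

Lemma seed1_seed : qWZ_seed lam 2 (seed1 lam mu).
Proof.
  split; [exact seed1_qhyper|].
  intros K As k0 ps HA Hp.
  destruct As as [|A [|B [|]]]; try discriminate HA.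
  destruct ps as [|a [|b [|]]]; try discriminate Hp.
  (* Slopes and offsets of k + b and a - b, as in [S1_translate]. *)
  eapply (has_mate_ext lam); [|apply (S1_has_mate (K + B) (A - B) (k0 + b) (a - b))].
  intros n k. unfold map, combine. rewrite seed1_S1, S1_translate.
  unfold link, lin. simpl fst. simpl snd.
  rewrite plus_IZR, minus_IZR, RtoC_plus, RtoC_minus. f_equal; ring.
Qed.

End Seed1.

(** * Seed (3') *)

Section Seed3.
Variable lam : C.
Hypothesis Hq : (Re lam < 0)%R.
Notation qp := (cpowL lam).
Notation Q := (Cexp lam).
Notation frZ := (frameZ2 lam).
Notation P := (Pq lam).
Notation v i := (fun xs : list C => @nth C i xs (RtoC 0)).

Definition Pq2 (l : C) : C := qpoch (1 * qp l) (Cexp (2 * lam)).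

Lemma Pq2_step l l' : l' = l + 2 -> Pq2 l = (1 - 1 * qp l) * Pq2 l'.
Proof. intros ->. apply (qpoch_cpowL_step lam Hq 2 1 l). lra. Qed.

Lemma Pq2_up l l' : l' = l + 2 -> 1 - 1 * qp l <> 0 ->
  Pq2 l' = Pq2 l / (1 - 1 * qp l).
Proof. intros H Hn. rewrite (Pq2_step l l' H). field. side_cond (1 : C). Qed.

Lemma Pq2_inv_step l l' : l' = l + 2 -> / Pq2 l = / (1 - 1 * qp l) * / Pq2 l'.
Proof. intros H. rewrite (Pq2_step l l' H). apply Cinv_mul. Qed.

Lemma Pq2_inv_up l l' : l' = l + 2 -> 1 - 1 * qp l <> 0 ->
  / Pq2 l' = (1 - 1 * qp l) * / Pq2 l.
Proof.
  intros H Hn. rewrite (Pq2_inv_step l l' H), Cmult_assoc, Cinv_r by assumption.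
  ring.
Qed.

(** The parameters enter doubled, so a unit shift moves a symbol in base q by two factors and a
    symbol in base q^2 by one. *)
Lemma Pq_up_2 g l l' : l' = l + 2 -> 1 - g * qp l <> 0 ->
  1 - g * qp (l + 1) <> 0 ->
  P g l' = P g l / ((1 - g * qp l) * (1 - g * qp (l + 1))).
Proof.
  intros H H1 H2.
  rewrite (Pq_up lam Hq g (l + 1) l'), (Pq_up lam Hq g l (l + 1))
    by (assumption || (rewrite ?H; ring)).
  field. now split.
Qed.

Lemma Pq_inv_up_2 g l l' : l' = l + 2 -> 1 - g * qp l <> 0 ->
  1 - g * qp (l + 1) <> 0 ->
  / P g l' = (1 - g * qp l) * (1 - g * qp (l + 1)) * / P g l.
Proof.
  intros H H1 H2.
  rewrite (Pq_inv_up lam Hq g (l + 1) l'), (Pq_inv_up lam Hq g l (l + 1))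
    by (assumption || (rewrite ?H; ring)).
  ring.
Qed.

Definition S3 (k a b c : C) : C :=
  mone_pow k * qp (2 * c * k + binom2 (2 * c) + 4 * b * c)
  * (P 1 (2 * c + 2 * a + k) * P 1 (2 * b + 2 * c + k)
     * (/ P 1 (2 * a + k) * / P 1 (2 * b + k)))
  * (P (- (1)) (2 * c) * / P 1 (2 * c))
  * (Pq2 (2 * a - 2 * b - 2 * c + 1) * / Pq2 (2 * a - 2 * b + 2 * c + 1)).

Lemma seed3_S3 k a b c : seed3 lam k (a :: b :: c :: nil) = S3 k a b c.
Proof.
  unfold seed3, S3, Pq, Pq2. simpl nth. unfold Cdiv.
  rewrite !Cinv_mul, !Cmult_1_l.
  replace (- (1) * qp (2 * c)) with (- qp (2 * c)) by ring. ring.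
Qed.

Definition S3_ratio_k (k a b c : C) : C :=
  - qp (2 * c) * (1 - 1 * qp (2 * a + k)) * (1 - 1 * qp (2 * b + k))
  / ((1 - 1 * qp (2 * c + 2 * a + k)) * (1 - 1 * qp (2 * b + 2 * c + k))).

Definition S3_ratio_a (k a b c : C) : C :=
  (1 - 1 * qp (2 * a + k)) * (1 - 1 * qp (2 * a + k + 1))
  * (1 - 1 * qp (2 * a - 2 * b + 2 * c + 1))
  / ((1 - 1 * qp (2 * c + 2 * a + k)) * (1 - 1 * qp (2 * c + 2 * a + k + 1))
     * (1 - 1 * qp (2 * a - 2 * b - 2 * c + 1))).

Definition S3_ratio_b (k a b c : C) : C :=
  qp (2 * c) * qp (2 * c)
  * ((1 - 1 * qp (2 * b + k)) * (1 - 1 * qp (2 * b + k + 1))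
     * (1 - 1 * qp (2 * a - 2 * b - 2 * c - 1)))
  / ((1 - 1 * qp (2 * b + 2 * c + k)) * (1 - 1 * qp (2 * b + 2 * c + k + 1))
     * (1 - 1 * qp (2 * a - 2 * b + 2 * c - 1))).

Definition S3_ratio_c (k a b c : C) : C :=
  qp k * qp k * Q * (qp (2 * c) * qp (2 * c)) * (qp (2 * b) * qp (2 * b))
  * ((1 - 1 * qp (2 * c)) * (1 - 1 * qp (2 * c + 1))
     * (1 - 1 * qp (2 * a - 2 * b - 2 * c - 1))
     * (1 - 1 * qp (2 * a - 2 * b + 2 * c + 1)))
  / ((1 - - (1) * qp (2 * c)) * (1 - - (1) * qp (2 * c + 1))
     * ((1 - 1 * qp (2 * c + 2 * a + k)) * (1 - 1 * qp (2 * c + 2 * a + k + 1))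
        * (1 - 1 * qp (2 * b + 2 * c + k))
        * (1 - 1 * qp (2 * b + 2 * c + k + 1)))).

(** At k + 1 the numerator cancels the denominator 1 - q^(2b+2c+k) of [S3_ratio_k], and the
    denominator supplies the second [k]-factor below [S3_ratio_a]. [S3_cert_b] has the roles of [a]
    and [b] exchanged here. *)
Definition S3_cert_a (k a b c : C) : C :=
  Q * qp (2 * a) / (qp (2 * b) * qp (2 * c)) * (qp (2 * c) - 1)
  / (1 - 1 * qp (2 * a - 2 * b - 2 * c + 1))
  * (1 - qp (2 * c) * qp (2 * b) * qp k / Q) / (1 - 1 * qp (2 * c + 2 * a + k)).

Definition S3_cert_b (k a b c : C) : C :=
  (1 - qp (2 * c)) / (1 - 1 * qp (2 * a - 2 * b + 2 * c - 1))
  * (1 - qp (2 * c) * qp (2 * a) * qp k / Q) / (1 - 1 * qp (2 * b + 2 * c + k)).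

(** Both denominators of [S3_ratio_k] also occur in [S3_ratio_c], so nothing has to cancel. A
    numerator quadratic in q^k matches the degree four of the identity after clearing
    denominators. *)
Definition S3_cert_c (k a b c : C) : C :=
  let x := qp k in let s := qp (2 * c) in
  let al := qp (2 * a) in let be := qp (2 * b) in
  (1 - (1 + Q) * s * s * (al + be) * x / (1 - - (1) * qp (2 * c + 1))
   + s * s * s * al * be * x * x)
  / ((1 - - (1) * qp (2 * c))
     * ((1 - 1 * qp (2 * c + 2 * a + k)) * (1 - 1 * qp (2 * b + 2 * c + k)))).

Lemma S3_shift_k k a b c :
  1 - 1 * qp (2 * a + k) <> 0 -> 1 - 1 * qp (2 * b + k) <> 0 ->
  1 - 1 * qp (2 * c + 2 * a + k) <> 0 -> 1 - 1 * qp (2 * b + 2 * c + k) <> 0 ->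
  S3 (k + 1) a b c = S3_ratio_k k a b c * S3 k a b c.
Proof.
  intros H1 H2 H3 H4. unfold S3, S3_ratio_k.
  rewrite (Pq_up lam Hq 1 (2 * c + 2 * a + k) (2 * c + 2 * a + (k + 1))),
    (Pq_up lam Hq 1 (2 * b + 2 * c + k) (2 * b + 2 * c + (k + 1))),
    (Pq_inv_up lam Hq 1 (2 * a + k) (2 * a + (k + 1))),
    (Pq_inv_up lam Hq 1 (2 * b + k) (2 * b + (k + 1))), mone_pow_S
    by (assumption || ring).
  replace (2 * c * (k + 1) + binom2 (2 * c) + 4 * b * c)
    with (2 * c + (2 * c * k + binom2 (2 * c) + 4 * b * c)) by ring.
  rewrite (cpowL_plus lam (2 * c)).
  unfold Cdiv. rewrite !Cinv_mul. ring.
Qed.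

Lemma S3_shift_a k a b c :
  1 - 1 * qp (2 * a + k) <> 0 -> 1 - 1 * qp (2 * a + k + 1) <> 0 ->
  1 - 1 * qp (2 * c + 2 * a + k) <> 0 ->
  1 - 1 * qp (2 * c + 2 * a + k + 1) <> 0 ->
  1 - 1 * qp (2 * a - 2 * b + 2 * c + 1) <> 0 ->
  1 - 1 * qp (2 * a - 2 * b - 2 * c + 1) <> 0 ->
  S3 k (a + 1) b c = S3_ratio_a k a b c * S3 k a b c.
Proof.
  intros H1 H2 H3 H4 H5 H6. unfold S3, S3_ratio_a.
  rewrite (Pq_up_2 1 (2 * c + 2 * a + k) (2 * c + 2 * (a + 1) + k)),
    (Pq_inv_up_2 1 (2 * a + k) (2 * (a + 1) + k)),
    (Pq2_up (2 * a - 2 * b - 2 * c + 1) (2 * (a + 1) - 2 * b - 2 * c + 1)),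
    (Pq2_inv_up (2 * a - 2 * b + 2 * c + 1) (2 * (a + 1) - 2 * b + 2 * c + 1))
    by (assumption || ring).
  unfold Cdiv. rewrite !Cinv_mul. ring.
Qed.

Lemma S3_shift_b k a b c :
  1 - 1 * qp (2 * b + k) <> 0 -> 1 - 1 * qp (2 * b + k + 1) <> 0 ->
  1 - 1 * qp (2 * b + 2 * c + k) <> 0 ->
  1 - 1 * qp (2 * b + 2 * c + k + 1) <> 0 ->
  S3 k a (b + 1) c = S3_ratio_b k a b c * S3 k a b c.
Proof.
  intros H1 H2 H3 H4. unfold S3, S3_ratio_b.
  replace (2 * a - 2 * (b + 1) - 2 * c + 1) with (2 * a - 2 * b - 2 * c - 1) by ring.
  replace (2 * a - 2 * (b + 1) + 2 * c + 1) with (2 * a - 2 * b + 2 * c - 1) by ring.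
  rewrite (Pq_up_2 1 (2 * b + 2 * c + k) (2 * (b + 1) + 2 * c + k)),
    (Pq_inv_up_2 1 (2 * b + k) (2 * (b + 1) + k)),
    (Pq2_step (2 * a - 2 * b - 2 * c - 1) (2 * a - 2 * b - 2 * c + 1)),
    (Pq2_inv_step (2 * a - 2 * b + 2 * c - 1) (2 * a - 2 * b + 2 * c + 1))
    by (assumption || ring).
  replace (2 * c * k + binom2 (2 * c) + 4 * (b + 1) * c)
    with (2 * c + 2 * c + (2 * c * k + binom2 (2 * c) + 4 * b * c)) by ring.
  rewrite (cpowL_plus lam (2 * c + 2 * c)), (cpowL_plus lam (2 * c)).
  unfold Cdiv. rewrite !Cinv_mul. ring.
Qed.

Lemma S3_shift_c k a b c :
  1 - 1 * qp (2 * c) <> 0 -> 1 - 1 * qp (2 * c + 1) <> 0 ->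
  1 - - (1) * qp (2 * c) <> 0 -> 1 - - (1) * qp (2 * c + 1) <> 0 ->
  1 - 1 * qp (2 * c + 2 * a + k) <> 0 ->
  1 - 1 * qp (2 * c + 2 * a + k + 1) <> 0 ->
  1 - 1 * qp (2 * b + 2 * c + k) <> 0 ->
  1 - 1 * qp (2 * b + 2 * c + k + 1) <> 0 ->
  1 - 1 * qp (2 * a - 2 * b + 2 * c + 1) <> 0 ->
  S3 k a b (c + 1) = S3_ratio_c k a b c * S3 k a b c.
Proof.
  intros H1 H2 H3 H4 H5 H6 H7 H8 H9. unfold S3, S3_ratio_c.
  replace (2 * a - 2 * b - 2 * (c + 1) + 1) with (2 * a - 2 * b - 2 * c - 1) by ring.
  rewrite (Pq_up_2 1 (2 * c + 2 * a + k) (2 * (c + 1) + 2 * a + k)),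
    (Pq_up_2 1 (2 * b + 2 * c + k) (2 * b + 2 * (c + 1) + k)),
    (Pq_up_2 (- (1)) (2 * c) (2 * (c + 1))),
    (Pq_inv_up_2 1 (2 * c) (2 * (c + 1))),
    (Pq2_step (2 * a - 2 * b - 2 * c - 1) (2 * a - 2 * b - 2 * c + 1)),
    (Pq2_inv_up (2 * a - 2 * b + 2 * c + 1) (2 * a - 2 * b + 2 * (c + 1) + 1))
    by (assumption || ring).
  (* The exponent grows by 2k + 4b + 4c + 1, where 4c + 1 is binom(2c+2,2) - binom(2c,2). *)
  replace (2 * (c + 1) * k + binom2 (2 * (c + 1)) + 4 * b * (c + 1))
    with (k + k + 1 + (2 * c + 2 * c) + (2 * b + 2 * b)
          + (2 * c * k + binom2 (2 * c) + 4 * b * c))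
    by (unfold binom2; field).
  rewrite (cpowL_plus lam (k + k + 1 + (2 * c + 2 * c) + (2 * b + 2 * b))),
    (cpowL_plus lam (k + k + 1 + (2 * c + 2 * c))), (cpowL_plus lam (k + k + 1)),
    (cpowL_plus lam (k + k)), (cpowL_plus lam k), (cpowL_plus lam (2 * c) (2 * c)),
    (cpowL_plus lam (2 * b) (2 * b)), cpowL_1.
  unfold Cdiv. rewrite !Cinv_mul. ring.
Qed.

Ltac abstract_powers a b c k :=
  autorewrite with cpow in *;
  assert (Ha := cpowL_neq0 lam (2 * a)); assert (Hb := cpowL_neq0 lam (2 * b));
  assert (Hc := cpowL_neq0 lam (2 * c)); assert (Hk := cpowL_neq0 lam k);
  assert (HQ := Cexp_neq0 lam);
  set (A := qp (2 * a)) in *; set (B := qp (2 * b)) in *;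
  set (s := qp (2 * c)) in *; set (x := qp k) in *; set (q := Q) in *;
  clearbody A B s x q.

Lemma S3_cert_a_correct k a b c :
  1 - 1 * qp (2 * c + 2 * a + k) <> 0 ->
  1 - 1 * qp (2 * c + 2 * a + k + 1) <> 0 -> 1 - 1 * qp (2 * b + 2 * c + k) <> 0 ->
  1 - 1 * qp (2 * a - 2 * b - 2 * c + 1) <> 0 ->
  S3_ratio_a k a b c - 1
  = S3_cert_a (k + 1) a b c * S3_ratio_k k a b c - S3_cert_a k a b c.
Proof.
  intros H1 H2 H3 H4. unfold S3_ratio_a, S3_cert_a, S3_ratio_k.
  abstract_powers a b c k.
  field. repeat split; side_cond (1 : C) || side_cond (B * s).
Qed.

Lemma S3_cert_b_correct k a b c :
  1 - 1 * qp (2 * c + 2 * a + k) <> 0 -> 1 - 1 * qp (2 * b + 2 * c + k) <> 0 ->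
  1 - 1 * qp (2 * b + 2 * c + k + 1) <> 0 ->
  1 - 1 * qp (2 * a - 2 * b + 2 * c - 1) <> 0 ->
  S3_ratio_b k a b c - 1
  = S3_cert_b (k + 1) a b c * S3_ratio_k k a b c - S3_cert_b k a b c.
Proof.
  intros H1 H2 H3 H4. unfold S3_ratio_b, S3_cert_b, S3_ratio_k.
  abstract_powers a b c k.
  field. repeat split; side_cond (1 : C) || side_cond (B * q).
Qed.

Lemma S3_cert_c_correct k a b c :
  1 - 1 * qp (2 * c + 2 * a + k) <> 0 ->
  1 - 1 * qp (2 * c + 2 * a + k + 1) <> 0 -> 1 - 1 * qp (2 * b + 2 * c + k) <> 0 ->
  1 - 1 * qp (2 * b + 2 * c + k + 1) <> 0 ->
  1 - - (1) * qp (2 * c) <> 0 -> 1 - - (1) * qp (2 * c + 1) <> 0 ->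
  S3_ratio_c k a b c - 1
  = S3_cert_c (k + 1) a b c * S3_ratio_k k a b c - S3_cert_c k a b c.
Proof.
  intros H1 H2 H3 H4 H5 H6. unfold S3_ratio_c, S3_cert_c, S3_ratio_k.
  abstract_powers a b c k.
  field. repeat split; side_cond (1 : C).
Qed.

Section S3_frame.
Variable fr : frame.
Variables k a b c : pt fr -> C.
Hypothesis rk : ratl (fun x => qp (k x)).
Hypothesis ra : ratl (fun x => qp (a x)).
Hypothesis rb : ratl (fun x => qp (b x)).
Hypothesis rc : ratl (fun x => qp (c x)).

Lemma S3_ratio_of_k :
  nz (fun x => 1 - 1 * qp (2 * a x + k x)) ->
  nz (fun x => 1 - 1 * qp (2 * b x + k x)) ->
  nz (fun x => 1 - 1 * qp (2 * c x + 2 * a x + k x)) ->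
  nz (fun x => 1 - 1 * qp (2 * b x + 2 * c x + k x)) ->
  ratio_of (fun x => S3 (k x + 1) (a x) (b x) (c x))
    (fun x => S3 (k x) (a x) (b x) (c x))
    (fun x => S3_ratio_k (k x) (a x) (b x) (c x)).
Proof.
  intros H1 H2 H3 H4. unfold S3_ratio_k at 1.
  split; [ratl_tac|split; [unfold S3_ratio_k; ratl_tac|]].
  generic_factors. intros. now apply S3_shift_k.
Qed.

Lemma S3_ratio_of_a :
  nz (fun x => 1 - 1 * qp (2 * a x + k x)) ->
  nz (fun x => 1 - 1 * qp (2 * a x + k x + 1)) ->
  nz (fun x => 1 - 1 * qp (2 * c x + 2 * a x + k x)) ->
  nz (fun x => 1 - 1 * qp (2 * c x + 2 * a x + k x + 1)) ->
  nz (fun x => 1 - 1 * qp (2 * a x - 2 * b x + 2 * c x + 1)) ->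
  nz (fun x => 1 - 1 * qp (2 * a x - 2 * b x - 2 * c x + 1)) ->
  ratio_of (fun x => S3 (k x) (a x + 1) (b x) (c x))
    (fun x => S3 (k x) (a x) (b x) (c x))
    (fun x => S3_ratio_a (k x) (a x) (b x) (c x)).
Proof.
  intros H1 H2 H3 H4 H5 H6. unfold S3_ratio_a at 1.
  split; [ratl_tac|split; [unfold S3_ratio_a; ratl_tac|]].
  generic_factors. intros. now apply S3_shift_a.
Qed.

Lemma S3_ratio_of_b :
  nz (fun x => 1 - 1 * qp (2 * b x + k x)) ->
  nz (fun x => 1 - 1 * qp (2 * b x + k x + 1)) ->
  nz (fun x => 1 - 1 * qp (2 * b x + 2 * c x + k x)) ->
  nz (fun x => 1 - 1 * qp (2 * b x + 2 * c x + k x + 1)) ->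
  nz (fun x => 1 - 1 * qp (2 * a x - 2 * b x - 2 * c x - 1)) ->
  nz (fun x => 1 - 1 * qp (2 * a x - 2 * b x + 2 * c x - 1)) ->
  ratio_of (fun x => S3 (k x) (a x) (b x + 1) (c x))
    (fun x => S3 (k x) (a x) (b x) (c x))
    (fun x => S3_ratio_b (k x) (a x) (b x) (c x)).
Proof.
  intros H1 H2 H3 H4 H5 H6. unfold S3_ratio_b at 1.
  split; [ratl_tac|split; [unfold S3_ratio_b; ratl_tac|]].
  generic_factors. intros. now apply S3_shift_b.
Qed.

Lemma S3_ratio_of_c :
  nz (fun x => 1 - 1 * qp (2 * c x)) -> nz (fun x => 1 - 1 * qp (2 * c x + 1)) ->
  nz (fun x => 1 - - (1) * qp (2 * c x)) ->
  nz (fun x => 1 - - (1) * qp (2 * c x + 1)) ->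
  nz (fun x => 1 - 1 * qp (2 * c x + 2 * a x + k x)) ->
  nz (fun x => 1 - 1 * qp (2 * c x + 2 * a x + k x + 1)) ->
  nz (fun x => 1 - 1 * qp (2 * b x + 2 * c x + k x)) ->
  nz (fun x => 1 - 1 * qp (2 * b x + 2 * c x + k x + 1)) ->
  nz (fun x => 1 - 1 * qp (2 * a x - 2 * b x - 2 * c x - 1)) ->
  nz (fun x => 1 - 1 * qp (2 * a x - 2 * b x + 2 * c x + 1)) ->
  ratio_of (fun x => S3 (k x) (a x) (b x) (c x + 1))
    (fun x => S3 (k x) (a x) (b x) (c x))
    (fun x => S3_ratio_c (k x) (a x) (b x) (c x)).
Proof.
  intros H1 H2 H3 H4 H5 H6 H7 H8 H9 H10. unfold S3_ratio_c at 1.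
  split; [ratl_tac|split; [unfold S3_ratio_c; ratl_tac|]].
  generic_factors. intros. now apply S3_shift_c.
Qed.

End S3_frame.

Lemma seed3_qhyper : qhyper lam 4 (fun xs => seed3 lam (hd (RtoC 0) xs) (tl xs)).
Proof.
  (* In the order k, a, b, c: a - b dominates c, which keeps 2a-2b-2c-1 positive. *)
  set (x0 := (1 : C) :: (100 : C) :: (10 : C) :: (1 : C) :: nil).
  apply (qhyper_of_rat lam x0).
  intros [|[|[|[|i]]]] Hi; [..|simpl in Hi; lia].
  - by_shift seed3_S3
      (S3_ratio_of_k (frameC lam x0) (v 0%nat) (v 1%nat) (v 2%nat) (v 3%nat)).
  - by_shift seed3_S3
      (S3_ratio_of_a (frameC lam x0) (v 0%nat) (v 1%nat) (v 2%nat) (v 3%nat)).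
  - by_shift seed3_S3
      (S3_ratio_of_b (frameC lam x0) (v 0%nat) (v 1%nat) (v 2%nat) (v 3%nat)).
  - by_shift seed3_S3
      (S3_ratio_of_c (frameC lam x0) (v 0%nat) (v 1%nat) (v 2%nat) (v 3%nat)).
Qed.

(** * Mates for seed (3') *)

Definition S3_admissible (a b c : Z * Z -> C) : Prop :=
  regular lam 2 1 (fun p => 2 * a p - 2 * b p - 2 * c p + 1)
  /\ regular lam 2 1 (fun p => 2 * a p - 2 * b p + 2 * c p + 1).

(** The two forms rise by 2(i+j-m) and 2(i+j+m). The surplus i + j in a - b thus allows [c] to move
    by [m] in either direction. *)
Lemma S3_admissible_up a b c a' b' c' (i j : nat) (m : Z) :
  (forall p, a' p = a p + RtoC (INR i)) -> (forall p, b' p = b p - RtoC (INR j)) ->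
  (forall p, c' p = c p + RtoC (IZR m)) -> (Z.abs m <= Z.of_nat (i + j))%Z ->
  S3_admissible a b c -> S3_admissible a' b' c'.
Proof.
  intros Ha Hb Hc Hm [A1 A2].
  assert (E : forall n, (0 <= n)%Z ->
    RtoC (INR (Z.to_nat n)) = RtoC (IZR n)) by exact RtoC_INR_to_nat.
  assert (EN : forall n, RtoC (INR n) = RtoC (IZR (Z.of_nat n)))
    by (intros; now rewrite INR_IZR_INZ).
  split;
  [ eapply (regular_up lam 2 _ _ _ (Z.to_nat (Z.of_nat (i + j) - m))); [|exact A1]
  | eapply (regular_up lam 2 _ _ _ (Z.to_nat (Z.of_nat (i + j) + m))); [|exact A2] ];
  intros p; rewrite Ha, Hb, Hc, E, !EN by lia; rewrite ?minus_IZR, ?plus_IZR,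
    Nat2Z.inj_add, plus_IZR, ?RtoC_minus, ?RtoC_plus; ring.
Qed.

Definition S3t (k a b c : Z * Z -> C) (p : Z * Z) : C :=
  S3 (k p) (a p) (b p) (c p).

Section S3_integer.
Variables k a b c : Z * Z -> C.
Hypothesis fk : in_nk k.
Hypothesis fa : in_n a.
Hypothesis fb : in_n b.
Hypothesis fc : in_n c.

Lemma S3t_ratl :
  ratl (fr := frZ) (fun p => qp (k p)) /\ ratl (fr := frZ) (fun p => qp (a p)) /\
  ratl (fr := frZ) (fun p => qp (b p)) /\ ratl (fr := frZ) (fun p => qp (c p)).
Proof. auto using ratl_in_n, ratl_in_nk. Qed.

Lemma S3t_nz :
  nz (fr := frZ) (fun p => 1 - 1 * qp (2 * c p + 2 * a p + k p)) /\
  nz (fr := frZ) (fun p => 1 - 1 * qp (2 * c p + 2 * a p + k p + 1)) /\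
  nz (fr := frZ) (fun p => 1 - 1 * qp (2 * b p + 2 * c p + k p)) /\
  nz (fr := frZ) (fun p => 1 - 1 * qp (2 * b p + 2 * c p + k p + 1)).
Proof. repeat split; apply nz_in_nk; (assumption || form_tac). Qed.

Lemma S3t_ratio_of_k :
  ratio_of (fr := frZ) (fun p => S3t k a b c (sk p)) (S3t k a b c)
    (fun p => S3_ratio_k (k p) (a p) (b p) (c p)).
Proof.
  destruct S3t_ratl as [rk [ra [rb rc]]].
  assert (H : ratio_of (fr := frZ) (fun p => S3 (k p + 1) (a p) (b p) (c p))
    (fun p => S3 (k p) (a p) (b p) (c p))
    (fun p => S3_ratio_k (k p) (a p) (b p) (c p))).
  { apply (S3_ratio_of_k frZ); first [assumption
      | apply nz_in_nk; [assumption|form_tac]]. }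
  destruct H as [H1 [H2 H3]]. split; [assumption|split; [assumption|]].
  eapply (generic_mono frZ); [|exact H3]. intros p _ H. unfold S3t.
  now rewrite in_nk_sk, !in_n_sk.
Qed.

Lemma S3t_step_k : wz_equiv lam (S3t k a b c) (S3t (fun p => k p + 1) a b c).
Proof.
  assert (H := wz_shift_k lam _ _ S3t_ratio_of_k).
  replace (S3t (fun p => k p + 1) a b c) with (fun p => S3t k a b c (sk p));
    [assumption|].
  apply functional_extensionality. intros p. unfold S3t.
  now rewrite in_nk_sk, !in_n_sk.
Qed.

Lemma S3t_step_a : S3_admissible a b c ->
  wz_equiv lam (S3t k a b c) (S3t k (fun p => a p + 1) b c).
Proof.
  intros [A1 A2]. apply regular_nz in A1, A2.
  destruct S3t_ratl as [rk [ra [rb rc]]].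
  destruct S3t_nz as [N1 [N2 [N3 N4]]].
  apply (wz_certificate lam) with
    (fun p => S3_ratio_a (k p) (a p) (b p) (c p))
    (fun p => S3_ratio_k (k p) (a p) (b p) (c p))
    (fun p => S3_cert_a (k p) (a p) (b p) (c p)).
  - apply (S3_ratio_of_a frZ); first [assumption
      | apply nz_in_nk; [assumption|form_tac]].
  - exact S3t_ratio_of_k.
  - unfold S3_cert_a. ratl_tac.
  - clear A2 N4. generic_factors. intros.
    rewrite in_nk_sk, !in_n_sk by assumption.
    now apply S3_cert_a_correct.
Qed.

Lemma S3t_step_b : S3_admissible a (fun p => b p + 1) c ->
  wz_equiv lam (S3t k a b c) (S3t k a (fun p => b p + 1) c).
Proof.
  intros [A1 A2]. apply regular_nz in A1, A2.
  destruct S3t_ratl as [rk [ra [rb rc]]].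
  destruct S3t_nz as [N1 [N2 [N3 N4]]].
  assert (B1 : nz (fr := frZ)
      (fun p => 1 - 1 * qp (2 * a p - 2 * b p - 2 * c p - 1)))
    by (eapply (nz_ext frZ); [|exact A1]; intros; simpl; do 3 f_equal; ring).
  assert (B2 : nz (fr := frZ)
      (fun p => 1 - 1 * qp (2 * a p - 2 * b p + 2 * c p - 1)))
    by (eapply (nz_ext frZ); [|exact A2]; intros; simpl; do 3 f_equal; ring).
  clear A1 A2.
  apply (wz_certificate lam) with
    (fun p => S3_ratio_b (k p) (a p) (b p) (c p))
    (fun p => S3_ratio_k (k p) (a p) (b p) (c p))
    (fun p => S3_cert_b (k p) (a p) (b p) (c p)).
  - apply (S3_ratio_of_b frZ); first [assumption
      | apply nz_in_nk; [assumption|form_tac]].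
  - exact S3t_ratio_of_k.
  - unfold S3_cert_b. ratl_tac.
  - clear B1 N2. generic_factors. intros.
    rewrite in_nk_sk, !in_n_sk by assumption.
    now apply S3_cert_b_correct.
Qed.

(** The forms move in opposite directions, so each is controlled at the end where it is smaller:
    2a-2b+2c+1 at [c], 2a-2b-2c+1 at [c + 1]. The nonzero slope of [c] keeps the factors at q^(2c)
    and -q^(2c) generically nonzero. *)
Lemma S3t_step_c : (exists u, u <> 0%Z /\ affine u 0 c) ->
  S3_admissible a b c -> S3_admissible a b (fun p => c p + 1) ->
  wz_equiv lam (S3t k a b c) (S3t k a b (fun p => c p + 1)).
Proof.
  intros [u [Hu [l Hc]]] [_ A2] [A1 _]. apply regular_nz in A1, A2.
  destruct S3t_ratl as [rk [ra [rb rc]]].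
  destruct S3t_nz as [N1 [N2 [N3 N4]]].
  assert (B1 : nz (fr := frZ)
      (fun p => 1 - 1 * qp (2 * a p - 2 * b p - 2 * c p - 1)))
    by (eapply (nz_ext frZ); [|exact A1]; intros; simpl; do 3 f_equal; ring).
  clear A1.
  assert (K : forall g, nz (fr := frZ) (fun p => 1 - g * qp (2 * c p))).
  { intros g. apply (nz_affine lam Hq g (2 * u) 0); [|left; lia].
    exists (2 * l). intros p. rewrite Hc, mult_IZR, RtoC_mult. ring. }
  assert (K' : forall g, nz (fr := frZ) (fun p => 1 - g * qp (2 * c p + 1))).
  { intros g. apply (nz_affine lam Hq g (2 * u) 0); [|left; lia].
    exists (2 * l + 1). intros p. rewrite Hc, mult_IZR, RtoC_mult. ring. }
  assert (M1 := K (- (1))). assert (M2 := K' (- (1))).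
  apply (wz_certificate lam) with
    (fun p => S3_ratio_c (k p) (a p) (b p) (c p))
    (fun p => S3_ratio_k (k p) (a p) (b p) (c p))
    (fun p => S3_cert_c (k p) (a p) (b p) (c p)).
  - now apply (S3_ratio_of_c frZ).
  - exact S3t_ratio_of_k.
  - unfold S3_cert_c. ratl_tac.
  - clear B1 A2 K K'. generic_factors. intros.
    rewrite in_nk_sk, !in_n_sk by assumption.
    now apply S3_cert_c_correct.
Qed.

End S3_integer.

Lemma S3t_to_top k a b c (i j : nat) :
  in_nk k -> in_n a -> in_n b -> in_n c -> S3_admissible a b c ->
  wz_equiv lam (S3t k a b c)
    (S3t k (fun p => a p + RtoC (INR i)) (fun p => b p - RtoC (INR j)) c).
Proof.
  intros fk fa fb fc H.
  eapply wz_trans.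
  - apply (wz_raise lam (fun a => S3t k a b c) a i). intros n _.
    apply (S3t_step_a k (fun p => a p + RtoC (INR n))); auto; [form_tac|].
    eapply (S3_admissible_up a b c _ _ _ n 0 0); [..|exact H];
      (lia || (intros p; simpl; ring)).
  - apply (wz_lower lam (fun b => S3t k (fun p => a p + RtoC (INR i)) b c) b).
    intros n.
    apply (S3t_step_b k _ (fun p => b p - RtoC (INR (S n)))); auto;
      [form_tac|form_tac|].
    eapply (S3_admissible_up a b c _ _ _ i n 0); [..|exact H];
      (lia || (intros p; rewrite ?S_INR, ?RtoC_plus; ring)).
Qed.

Lemma S3t_raise_c k a b c (n : nat) : in_nk k -> in_n a -> in_n b -> in_n c ->
  (exists u, u <> 0%Z /\ affine u 0 c) ->
  (forall i, (i <= n)%nat -> S3_admissible a b (fun p => c p + RtoC (INR i))) ->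
  wz_equiv lam (S3t k a b c) (S3t k a b (fun p => c p + RtoC (INR n))).
Proof.
  intros fk fa fb fc [u [Hu [l Hc]]] H. apply wz_raise. intros i Hi.
  apply (S3t_step_c k a b (fun p => c p + RtoC (INR i))); auto.
  - form_tac.
  - exists u. split; [assumption|]. exists (l + RtoC (INR i)).
    intros p. rewrite Hc. ring.
  - apply H. lia.
  - replace (fun p => c p + RtoC (INR i) + 1)
      with (fun p => c p + RtoC (INR (S i))); [apply H; lia|].
    apply functional_extensionality; intros p. rewrite S_INR, RtoC_plus. ring.
Qed.

Lemma S3t_admissible_or_zero k a b c : in_n a -> in_n b -> in_n c ->
  S3_admissible a b c \/ forall p, S3t k a b c p = 0.
Proof.
  intros fa fb fc.
  assert (H2 : (0 < 2)%R) by lra.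
  destruct (regular_or_vanishing lam Hq 2 1
    (fun p => 2 * a p - 2 * b p - 2 * c p + 1) H2) as [A1|H]; [form_tac| |].
  2: { right. intros p. unfold S3t, S3, Pq2. rewrite H. ring. }
  destruct (regular_or_vanishing lam Hq 2 1
    (fun p => 2 * a p - 2 * b p + 2 * c p + 1) H2) as [A2|H]; [form_tac| |].
  2: { right. intros p. unfold S3t, S3, Pq2. rewrite H, Cinv_0. ring. }
  left. now split.
Qed.

(* The constant numerators and denominators grow with [a - b], so that [c] is
   changed where [a - b] is large. *)
Lemma S3_has_mate (K A B C0 : Z) (k0 a b c : C) :
  has_qWZ_mate lam (fun n k => S3 (link K k0 (n, k)) (lin A a (n, k))
    (lin B b (n, k)) (lin C0 c (n, k))).
Proof.
  assert (fk := in_nk_link K k0). assert (fk' := in_nk_link_sn K k0).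
  assert (fl := in_n_lin). assert (fl' := in_n_lin_sn).
  destruct (S3t_admissible_or_zero (link K k0) (lin A a) (lin B b) (lin C0 c))
    as [Ha|H0]; auto.
  2: { apply (mate_of_zero lam Hq). intros n k. exact (H0 (n, k)). }
  apply (mate_of_wz_equiv lam Hq).
  { eapply ratio_of_rat, (S3t_ratio_of_k (link K k0) (lin A a) (lin B b)
      (lin C0 c)); auto. }
  change (wz_equiv lam (S3t (link K k0) (lin A a) (lin B b) (lin C0 c))
    (S3t (fun p => link K k0 (sn p)) (fun p => lin A a (sn p))
       (fun p => lin B b (sn p)) (fun p => lin C0 c (sn p)))).
  assert (Ha' : S3_admissible (fun p => lin A a (sn p)) (fun p => lin B b (sn p))
    (fun p => lin C0 c (sn p))).
  { destruct Ha as [A1 A2]. apply regular_sn in A1, A2. now split. }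
  set (M := (Z.abs A + Z.abs B + Z.abs C0)%Z).
  eapply wz_trans.
  { apply (S3t_to_top (link K k0) _ _ _ (Z.to_nat M) (Z.to_nat M)); auto. }
  apply wz_sym. eapply wz_trans.
  { apply (S3t_to_top (fun p => link K k0 (sn p)) _ _ _ (Z.to_nat (M - A))
      (Z.to_nat (M + B))); auto. }
  cbv beta. rewrite lin_sn_raise, lin_sn_lower by lia.
  set (a1 := fun p => lin A a p + RtoC (INR (Z.to_nat M))).
  set (b1 := fun p => lin B b p - RtoC (INR (Z.to_nat M))).
  assert (fa1 : in_n a1) by (unfold a1; form_tac; auto).
  assert (fb1 : in_n b1) by (unfold b1; form_tac; auto).
  apply wz_trans with (S3t (link K k0) a1 b1 (fun p => lin C0 c (sn p))).
  { apply wz_sym, (wz_translate_k lam (fun k => S3t k a1 b1 _)) with K;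
      auto using link_sn.
    intros k fk0. apply S3t_step_k; auto. }
  (* Raising [a] and lowering [b] by [M] each leaves a surplus 2M, at least the modulus of [C0], so
     every intermediate [c] is admissible. *)
  assert (Hadm : forall c' m, (Z.abs m <= Z.abs C0)%Z ->
    (forall p, c' p = lin C0 c p + RtoC (IZR m)) -> S3_admissible a1 b1 c').
  { intros c' m Hm Hc'.
    eapply (S3_admissible_up _ _ _ _ _ _ (Z.to_nat M) (Z.to_nat M) m);
      [..|exact Ha]; unfold a1, b1; auto; lia. }
  (* [c] is raised from its smaller end to its larger one, so the sign of [C0] decides the
     direction. For [C0 = 0] the two terms coincide. *)
  destruct (Z.lt_trichotomy C0 0) as [HC|[HC|HC]].
  - assert (E : (fun p => lin C0 c (sn p) + RtoC (INR (Z.to_nat (- C0))))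
      = lin C0 c).
    { apply functional_extensionality; intros p.
      rewrite lin_sn, RtoC_INR_to_nat, opp_IZR, RtoC_opp by lia. ring. }
    assert (H := S3t_raise_c (link K k0) a1 b1 (fun p => lin C0 c (sn p))
      (Z.to_nat (- C0)) fk fa1 fb1 (fl' C0 c)).
    cbv beta in H. rewrite E in H. apply H.
    + exists C0. split; [lia|]. exists (RtoC (IZR C0) + c). intros p.
      rewrite lin_sn. unfold lin. ring.
    + intros i Hi. apply (Hadm _ (C0 + Z.of_nat i)%Z); [lia|].
      intros p. rewrite lin_sn, plus_IZR, <- INR_IZR_INZ, RtoC_plus. ring.
  - subst C0. replace (fun p => lin 0 c (sn p)) with (lin 0 c); [apply wz_refl|].
    apply functional_extensionality; intros p. rewrite lin_sn. ring.
  - assert (E : (fun p => lin C0 c p + RtoC (INR (Z.to_nat C0)))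
      = (fun p => lin C0 c (sn p))).
    { apply functional_extensionality; intros p.
      now rewrite lin_sn, RtoC_INR_to_nat by lia. }
    assert (H := S3t_raise_c (link K k0) a1 b1 (lin C0 c)
      (Z.to_nat C0) fk fa1 fb1 (fl C0 c)).
    cbv beta in H. rewrite E in H. apply wz_sym, H.
    + exists C0. split; [lia|]. exists c. intros p. unfold lin. ring.
    + intros i Hi. apply (Hadm _ (Z.of_nat i)); [lia|].
      intros p. now rewrite <- INR_IZR_INZ.
Qed.

Lemma seed3_seed : qWZ_seed lam 3 (seed3 lam).
Proof.
  split; [exact seed3_qhyper|].
  intros K As k0 ps HA Hp.
  destruct As as [|A [|B [|C0 [|]]]]; try discriminate HA.
  destruct ps as [|a [|b [|c [|]]]]; try discriminate Hp.
  eapply (has_mate_ext lam); [|apply (S3_has_mate K A B C0 k0 a b c)].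
  intros n k. apply seed3_S3.
Qed.

End Seed3.

(* q = Cexp lam (so 0 < |q| < 1 iff Re lam < 0; lam fixes the branch of
   q^x), z = Cexp mu (so z <> 0; mu fixes the branch of z^x). *)
Theorem theorem3 (lam mu : C) (Hq : (Re lam < 0)%R) :
  qWZ_seed lam 2 (seed1 lam mu) /\
  qWZ_seed lam 4 (seed2 lam) /\
  qWZ_seed lam 3 (seed3 lam) /\
  qWZ_seed lam 5 (seed4 lam).
Proof.
  split; [now apply seed1_seed|]. split; [now apply seed2_seed|].
  split; [now apply seed3_seed|now apply seed4_seed].
Qed.
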